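(* A finite simple graph $G$ is free-planar if and only if neither $K_5^-$ nor $K_{3,3}^-$ is a minor of $G$. In symbols, $Free(Planar) = N_{\circ}(K_5^-, K_{3,3}^-)$.
   Context: Graphs are finite and simple, considered up to isomorphism. $H$ is a minor of $G$, written $H \prec G$, if $H$ can be obtained from $G$ by vertex deletions, edge deletions and edge contractions (every graph is a minor of itself). For a set $B$ of graphs, $N_{\circ}(B) = \{G : H \not\prec G \text{ for all } H \in B\}$. $Planar$ is the class of planar graphs. A planar graph $G$ is called free-planar if for every pair $e$ of distinct non-adjacent vertices of $G$ the graph $G+e$, obtained by adding $e$ as an edge, is again planar; $Free(Planar)$ is the class of free-planar graphs. $K_5^-$ and $K_{3,3}^-$ are the graphs obtained from $K_5$ and $K_{3,3}$, respectively, by deleting one edge. *)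

(* Defs.v *)
From HB Require Import structures.
From mathcomp Require Import all_boot all_order all_algebra.
From mathcomp Require Import classical_sets reals topology normedtype.

Set Implicit Arguments.
Unset Strict Implicit.
Unset Printing Implicit Defensive.

Import Order.TTheory GRing.Theory Num.Theory.
Import numFieldNormedType.Exports.

Local Open Scope classical_set_scope.

Record sgraph := SGraph {
  vertex :> finType;
  adj : rel vertex;
  adj_sym : symmetric adj;
  adj_irrefl : irreflexive adj }.

Definition giso (G H : sgraph) : Prop :=
  exists f : G -> H, bijective f /\ forall x y, adj (f x) (f y) = adj x y.

Definition same_pair (T : eqType) (u v x y : T) : bool :=
  ((x == u) && (y == v)) || ((x == v) && (y == u)).

Lemma same_pair_sym (T : eqType) (u v x y : T) :
  same_pair u v x y = same_pair u v y x.
Proof. by rewrite /same_pair orbC andbC [(y == v) && _]andbC. Qed.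

(* For u = v this returns G itself. *)
Section AddEdge.
Variables (G : sgraph) (u v : G).
Definition add_edge_rel : rel G :=
  [rel x y | (x != y) && (adj x y || same_pair u v x y)].
Lemma add_edge_sym : symmetric add_edge_rel.
Proof. by move=> x y; rewrite /add_edge_rel /= eq_sym adj_sym same_pair_sym. Qed.
Lemma add_edge_irrefl : irreflexive add_edge_rel.
Proof. by move=> x; rewrite /add_edge_rel /= eqxx. Qed.
Definition add_edge : sgraph := SGraph add_edge_sym add_edge_irrefl.
End AddEdge.

Section DelEdge.
Variables (G : sgraph) (u v : G).
Definition del_edge_rel : rel G :=
  [rel x y | adj x y && ~~ same_pair u v x y].
Lemma del_edge_sym : symmetric del_edge_rel.
Proof. by move=> x y; rewrite /del_edge_rel /= adj_sym same_pair_sym. Qed.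
Lemma del_edge_irrefl : irreflexive del_edge_rel.
Proof. by move=> x; rewrite /del_edge_rel /= adj_irrefl. Qed.
Definition del_edge : sgraph := SGraph del_edge_sym del_edge_irrefl.
End DelEdge.

Section DelVertex.
Variables (G : sgraph) (v : G).
Definition del_vertex_rel : rel {x : G | x != v} :=
  [rel x y | adj (val x) (val y)].
Lemma del_vertex_sym : symmetric del_vertex_rel.
Proof. by move=> x y; rewrite /del_vertex_rel /= adj_sym. Qed.
Lemma del_vertex_irrefl : irreflexive del_vertex_rel.
Proof. by move=> x; rewrite /del_vertex_rel /= adj_irrefl. Qed.
Definition del_vertex : sgraph := SGraph del_vertex_sym del_vertex_irrefl.
End DelVertex.

(* The vertex v is merged into u: the vertices are those of G other than v,
   and u represents the contracted edge. Loops and parallel edges disappear. *)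
Section Contract.
Variables (G : sgraph) (u v : G).
Definition contract_rel : rel {x : G | x != v} :=
  [rel x y | (x != y) &&
     [|| adj (val x) (val y),
         (val x == u) && adj v (val y) |
         (val y == u) && adj v (val x)]].
Lemma contract_sym : symmetric contract_rel.
Proof. by move=> x y; rewrite /contract_rel /= eq_sym adj_sym [X in _ || X]orbC. Qed.
Lemma contract_irrefl : irreflexive contract_rel.
Proof. by move=> x; rewrite /contract_rel /= eqxx. Qed.
Definition contract : sgraph := SGraph contract_sym contract_irrefl.
End Contract.

Inductive minor (H : sgraph) : sgraph -> Prop :=
| minor_iso (G : sgraph) : giso H G -> minor H G
| minor_del_vertex (G : sgraph) (v : G) :
    minor H (del_vertex v) -> minor H G
| minor_del_edge (G : sgraph) (u v : G) :
    adj u v -> minor H (del_edge u v) -> minor H G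
| minor_contract (G : sgraph) (u v : G) :
    adj u v -> minor H (contract u v) -> minor H G.

Definition excluded_minors (B : sgraph -> Prop) (G : sgraph) : Prop :=
  forall H, B H -> ~ minor H G.

Section Complete.
Variable n : nat.
Definition complete_rel : rel 'I_n := [rel x y | x != y].
Lemma complete_sym : symmetric complete_rel.
Proof. by move=> x y; rewrite /complete_rel /= eq_sym. Qed.
Lemma complete_irrefl : irreflexive complete_rel.
Proof. by move=> x; rewrite /complete_rel /= eqxx. Qed.
Definition complete : sgraph := SGraph complete_sym complete_irrefl.
End Complete.

Section CompleteBipartite.
Variables m n : nat.
Definition is_left (x : 'I_m + 'I_n) : bool := if x is inl _ then true else false.
Definition bipartite_rel : rel ('I_m + 'I_n)%type :=
  [rel x y | is_left x != is_left y].
Lemma bipartite_sym : symmetric bipartite_rel.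
Proof. by move=> x y; rewrite /bipartite_rel /= eq_sym. Qed.
Lemma bipartite_irrefl : irreflexive bipartite_rel.
Proof. by move=> x; rewrite /bipartite_rel /= eqxx. Qed.
Definition complete_bipartite : sgraph := SGraph bipartite_sym bipartite_irrefl.
End CompleteBipartite.

Definition K5_minus : sgraph :=
  @del_edge (complete 5) (ord0 : 'I_5) (ord_max : 'I_5).

Definition K33_minus : sgraph :=
  @del_edge (complete_bipartite 3 3)
    (inl ord0 : 'I_3 + 'I_3)%type (inr ord0 : 'I_3 + 'I_3)%type.

Section Planarity.
Variable R : realType.
Local Open Scope ring_scope.

Definition is_arc (x y : R * R) (A : set (R * R)) : Prop :=
  exists g : R -> R * R,
    [/\ {within `[0, 1], continuous g}, {in `[0, 1] &, injective g},
        g 0 = x, g 1 = y & A = g @` `[0, 1]].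

(* The arc drawn for the edge uv is a [set u; v]; the values of a on other
   vertex sets are irrelevant. By the third and fourth conditions two distinct
   edges meet in common endpoints only. *)
Definition plane_drawing (G : sgraph) (p : G -> R * R)
    (a : {set G} -> set (R * R)) : Prop :=
  [/\ injective p,
      forall u v : G, adj u v -> is_arc (p u) (p v) (a [set u; v]%SET),
      forall u v w : G, adj u v -> a [set u; v]%SET (p w) -> w = u \/ w = v &
      forall u v x y : G, adj u v -> adj x y ->
        [set u; v]%SET != [set x; y]%SET ->
        a [set u; v]%SET `&` a [set x; y]%SET `<=` range p].

Definition Planar (G : sgraph) : Prop :=
  exists p a, @plane_drawing G p a.

End Planarity.

Definition Free (P : sgraph -> Prop) (G : sgraph) : Prop :=
  P G /\ forall u v : G, u != v -> ~~ adj u v -> P (add_edge u v).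

(* Main.v *)
(* An edge added to a graph without the two minors creates neither a K5 nor a
   K33 minor, so it suffices to draw graphs without these.  A K5- and K33-minor-free graph
   with an edge uz has a bar representation: vertices are horizontal bars at
   distinct heights, edges are vertical segments, a segment crosses no bar
   between its ends, u is the lowest bar, z the highest one, and uz the leftmost
   segment.  The induction glues along separations of order at most two; in a
   3-connected graph it contracts an edge zv and inserts the bar of v just below
   z, which is possible unless the neighbours of v and z on the skyline
   alternate, and that gives a K33 or a K5.  If every contraction loses
   connectivity, a vertex of degree three is removed and reinserted.

   Conversely, joining the bags of the two ends of the missing edge turns a
   model of one of the minors into a model of K5 or K33, and these are not planar:
   approximate the arcs by polygons and record, modulo 2, how often each arc
   passes above each vertex.  Two independent edges do not cross, which is a
   linear equation between these parities and the left-to-right order of the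
   vertices; the 15, respectively 18, equations of K5 and K33 add up to 0 = 1. *)
Require Import Defs.
From HB Require Import structures.
From mathcomp Require Import all_boot all_order all_algebra.
From mathcomp Require Import boolp zify lra ring.

Set Implicit Arguments.
Unset Strict Implicit.
Unset Printing Implicit Defensive.

(** * Connectivity and models *)

(** Bars turn planarity into finitely many strict inequalities over an ordered field. The outer face
    becomes the skyline, and what is needed of the Jordan curve theorem becomes [noncrossing]: two
    disjoint connected sets do not alternate on the skyline, by induction on the number of bars.
    Prescribing the edge uz at the left end makes the induction close. A piece attached at c and d
    is represented with cd as its own leftmost edge, so it fits into a thin box beside cd; and the
    lowest bar u can be stretched to the right past everything, which gives v a second place from
    which to see u. Alternation yields a minor because S without z and v is 2-connected and can be
    contracted onto any three or four of its vertices. If no edge at z other than uz leaves a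
    2-connected rest, a smallest separation exhibits a neighbour of z of degree three. *)

Section Connectivity.
Variables (T : finType) (e : rel T).
Implicit Types (A B D S : {set T}) (x y : T).

(** Connectivity without paths: only the whole of [A] is non-empty and closed under the edges inside
    [A]. The empty set is connected in this sense, so models ask for non-empty bags separately. *)
Definition conn A := forall D, D \subset A -> D != set0 ->
  (forall x y, x \in D -> y \in A -> y \notin D -> ~~ e x y) -> A \subset D.

Definition nb S D := [set y in S :\: D | [exists x in D, e x y]].

(** No set of fewer than [k] vertices separates [S]. The size of [S] is not bounded below: a
    complete graph satisfies this for every [k], and lemmas that need more vertices say so. *)
Definition kconn k S := forall D, D \subset S -> D != set0 ->
  #|nb S D| < k -> D :|: nb S D = S.

Lemma nbP S D y :
  reflect [/\ y \in S, y \notin D & exists2 x, x \in D & e x y] (y \in nb S D).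
Proof.
rewrite !inE; apply: (iffP idP).
  by case/andP=> /andP[-> ->] /exists_inP[x xD xy]; split=> //; exists x.
by case=> -> -> [x xD xy]; rewrite /=; apply/exists_inP; exists x.
Qed.

Lemma nb_sub S D A :
  (forall x y, x \in D -> y \in S -> y \notin D -> e x y -> y \in A) ->
  nb S D \subset A.
Proof. by move=> H; apply/subsetP=> y /nbP[yS yD [x xD xy]]; apply: H xy. Qed.

Lemma conn1 x : conn [set x].
Proof.
move=> D sD /set0Pn[y yD] _; have := subsetP sD _ yD; rewrite inE => /eqP E.
by rewrite sub1set -E.
Qed.

Definition component A x :=
  [set y | connect [rel a b | [&& a \in A, b \in A & e a b]] x y].

Lemma component_id A x : x \in component A x.
Proof. by rewrite inE connect0. Qed.

Lemma component_closed A x a b :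
  x \in A -> a \in component A x -> b \in A -> e a b -> b \in component A x.
Proof.
move=> xA; rewrite !inE => xa bA ab; apply: connect_trans (xa) _.
apply: connect1 => /=; rewrite bA ab /= andbT.
case/connectP: xa => p; elim/last_ind: p => [_ -> //|p w _].
by rewrite rcons_path last_rcons => /andP[_ /and3P[_ wA _]] ->.
Qed.

Lemma component_sub A x : x \in A -> component A x \subset A.
Proof.
move=> xA; apply/subsetP=> y; rewrite inE => /connectP[p].
elim/last_ind: p => [_ -> //|p w _].
by rewrite rcons_path last_rcons => /andP[_ /and3P[_ wA _]] ->.
Qed.

Hypothesis e_sym : symmetric e.

Lemma connU A B x y : conn A -> conn B -> x \in A -> y \in B -> e x y ->
  conn (A :|: B).
Proof.
move=> cA cB xA yB xy D sD D0 cl.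
have meetA z : z \in A -> z \in D -> A \subset D.
  move=> zA zD; suff: A \subset D :&: A by rewrite subsetI; case/andP.
  apply: cA; [exact: subsetIr|by apply/set0Pn; exists z; rewrite inE zD|].
  move=> a b; rewrite !inE => /andP[aD aA] bA; rewrite bA andbT => bD.
  by apply: cl => //; rewrite inE bA.
have meetB z : z \in B -> z \in D -> B \subset D.
  move=> zB zD; suff: B \subset D :&: B by rewrite subsetI; case/andP.
  apply: cB; [exact: subsetIr|by apply/set0Pn; exists z; rewrite inE zD|].
  move=> a b; rewrite !inE => /andP[aD aB] bB; rewrite bB andbT => bD.
  by apply: cl => //; rewrite inE bB orbT.
have [z zD] := set0Pn _ D0.
have := subsetP sD _ zD; rewrite inE => /orP[zA|zB]; rewrite subUset.
  have sA := meetA _ zA zD; rewrite sA /=; apply: (meetB y) => //.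
  apply/negPn/negP => yD; move: (cl x y (subsetP sA _ xA)).
  by rewrite inE yB orbT xy => /(_ isT yD).
have sB := meetB _ zB zD; rewrite sB andbT; apply: (meetA x) => //.
apply/negPn/negP => xD; move: (cl y x (subsetP sB _ yB)).
by rewrite inE xA e_sym xy => /(_ isT xD).
Qed.

Lemma component_conn A x : x \in A -> conn (component A x).
Proof.
move=> xA D sD D0 cl.
set r := [rel a b | [&& a \in A, b \in A & e a b]].
have rs : connect_sym r.
  by apply: sym_connect_sym => a b /=; rewrite e_sym andbCA.
have Dcl : closed r D.
  move=> a b /and3P[aA bA ab].
  have h (u v : T) : v \in A -> e u v -> u \in D -> v \in D.
    move=> vA uv uD; apply/negPn/negP=> vD.
    have uc := subsetP sD _ uD; have vc := component_closed xA uc vA uv.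
    by move: (cl _ _ uD vc vD); rewrite uv.
  by apply/idP/idP; apply: h; rewrite // e_sym.
have [z zD] := set0Pn _ D0.
have := subsetP sD _ zD; rewrite inE => xz.
apply/subsetP => y; rewrite inE => xy.
by rewrite -(closed_connect Dcl xy) (closed_connect Dcl xz).
Qed.

Lemma conn_not A : ~ conn A -> exists2 D : {set T}, D \subset A & [/\ D != set0, D != A &
  forall x y, x \in D -> y \in A -> y \notin D -> ~~ e x y].
Proof.
move=> nc; pose P (D : {set T}) := [&& D \subset A, D != set0, D != A &
  [forall x in D, [forall y in A :\: D, ~~ e x y]]].
case: (pickP P) => [D /and4P[sD D0 DA /forall_inP cl]|none].
  exists D => //; split=> // x y xD yA yD.
  by move/forall_inP: (cl _ xD); apply; rewrite inE yD.
case: nc => D sD D0 cl; apply/negPn/negP => nAD; move: (none D).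
rewrite /P sD D0 /=; case: eqP => [E|_] /=; first by rewrite E subxx in nAD.
move/negP; apply; apply/forall_inP=> x xD; apply/forall_inP=> y.
by rewrite inE => /andP[yD yA]; apply: cl.
Qed.

Lemma kconn_not k S : ~ kconn k S -> exists2 D : {set T}, D \subset S &
  [/\ D != set0, #|nb S D| < k & D :|: nb S D != S].
Proof.
move=> nc; pose P (D : {set T}) :=
  [&& D \subset S, D != set0, #|nb S D| < k & D :|: nb S D != S].
case: (pickP P) => [D /and4P[? ? ? ?]|none]; first by exists D.
case: nc => D sD D0 lt; apply/eqP/negPn/negP => ne; move: (none D).
by rewrite /P sD D0 lt ne.
Qed.

End Connectivity.

(** The graphs are cut out of fixed finite types by [P] and [S]: deleting a vertex only shrinks a
    set, and one type serves the whole induction. *)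
Definition model (K : finType) (k : rel K) (P : {set K})
    (T : finType) (e : rel T) (S : {set T}) (phi : K -> {set T}) :=
  [/\ {in P, forall i, phi i \subset S}, {in P, forall i, phi i != set0},
      {in P, forall i, conn e (phi i)},
      {in P &, forall i j, i != j -> [disjoint phi i & phi j]} &
      {in P &, forall i j, k i j ->
         exists x y, [/\ x \in phi i, y \in phi j & e x y]}].

Definition has_model (K : finType) (k : rel K) (T : finType) (e : rel T)
  (S : {set T}) := exists phi, model k setT e S phi.

Lemma model_comp (K : finType) (k : rel K) (P : {set K}) (T T' : finType)
    (e : rel T) (S : {set T}) (e' : rel T') (S' : {set T'}) phi f :
  model k P e S phi -> model e S e' S' f ->
  model k P e' S' (fun i => \bigcup_(x in phi i) f x).
Proof.
move=> [p1 p2 p3 p4 p5] [f1 f2 f3 f4 f5].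
have pS i x : i \in P -> x \in phi i -> x \in S.
  by move=> iP; apply: (subsetP (p1 i iP)).
split.
- move=> i iP; apply/bigcupsP=> x xi; exact: f1 (pS _ _ iP xi).
- move=> i iP; have /set0Pn[x xi] := p2 i iP.
  have /set0Pn[y yx] := f2 _ (pS _ _ iP xi).
  by apply/set0Pn; exists y; apply/bigcupP; exists x.
- move=> i iP D sD D0 cl.
  have meet x a : x \in phi i -> a \in f x -> a \in D -> f x \subset D.
    move=> xi ax aD; suff: f x \subset D :&: f x by rewrite subsetI; case/andP.
    apply: (f3 _ (pS _ _ iP xi)); first exact: subsetIr.
      by apply/set0Pn; exists a; rewrite inE aD.
    move=> b c; rewrite !inE => /andP[bD bx] cx; rewrite cx andbT => cD.
    by apply: cl => //; apply/bigcupP; exists x.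
  have /set0Pn[a aD] := D0.
  have /bigcupP[x xi ax] := subsetP sD _ aD.
  (* [D] contains every inner bag that it meets, so the vertices whose bags lie in [D] form a closed
     part of the connected bag [phi i]. *)
  suff sX : phi i \subset [set w in phi i | f w \subset D].
    by apply/bigcupsP=> w wi; have := subsetP sX _ wi; rewrite inE wi.
  apply: (p3 i iP).
  + by apply/subsetP=> w; rewrite inE; case/andP.
  + by apply/set0Pn; exists x; rewrite inE xi (meet _ a).
  + move=> u v; rewrite !inE => /andP[ui uD] vi; rewrite vi /= => vD.
    apply/negP=> uv.
    have [b [c [bu cv bc]]] := f5 _ _ (pS _ _ iP ui) (pS _ _ iP vi) uv.
    case/negP: vD; apply: (meet _ c) => //; apply/negPn/negP=> cD.
    have cU : c \in \bigcup_(x in phi i) f x by apply/bigcupP; exists v.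
    by move: (cl b c (subsetP uD _ bu) cU cD); rewrite bc.
- move=> i j iP jP ij; rewrite -setI_eq0; apply/negPn/negP=> /set0Pn[a].
  rewrite inE => /andP[/bigcupP[x xi ax] /bigcupP[y yj ay]].
  case: (eqVneq x y) => [E|xy].
    by move: (disjointFr (p4 i j iP jP ij) xi); rewrite E yj.
  by move: (disjointFr (f4 x y (pS _ _ iP xi) (pS _ _ jP yj) xy) ax); rewrite ay.
- move=> i j iP jP ij; have [x [y [xi yj xy]]] := p5 i j iP jP ij.
  have [a [b [ax bx ab]]] := f5 x y (pS _ _ iP xi) (pS _ _ jP yj) xy.
  by exists a, b; split=> //; apply/bigcupP; [exists x|exists y].
Qed.

Lemma model_id (T : finType) (e e' : rel T) (S S' : {set T}) :
  S \subset S' -> {in S &, subrel e e'} -> model e S e' S' (fun x => [set x]).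
Proof.
move=> sS ee; split.
- by move=> i iS; rewrite sub1set; apply: (subsetP sS).
- by move=> i _; apply/set0Pn; exists i; rewrite inE eqxx.
- by move=> i _; exact: (@conn1 _ e').
- by move=> i j _ _ ij; rewrite disjoints1 inE.
- by move=> i j iS jS ij; exists i, j; rewrite !inE !eqxx; split=> //; apply: ee.
Qed.

Lemma has_model_comp (K : finType) (k : rel K) (T T' : finType)
    (e : rel T) (S : {set T}) (e' : rel T') (S' : {set T'}) f :
  model e S e' S' f -> has_model k e S -> has_model k e' S'.
Proof. by move=> mf [phi mp]; eexists; apply: model_comp mp mf. Qed.

Definition Kfree (T : finType) (e : rel T) (S : {set T}) :=
  ~ has_model (@complete_rel 5) e S /\ ~ has_model (@bipartite_rel 3 3) e S.

Lemma Kfree_minor (T T' : finType) (e : rel T) (S : {set T})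
    (e' : rel T') (S' : {set T'}) f :
  model e S e' S' f -> Kfree e' S' -> Kfree e S.
Proof. by move=> mf [h1 h2]; split=> /(has_model_comp mf). Qed.

(** [a] takes over the edges of [n]; [n] itself is discarded by passing to [S :\ n]. *)
Definition contracted (T : finType) (e : rel T) (a n : T) : rel T :=
  [rel x y | [|| e x y, (x == a) && e n y | (y == a) && e n x]].

Lemma contracted_sym (T : finType) (e : rel T) a n :
  symmetric e -> symmetric (contracted e a n).
Proof. by move=> s x y; rewrite /contracted /= (s x y); congr (_ || _); rewrite orbC. Qed.

(* The connected set [D] is absorbed by the vertex [a]. *)
Lemma model_absorb (T : finType) (e e' : rel T) (S S' D : {set T}) (a : T) :
  symmetric e' -> a \in S -> S \subset S' -> D \subset S' ->
  [disjoint S & D] -> conn e' (a |: D) ->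
  (forall x y, x \in S -> y \in S -> e x y -> e' x y \/
     (x = a /\ exists2 d, d \in D & e' d y) \/
     (y = a /\ exists2 d, d \in D & e' x d)) ->
  model e S e' S' (fun x => if x == a then a |: D else [set x]).
Proof.
move=> es aS sS sD dSD cD ee.
have memf x w : w \in (if x == a then a |: D else [set x]) ->
  w = x \/ (x = a /\ w \in D).
  by case: eqP => [->|_]; rewrite !inE; [case/orP=> [/eqP|]|move/eqP]; auto.
split.
- move=> i iS; case: eqP => _; last by rewrite sub1set (subsetP sS).
  by rewrite subUset sub1set (subsetP sS).
- by move=> i _; case: ifP => _; apply/set0Pn; [exists a|exists i]; rewrite !inE eqxx.
- by move=> i _; case: eqP => // _; exact: (@conn1 _ e').
- move=> i j iS jS ij; rewrite -setI_eq0; apply/negPn/negP=> /set0Pn[w].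
  rewrite inE => /andP[/memf wi /memf wj].
  case: wi wj => [->|[ia wD]] [E|[ja wD']]; try subst.
  + by rewrite eqxx in ij.
  + by rewrite (disjointFr dSD iS) in wD'.
  + by rewrite (disjointFr dSD jS) in wD.
  + by rewrite eqxx in ij.
- move=> i j iS jS /(ee _ _ iS jS) [ij|[[-> [d dD dj]]|[-> [d dD dj]]]].
  + by exists i, j; split=> //; case: ifP => [/eqP ->|_]; rewrite !inE eqxx.
  + exists d, j; split=> //; first by rewrite eqxx !inE dD orbT.
    by case: ifP => [/eqP ->|_]; rewrite !inE eqxx.
  + exists i, d; split=> //; last by rewrite eqxx !inE dD orbT.
    by case: ifP => [/eqP ->|_]; rewrite !inE eqxx.
Qed.

Lemma model_contracted (T : finType) (e : rel T) (S : {set T}) (a n : T) :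
  symmetric e -> a \in S -> n \in S -> a != n -> e a n ->
  model (contracted e a n) (S :\ n) e S
    (fun x => if x == a then a |: [set n] else [set x]).
Proof.
move=> es aS nS an ean; apply: model_absorb => //.
- by rewrite !inE an.
- exact: subD1set.
- by rewrite sub1set.
- by rewrite disjoint_sym disjoints1 !inE eqxx.
- by apply: (@connU _ _ _ _ _ a n) => //; rewrite ?inE //; exact: (@conn1 _ e).
move=> x y xS yS; rewrite /contracted /= => /or3P[|/andP[/eqP-> nj]|/andP[/eqP-> ni]]; auto.
- by right; left; split=> //; exists n; rewrite ?inE.
- by right; right; split=> //; exists n; rewrite ?inE // es.
Qed.

Lemma min_measure (U : Type) (m : U -> nat) (Q : U -> Prop) :
  (exists D, Q D) -> exists2 D, Q D & forall D', Q D' -> m D <= m D'.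
Proof.
case=> D0 QD0; apply: contrapT => no.
have H n : forall D, m D <= n -> ~ Q D.
  elim: n => [|n IH] D leD QD; apply: no; exists D => // D' QD'; first by lia.
  by rewrite leqNgt; apply/negP=> lt; apply: (IH D') => //; lia.
exact: (H (m D0) D0).
Qed.

(** * Contracting a 2-connected graph onto prescribed vertices *)

Section Rooted.
Variable T : finType.
Implicit Types (e : rel T) (B D S : {set T}).

Lemma kconn_eq e k B D (C : {set T}) : kconn e k B -> D \subset B ->
  D != set0 -> nb e B D \subset C -> #|C| < k -> D :|: nb e B D = B.
Proof.
move=> cB sD D0 sC lt; apply: cB => //.
exact: leq_ltn_trans (subset_leq_card sC) lt.
Qed.

Lemma kconn_sub e k B D (C : {set T}) : kconn e k B -> D \subset B ->
  D != set0 -> nb e B D \subset C -> #|C| < k -> B \subset D :|: C.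
Proof. by move=> cB sD D0 sC lt; rewrite -{1}(kconn_eq cB sD D0 sC lt) setUS. Qed.

(** Among all sides of separations of [B] by [n] and one further vertex take a smallest, [D]. A
    neighbour [d] of [n] in [D] cannot form such a separation with [n], since one side of it would
    lie strictly inside [D]. *)
Lemma nonseparating_neighbour e B n : symmetric e -> kconn e 2 B ->
  2 < #|B| -> n \in B ->
  exists a, [/\ a \in B, a != n, e n a & conn e (B :\ n :\ a)].
Proof.
move=> es cB B3 nB.
pose Q (D : {set T}) := exists a, [/\ a \in B :\ n, D \subset B :\ n :\ a,
  D != set0, nb e B D \subset [set n; a] & ~ (B \subset D :|: [set n; a])].
have memB (a d x : T) D : D \subset B :\ a :\ d -> x \in D -> [/\ x \in B, x != a & x != d].
  by move=> s /(subsetP s); rewrite !inE => /and3P[].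
have bad a : a \in B -> a != n -> ~ conn e (B :\ n :\ a) ->
    exists2 D : {set T}, D \subset B :\ n :\ a & [/\ D != set0,
      nb e B D \subset [set n; a], ~ (B \subset D :|: [set n; a]) &
      forall b, b \in B -> b != n -> b != a -> b \notin D -> exists2 D' : {set T},
       D' \subset B :\ n :\ a & [/\ D' != set0, b \in D',
      nb e B D' \subset [set n; a], ~ (B \subset D' :|: [set n; a]) & [disjoint D & D']]].
  move=> aB an /conn_not[D sD [D0 DA cl]].
  have cl' x y : x \in D -> y \in B -> y \notin D -> e x y -> y \in [set n; a].
    move=> xD yB yD xy; rewrite !inE; apply/negPn/negP; rewrite negb_or => /andP[yn ya].
    by have := cl x y xD; rewrite !inE yn ya yB xy => /(_ isT yD).
  exists D => //; split=> //; first exact: nb_sub.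
    move=> sB; case/eqP: DA; apply/eqP; rewrite eqEsubset sD /=; apply/subsetP=> w.
    rewrite !inE => /and3P[wa wn wB]; have := subsetP sB _ wB.
    by rewrite !inE (negPf wn) (negPf wa) !orbF.
  move=> b bB bn ba bD; exists ((B :\ n :\ a) :\: D); first exact: subsetDl.
  split.
  - by apply/set0Pn; exists b; rewrite !inE bD bn ba bB.
  - by rewrite !inE bD bn ba bB.
  - apply: nb_sub => x y; rewrite !inE => /and4P[xD xa xn xB] yB yE xy.
    apply/negPn/negP; rewrite negb_or => /andP[yn ya].
    move: yE; rewrite yn ya yB /= andbT negbK => yD.
    have := cl' y x yD xB xD; rewrite es xy !inE (negPf xa) (negPf xn) => /(_ isT); by [].
  - case/set0Pn: D0 => d dD; have [dB dn da] := memB _ _ _ _ sD dD.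
    by move/subsetP/(_ _ dB); rewrite !inE dD (negPf dn) (negPf da).
  - by rewrite disjoint_sym disjoints_subset; apply/subsetP=> x; rewrite !inE => /andP[].
(* Without any such separation every neighbour of [n] serves, and there is one, since otherwise the
   empty set would cut off [n]. *)
have [exQ|noQ] := pselect (exists D, Q D); last first.
  have [a /andP[/andP[aB an] na]] : exists a, (a \in B) && (a != n) && e n a.
    case: (pickP [pred a | (a \in B) && (a != n) && e n a]) => [a|none]; first by exists a.
    have s0 : nb e B [set n] \subset set0.
      apply: nb_sub => x y; rewrite !inE => /eqP -> yB yn ny.
      by have := none y; rewrite /= yB yn ny.
    have s1 : [set n] \subset B by rewrite sub1set.
    have n0 : [set n] != set0 by apply/set0Pn; exists n; rewrite inE.
    have := kconn_sub cB s1 n0 s0; rewrite cards0 setU0 => /(_ isT).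
    by move/subset_leq_card; rewrite cards1 leqNgt (ltnW B3).
  exists a; split=> //; apply: contrapT => /(bad _ aB an)[D sD [D0 nbD nB' _]].
  by apply: noQ; exists D, a; rewrite !inE an.
have [D [a [aBn sD D0 nbD nsB]] minD] := min_measure (fun D : {set T} => #|D|) exQ.
have [aB an] : a \in B /\ a != n by move: aBn; rewrite !inE => /andP[].
have sDB : D \subset B by apply/subsetP=> x /(memB _ _ _ _ sD)[].
have nD : n \notin D by apply/negP=> /(memB _ _ _ _ sD)[_]; rewrite eqxx.
have aD : a \notin D by apply/negP=> /(memB _ _ _ _ sD)[_ _]; rewrite eqxx.
have [d dD nd] : exists2 d, d \in D & e n d.
  case: (pickP [pred d | (d \in D) && e n d]) => [d /andP[]|none]; first by exists d.
  have sa : nb e B D \subset [set a].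
    apply/subsetP=> y yn; have := subsetP nbD _ yn; rewrite !inE => /orP[/eqP E|//].
    by case/nbP: yn => _ _ [x xD]; have := none x; rewrite /= xD /= E es => ->.
  have := kconn_sub cB sDB D0 sa; rewrite cards1 => /(_ isT) /subsetP /(_ _ nB).
  by rewrite !inE (negPf nD) eq_sym (negPf an).
have [dB dn da] := memB _ _ _ _ sD dD.
exists d; split=> //; apply: contrapT => /(bad _ dB dn)[D1 s1 [D10 nb1 ns1 other]].
(* Of two sides of the separation by [n] and [d], one avoids [a]. *)
have [E [sE E0 aE nbE nsE]] : exists E : {set T}, [/\ E \subset B :\ n :\ d, E != set0, a \notin E,
      nb e B E \subset [set n; d] & ~ (B \subset E :|: [set n; d])].
  case: (boolP (a \in D1)) => [aD1|aD1]; last by exists D1.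
  have [c] : exists c, (c \in B) && (c \notin D1 :|: [set n; d]).
    by move/negP: ns1 => /subsetPn[c cB' cD]; exists c; rewrite cB'.
  rewrite !inE !negb_or => /and4P[cB' cD cn cd].
  have [D2 s2 [D20 _ nb2 ns2 dis]] := other c cB' cn cd cD.
  by exists D2; split=> //; rewrite (disjointFr dis aD1).
(* The part of [E] outside [D] has no attachment but [n]: it is not adjacent to [D], which is left
   only through [n] and [a], and [d] lies in [D]. So [n] alone would cut it off. *)
have sED : E \subset D.
  rewrite -setD_eq0; apply/negPn/negP=> F0.
  have sF : E :\: D \subset B by apply/subsetP=> x; rewrite inE => /andP[_ /(memB _ _ _ _ sE)[]].
  have nbF : nb e B (E :\: D) \subset [set n].
    apply: nb_sub => x y; rewrite !inE => /andP[xD xE] yB yED xy.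
    apply/negPn/negP=> yn.
    have xa : x != a by apply: contraNneq aE => <-.
    have [xB xn xd] := memB _ _ _ _ sE xE.
    have yD : y \notin D.
      apply/negP=> yD; have : x \in nb e B D by apply/nbP; split=> //; exists y; rewrite // es.
      by move/(subsetP nbD); rewrite !inE (negPf xn) (negPf xa).
    have yE : y \notin E by move: yED; rewrite yD.
    have : y \in nb e B E by apply/nbP; split=> //; exists x.
    by move/(subsetP nbE); rewrite !inE (negPf yn) /= => /eqP yd; rewrite yd dD in yD.
  have := kconn_sub cB sF F0 nbF; rewrite cards1 => /(_ isT) /subsetP /(_ _ dB).
  by rewrite !inE dD (negPf dn).
have : #|D| <= #|E| by apply: minD; exists d; rewrite !inE dn.
rewrite leqNgt; case/negP; apply: proper_card.
rewrite properE sED /=; apply/subsetPn; exists d => //.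
by apply/negP=> /(memB _ _ _ _ sE)[_ _]; rewrite eqxx.
Qed.

(** The vertices outside [T0] are contracted one by one, each into a neighbour chosen so that the
    graph stays 2-connected. On three or four roots the result can be read off. *)
Lemma rooted_quotient e B (T0 : {set T}) : symmetric e -> kconn e 2 B ->
  T0 \subset B -> 2 < #|T0| ->
  exists e' f, [/\ symmetric e', kconn e' 2 T0, model e' T0 e B f &
    {in T0, forall t, t \in f t}].
Proof.
move=> es cB sT T3; move En : #|B| => n.
elim: n e B es cB sT En => [|n IH] e B es cB sT En.
  by have := subset_leq_card sT; rewrite En; lia.
case: (eqVneq T0 B) => [->|ne].
  exists e, (fun x => [set x]); split=> //; first exact: model_id.
  by move=> t _; rewrite inE.
have [v vB vT] : exists2 v, v \in B & v \notin T0.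
  by apply/subsetPn; apply: contra ne => sB; rewrite eqEsubset sT.
have B3 : 2 < #|B| by apply: leq_trans T3 (subset_leq_card sT).
have [a [aB av va cBa]] := nonseparating_neighbour es cB B3 vB.
have es1 := contracted_sym a v es.
have aBv : a \in B :\ v by rewrite !inE av.
(* The contraction can create no cut vertex except the merged vertex [a], and [a] is none because
   [B] without [v] and [a] is connected. *)
have cB1 : kconn (contracted e a v) 2 (B :\ v).
  move=> D sD D0 lt.
  have sDB : D \subset B by apply: subset_trans sD (subD1set _ _).
  have vD : v \notin D by apply/negP=> /(subsetP sD); rewrite !inE eqxx.
  apply/eqP; rewrite eqEsubset subUset sD /=; apply/andP; split.
    by apply/subsetP=> y /nbP[].
  apply/subsetP=> w; rewrite !in_setD1 => /andP[wv wB].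
  have sub x y : x \in D -> y \in B -> y \notin D -> y != v -> e x y ->
      y \in nb (contracted e a v) (B :\ v) D.
    move=> xD yB yD yv xy; apply/nbP; rewrite !inE yv yB; split=> //.
    by exists x => //; rewrite /contracted /= xy.
  case: (boolP (a \in D)) => aD.
    have s1 : v |: D \subset B by rewrite subUset sub1set vB.
    have D10 : v |: D != set0 by apply/set0Pn; exists v; rewrite !inE eqxx.
    have s2 : nb e B (v |: D) \subset nb (contracted e a v) (B :\ v) D.
      apply: nb_sub => x y; rewrite !inE negb_or => /orP[/eqP ->|xD] yB /andP[yv yD] xy.
        rewrite yD yB yv /=; apply/exists_inP; exists a => //.
        by rewrite /contracted /= eqxx xy orbT.
      by have := sub x y xD yB yD yv xy; rewrite !inE.
    have /subsetP /(_ _ wB) := kconn_sub cB s1 D10 s2 lt.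
    by rewrite in_setU in_setU1 (negPf wv) /= => h; rewrite in_setU.
  case: (boolP (v \in nb e B D)) => [/nbP[_ _ [x xD xv]]|vn]; last first.
    have s2 : nb e B D \subset nb (contracted e a v) (B :\ v) D.
      apply: nb_sub => x y xD yB yD xy; apply: (sub x) => //.
      by apply: contraNneq vn => <-; apply/nbP; split=> //; exists x.
    have /subsetP /(_ _ vB) := kconn_sub cB sDB D0 s2 lt.
    by rewrite inE (negPf vD) => /nbP[]; rewrite !inE eqxx.
  have aN : a \in nb (contracted e a v) (B :\ v) D.
    apply/nbP; split=> //; exists x => //.
    by rewrite /contracted /= eqxx (es v x) xv !orbT.
  have Na : nb (contracted e a v) (B :\ v) D = [set a].
    by apply/esym/eqP; rewrite eqEcard sub1set aN cards1 -ltnS.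
  have sDa : D \subset B :\ v :\ a.
    apply/subsetP=> y yD; rewrite in_setD1 (subsetP sD) // andbT.
    by apply: contraNneq aD => <-.
  have := cBa D sDa D0; case: (eqVneq w a) => [->|wa]; first by rewrite in_setU aN orbT.
  have dc : forall x0 y : T, x0 \in D -> y \in B :\ v :\ a -> y \notin D -> ~~ e x0 y.
    move=> x0 y xD0; rewrite !inE => /and3P[ya yv yB] yD; apply/negP=> xy.
    by have := sub _ _ xD0 yB yD yv xy; rewrite Na inE (negPf ya).
  by move/(_ dc)/subsetP/(_ w); rewrite !inE wa wv wB => /(_ isT) ->.
have [||e' [f [es' ce' mf tf]]] := IH _ _ es1 cB1.
- apply/subsetP=> x xT; rewrite !inE (subsetP sT) // andbT.
  by apply: contraNneq vT => <-.
- by move: En; rewrite (cardsD1 v) vB add1n => -[].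
have eav : e a v by rewrite es.
have mm := model_contracted es aB vB av eav.
exists e'; eexists; split; [exact: es'|exact: ce'|exact: model_comp mf mm|].
move=> t tT; apply/bigcupP; exists t; first exact: tf.
by case: eqP => [->|_]; rewrite !inE eqxx.
Qed.

(** If [y] were the only neighbour of [x], it would separate [x] from [w]. *)
Lemma kconn2_two_neighbours e (S : {set T}) x y w : kconn e 2 S -> x \in S ->
  w \in S -> w != x -> y != w -> (forall z, z \in S -> z != x -> e x z -> z = y) -> False.
Proof.
move=> cS xS wS wx yw H.
have s : [set x] \subset S by rewrite sub1set.
have n0 : [set x] != set0 by apply/set0Pn; exists x; rewrite inE.
have nbx : nb e S [set x] \subset [set y].
  by apply: nb_sub => a b; rewrite !inE => /eqP -> bS bx ab; apply/eqP; apply: H.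
have := kconn_sub cS s n0 nbx; rewrite cards1 => /(_ isT) /subsetP /(_ _ wS).
by rewrite !inE (negPf wx) eq_sym (negPf yw).
Qed.

(** In the quotient on three vertices, a missing side ij would leave [i] with the third vertex [k]
    as its only neighbour. *)
Lemma rooted_triangle e B x1 x2 x3 : symmetric e -> kconn e 2 B ->
  x1 \in B -> x2 \in B -> x3 \in B -> uniq [:: x1; x2; x3] ->
  exists f, model [rel a b | a != b] [set x1; x2; x3] e B f /\
    {in [set x1; x2; x3], forall t, t \in f t}.
Proof.
move=> es cB b1 b2 b3 /=; rewrite !inE !negb_or !andbT => /andP[/andP[n12 n13] n23].
have sT : [set x1; x2; x3] \subset B by apply/subsetP=> w; rewrite !inE => /orP[/orP[]|] /eqP->.
have T3 : 2 < #|[set x1; x2; x3]|.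
  by rewrite cardsU cardsU1 !cards1 inE n12 (_ : _ :&: _ = set0) ?cards0 //;
  apply/setP=> w; rewrite !inE; apply/negP=> /andP[/orP[] /eqP-> /eqP E]; rewrite E eqxx in n13 n23.
have [e' [f [es' ce' [f1 f2 f3 f4 f5] tf]]] := rooted_quotient es cB sT T3.
exists f; split=> //; split=> // i j iT jT /= ij; apply: f5 => //.
have [k kT [ki kj kk]] : exists2 k, k \in [set x1; x2; x3] & [/\ k != i, k != j &
    forall w, w \in [set x1; x2; x3] -> w != i -> w != j -> w = k].
  have H a b c : [set a; b; c] = [set x1; x2; x3] -> i = a -> j = b -> c != a -> c != b ->
      exists2 k, k \in [set x1; x2; x3] & [/\ k != i, k != j &
    forall w, w \in [set x1; x2; x3] -> w != i -> w != j -> w = k].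
    move=> <- -> -> ca cb; exists c; first by rewrite !inE eqxx orbT.
    by split=> // w; rewrite !inE => /orP[/orP[]|] /eqP->; rewrite ?eqxx.
  move: iT jT; rewrite !inE => /orP[/orP[]|] /eqP Ei /orP[/orP[]|] /eqP Ej;
    have ij' := ij; rewrite Ei Ej ?eqxx // in ij'; clear ij'.
  + by apply: (H x1 x2 x3); rewrite // eq_sym.
  + by apply: (H x1 x3 x2); rewrite // 1?eq_sym // setUAC.
  + by apply: (H x2 x1 x3); rewrite // 1?eq_sym // [[set x2; x1]]setUC.
  + by apply: (H x2 x3 x1); rewrite // setUC setUA.
  + by apply: (H x3 x1 x2); rewrite // 1?eq_sym // -setUA setUC.
  + by apply: (H x3 x2 x1); rewrite // setUC -setUA [[set x3; x2]]setUC setUA.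
apply/negPn/negP=> nij; apply: (@kconn2_two_neighbours _ _ i k j ce') => //; rewrite 1?eq_sym //.
move=> w wT wi iw; apply: kk => //.
by apply: contraNneq nij => <-.
Qed.

(** In the quotient on the four vertices the edges x1x2 and y1y2 are not both present, for their
    bags would form two disjoint links. If a pair ab across were not adjacent, [a] and [b] would
    need exactly these two edges to have two neighbours each. *)
Lemma rooted_four_cycle e B x1 x2 y1 y2 : symmetric e -> kconn e 2 B ->
  x1 \in B -> x2 \in B -> y1 \in B -> y2 \in B -> uniq [:: x1; x2; y1; y2] ->
  (forall P Q : {set T}, P \subset B -> Q \subset B -> [disjoint P & Q] ->
     conn e P -> conn e Q -> x1 \in P -> x2 \in P -> y1 \in Q -> y2 \in Q -> False) ->
  exists f, model [rel a b | (a \in [set x1; x2]) != (b \in [set x1; x2])]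
    [set x1; x2; y1; y2] e B f /\
    {in [set x1; x2; y1; y2], forall t, t \in f t}.
Proof.
move=> es cB b1 b2 b3 b4 /=; rewrite !inE !negb_or !andbT.
case/and3P=> /and3P[n12 n13 n14] /andP[n23 n24] n34 nolink.
have sT : [set x1; x2; y1; y2] \subset B.
  by apply/subsetP=> w; rewrite !inE => /orP[/orP[/orP[]|]|] /eqP->.
have T3 : 2 < #|[set x1; x2; y1; y2]|.
  have : [set x1; x2] :|: [set y1] \subset [set x1; x2; y1; y2] by apply: subsetUl.
  move/subset_leq_card; apply: leq_trans.
  by rewrite cardsU cards2 n12 cards1 (_ : _ :&: _ = set0) ?cards0 //;
  apply/setP=> w; rewrite !inE; apply/negP=> /andP[/orP[] /eqP-> /eqP E]; rewrite E eqxx in n13 n23.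
have [e' [f [es' ce' [f1 f2 f3 f4 f5] tf]]] := rooted_quotient es cB sT T3.
have [m1 m2 m3 m4] : [/\ x1 \in [set x1; x2; y1; y2], x2 \in [set x1; x2; y1; y2],
    y1 \in [set x1; x2; y1; y2] & y2 \in [set x1; x2; y1; y2]].
  by rewrite !inE !eqxx !orbT.
have no : ~ (e' x1 x2 /\ e' y1 y2).
  case=> h1 h2.
  have [a1 [a2 [aa1 aa2 aa]]] := f5 _ _ m1 m2 h1.
  have [c1 [c2 [cc1 cc2 cc]]] := f5 _ _ m3 m4 h2.
  apply: (nolink (f x1 :|: f x2) (f y1 :|: f y2)).
  - by rewrite subUset !f1.
  - by rewrite subUset !f1.
  - rewrite -setI_eq0 setIUl !setIUr !setU_eq0 !setI_eq0.
    by rewrite (f4 _ _ m1 m3) // (f4 _ _ m1 m4) // (f4 _ _ m2 m3) // (f4 _ _ m2 m4).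
  - by apply: (connU es (f3 _ m1) (f3 _ m2) aa1 aa2).
  - by apply: (connU es (f3 _ m3) (f3 _ m4) cc1 cc2).
  - by rewrite inE tf.
  - by rewrite inE tf // orbT.
  - by rewrite inE tf.
  - by rewrite inE tf // orbT.
have [k12 k13 k14 k23] : [/\ x2 != x1, y1 != x1, y2 != x1 & y1 != x2] by split; rewrite eq_sym.
have [k24 k34] : y2 != x2 /\ y2 != y1 by split; rewrite eq_sym.
have adj a a' b b' : [set a; a'] = [set x1; x2] -> [set b; b'] = [set y1; y2] ->
    a != a' -> b != b' -> a != b -> a != b' -> a' != b -> a' != b' -> e' a b.
  move=> Ea Eb naa nbb nab nab' nab1 nab2.
  have E : [set x1; x2; y1; y2] = [set a; a'] :|: [set b; b'] by rewrite Ea Eb setUA.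
  have [i1 i2 i3 i4] : [/\ a \in [set x1; x2; y1; y2], a' \in [set x1; x2; y1; y2],
     b \in [set x1; x2; y1; y2] & b' \in [set x1; x2; y1; y2]] by rewrite E !inE !eqxx !orbT.
  apply/negPn/negP=> nab0; apply: no.
  have eaa : e' a a'.
    apply/negPn/negP=> h; apply: (@kconn2_two_neighbours _ _ a b' a' ce') => //; rewrite 1?eq_sym //.
    move=> w; rewrite E !inE => /orP[/orP[]|/orP[]] /eqP -> //; rewrite ?eqxx //.
    + by rewrite (negPf h).
    + by rewrite (negPf nab0).
  have ebb : e' b b'.
    apply/negPn/negP=> h; apply: (@kconn2_two_neighbours _ _ b a' b' ce') => //; rewrite 1?eq_sym //.
    move=> w; rewrite E !inE => /orP[/orP[]|/orP[]] /eqP -> //; rewrite ?eqxx //.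
    + by rewrite es' (negPf nab0).
    + by rewrite (negPf h).
  split.
  + have : x1 \in [set a; a'] by rewrite Ea !inE eqxx.
    have : x2 \in [set a; a'] by rewrite Ea !inE eqxx orbT.
    rewrite !inE => /orP[] /eqP E2 /orP[] /eqP E1; rewrite E1 E2 ?eqxx // in n12 *.
    by rewrite es'.
  + have : y1 \in [set b; b'] by rewrite Eb !inE eqxx.
    have : y2 \in [set b; b'] by rewrite Eb !inE eqxx orbT.
    rewrite !inE => /orP[] /eqP E2 /orP[] /eqP E1; rewrite E1 E2 ?eqxx // in n34 *.
    by rewrite es'.
have Cx : [set x2; x1] = [set x1; x2] by rewrite setUC.
have Cy : [set y2; y1] = [set y1; y2] by rewrite setUC.
have e11 : e' x1 y1 by apply: (@adj x1 x2 y1 y2).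
have e12 : e' x1 y2 by apply: (@adj x1 x2 y2 y1).
have e21 : e' x2 y1 by apply: (@adj x2 x1 y1 y2).
have e22 : e' x2 y2 by apply: (@adj x2 x1 y2 y1).
exists f; split=> //; split=> // i j iT jT ij; apply: f5 => //; move: iT jT ij.
rewrite /= !inE => /orP[/orP[/orP[]|]|] /eqP-> /orP[/orP[/orP[]|]|] /eqP->;
  rewrite ?eqxx ?orbT //= ?(negPf k13) ?(negPf k14) ?(negPf k23) ?(negPf k24) //= ?[e' y1 _]es' ?[e' y2 _]es' //.
Qed.

End Rooted.

(** * Separations of order three in a 3-connected graph *)

Section ThreeConnected.
Variables (T : finType) (e : rel T) (S : {set T}).
Hypothesis es : symmetric e.
Hypothesis cS : kconn e 3 S.
Implicit Types (D E : {set T}) (a b c n u v z : T).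

(** What [D1] satisfies as one side of a separation by [z], [n] and [c] whose other side is [D2]. A
    separation is given by both orders. *)
Definition splitting z n c D1 D2 :=
  [/\ D1 != set0, nb e S D1 \subset [set z; n; c],
      forall x, x \in D1 -> [/\ x \in S, x != z, x != n, x != c & x \notin D2] &
      forall x, x \in S -> x != z -> x != n -> x != c ->
        (x \in D1) || (x \in D2)].

Lemma kconn3_small D a b w : D \subset S -> D != set0 ->
  nb e S D \subset [set a; b] -> w \in S -> w \notin D -> w != a -> w != b -> False.
Proof.
move=> sD D0 nbD wS wD wa wb.
have c2 : #|[set a; b]| < 3 by rewrite cards2; case: (a != b).
have := subsetP (kconn_sub cS sD D0 nbD c2) _ wS.
by rewrite !inE (negPf wD) (negPf wa) (negPf wb).
Qed.

(** The cut vertex [c] exists because [z] and [v] alone cannot separate a 3-connected graph. *)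
Lemma not_2conn_splitting z v : v \in S -> v != z -> ~ kconn e 2 (S :\ z :\ v) ->
  exists c D1 D2, [/\ c \in S, c != z, c != v,
    splitting z v c D1 D2 & splitting z v c D2 D1].
Proof.
move=> vS vz /kconn_not[D sD [D0 lt ne]].
have mD x : x \in D -> [/\ x \in S, x != z & x != v].
  by move/(subsetP sD); rewrite !inE => /and3P[].
have sDS : D \subset S by apply/subsetP=> x /mD[].
have nbS C : nb e (S :\ z :\ v) D = C -> forall x y, x \in D -> y \in S ->
    y \notin D -> e x y -> y \in C :|: [set z; v].
  move=> <- x y xD yS yD xy; rewrite inE; case: nbP => //= h; rewrite !inE.
  apply/negPn/negP; rewrite negb_or => /andP[yz yv]; apply: h; rewrite !inE yz yv yS.
  by split=> //; exists x.
have [w wB wD] : exists2 w, w \in S :\ z :\ v & w \notin D :|: nb e (S :\ z :\ v) D.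
  apply/subsetPn; apply: contra ne => sB; rewrite eqEsubset sB andbT subUset sD /=.
  by apply/subsetP=> y /nbP[].
move: (wB); rewrite !inE => /and3P[wv wz wS].
have [c Nc] : exists c, nb e (S :\ z :\ v) D = [set c].
  apply/cards1P; move: lt; rewrite leq_eqVlt => /orP[//|]; rewrite !ltnS leqn0 cards_eq0 => /eqP N0.
  exfalso; apply: (@kconn3_small D z v w) => //.
  - by apply: nb_sub => x y xD yS yD xy; have := nbS _ N0 x y xD yS yD xy; rewrite set0U.
  - by move: wD; rewrite inE negb_or => /andP[].
have : c \in nb e (S :\ z :\ v) D by rewrite Nc inE.
case/nbP; rewrite !inE => /and3P[cv cz cS'] cD _.
have nbD x y : x \in D -> y \in S -> y \notin D -> e x y -> y \in [set z; v; c].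
  by move=> xD yS yD xy; have := nbS _ Nc x y xD yS yD xy; rewrite !inE orbC.
move: wD; rewrite Nc !inE negb_or => /andP[wD wc].
exists c, D, (S :\ z :\ v :\ c :\: D); split=> //; split.
- by [].
- exact: nb_sub.
- move=> x xD; have [-> -> ->] := mD _ xD; rewrite !inE xD /=; split=> //.
  by apply: contraNneq cD => <-.
- by move=> x xS xz xv xc; rewrite !inE xS xz xv xc /= andbT orbN.
- by apply/set0Pn; exists w; rewrite !inE wD wc wv wz wS.
- apply: nb_sub => x y; rewrite !inE => /andP[xD /and4P[xc xv xz xS]] yS yE xy.
  apply/negPn/negP; rewrite !negb_or => /andP[/andP[yz yv] yc].
  move: yE; rewrite yz yv yc yS /= andbT negbK => yD.
  have := nbD y x yD xS xD; rewrite es => /(_ xy).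
  by rewrite !inE (negPf xc) (negPf xv) (negPf xz).
- by move=> x; rewrite !inE => /and5P[-> -> -> -> ->].
- by move=> x xS xz xv xc; rewrite !inE xS xz xv xc /= andbT orNb.
Qed.

(* [D] is a smallest side, avoiding [u], of a separation of order three through
   [z] and a neighbour of [z].  A neighbour [n] of [z] in [D] gives a second such
   separation, and by minimality none of its sides meets [D]: thus [D] is {n}. *)
Lemma degree_three_neighbour u z : u \in S -> z \in S -> 3 < #|S| ->
  (forall v, v \in S -> v != z -> v != u -> e z v -> ~ kconn e 2 (S :\ z :\ v)) ->
  exists n v c c' D1, [/\ [/\ n \in S, n != z & n != u],
     [/\ v \in S, v != z, v != n & e z v],
     [/\ c \in S, c != z, c != n, c != v & e n c],
     [/\ e n z, e n v & forall w, w \in S -> w != n -> e n w -> w \in [set z; v; c]] &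
     [/\ D1 \subset S, v \in D1, c \notin D1,
      forall x, x \in D1 -> [/\ x != z, x != n & x != c'] & c' != v /\ c' != c /\
      nb e S D1 \subset [set z; n; c']]].
Proof.
move=> uS zS S3 nobad.
pose Q (D : {set T}) := exists v c, [/\ [/\ v \in S, v != z, v != u & e z v],
  [/\ c \in S, c != z & c != v], D != set0 /\ u \notin D,
  forall x, x \in D -> [/\ x \in S, x != z, x != v & x != c] &
  nb e S D \subset [set z; v; c] /\
  exists2 w, w \in S & w \notin D /\ w \notin [set z; v; c]].
have exQ : exists D, Q D.
  have [v [vS vz vu ezv]] : exists v, [/\ v \in S, v != z, v != u & e z v].
    case: (pickP [pred v | [&& v \in S, v != z, v != u & e z v]]) => [v /and4P[]|none]; first by exists v.
    exfalso; have [w wS wN] : exists2 w, w \in S & w \notin [set z; u].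
      apply/subsetPn; apply/negP=> /subset_leq_card; rewrite cards2.
      by case: (z != u) => /= h; lia.
    move: wN; rewrite !inE negb_or => /andP[wz wu].
    apply: (@kconn3_small [set z] u u w) => //.
    - by rewrite sub1set.
    - by apply/set0Pn; exists z; rewrite inE.
    - apply: nb_sub => x y; rewrite !inE => /eqP -> yS yz zy; rewrite orbb.
      by have := none y; rewrite /= yS yz zy andbT /= => /negbFE.
    - by rewrite inE.
  have [c [D1 [D2 [cS' cz cv [D10 N1 m1 cov] [D20 N2 m2 _]]]]] :=
    not_2conn_splitting vS vz (nobad _ vS vz vu ezv).
  have mk D D' : D != set0 -> nb e S D \subset [set z; v; c] ->
      (forall x, x \in D -> [/\ x \in S, x != z, x != v, x != c & x \notin D']) ->
      D' != set0 ->
      (forall x, x \in D' -> [/\ x \in S, x != z, x != v, x != c & x \notin D]) ->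
      u \notin D -> Q D.
    move=> D0 N m D0' m' uD; exists v, c; split=> //; first by move=> x /m[].
    case/set0Pn: D0' => w /m'[wS wz wv wc wD]; split=> //; exists w => //.
    by rewrite !inE (negPf wz) (negPf wv) (negPf wc).
  case: (boolP (u \in D1)) => [uD1|uD1]; last by exists D1; apply: (mk D1 D2).
  by exists D2; apply: (mk D2 D1) => //; case: (m1 _ uD1).
have [D [v [c [[vS vz vu ezv] [cS' cz cv] [D0 uD] mD [ND [h hS [hD hN]]]]]] minD] :=
  min_measure (fun D : {set T} => #|D|) exQ.
have sDS : D \subset S by apply/subsetP=> x /mD[].
have [zD vD cD] : [/\ z \notin D, v \notin D & c \notin D].
  by split; apply/negP=> /mD[]; rewrite eqxx.
move: hN; rewrite !inE !negb_or => /andP[/andP[hz hv] hc].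
have [n nD ezn] : exists2 n, n \in D & e z n.
  case: (pickP [pred x | (x \in D) && e z x]) => [x /andP[]|none]; first by exists x.
  exfalso; apply: (@kconn3_small D v c h) => //.
  apply/subsetP=> y yN; have := subsetP ND _ yN; rewrite !inE => /orP[/orP[/eqP E|->//]|->]; last by rewrite orbT.
  by case/nbP: yN => _ _ [x xD]; have := none x; rewrite /= xD es /= E => ->.
have [n0 [nS nz nv nc]] := (n, mD _ nD).
have nu : n != u by apply: contraNneq uD => <-.
(* A non-empty [E] would be a smaller candidate than [D]: [n], a neighbour of [z] other than [u],
   takes the place of [v], and [q] that of [c]. *)
have small E q : E \subset D -> n \notin E -> q \in S -> q != z -> q != n -> q \notin E ->
    nb e S E \subset [set z; n; q] -> E = set0.
  move=> sE nE qS qz qn qE NE; apply/eqP/negPn/negP=> E0.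
  have : #|D| <= #|E|.
    apply: minD; exists n, q; split=> //.
    - by split=> //; apply: contra uD => /(subsetP sE).
    - move=> x xE; have [-> -> _ _] := mD _ (subsetP sE _ xE); split=> //.
      + by apply: contraNneq nE => <-.
      + by apply: contraNneq qE => <-.
    - split=> //; case: (eqVneq q h) => [E1|qh].
        exists v => //; split; first by apply: contra vD => /(subsetP sE).
        by rewrite !inE (negPf vz) eq_sym (negPf nv) E1 eq_sym (negPf hv).
      exists h => //; split; first by apply: contra hD => /(subsetP sE).
      by rewrite !inE (negPf hz) eq_sym [h == q]eq_sym (negPf qh) orbF; apply: contraNneq hD => <-.
  rewrite leqNgt; case/negP; apply: proper_card.
  by rewrite properE sE; apply/subsetPn; exists n.
have nbrD x y : x \in D -> y \in S -> e x y -> y \notin D -> y \in [set z; v; c].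
  by move=> xD yS xy yD; apply: (subsetP ND); apply/nbP; split=> //; exists x.
have [c' [D1 [D2 [c'S c'z c'n sp1 sp2]]]] := not_2conn_splitting nS nz (nobad _ nS nz nu ezn).
have nbrE D1' D2' x y : splitting z n c' D1' D2' -> x \in D1' -> y \in S -> e x y ->
    y \notin D1' -> y \in [set z; n; c'].
  by case=> _ N _ _ xD yS xy yD; apply: (subsetP N); apply/nbP; split=> //; exists x.
have vcn x : x \in [set v; c] -> [/\ x \in S, x != z, x != n & x \notin D].
  by rewrite !inE => /orP[] /eqP ->; split; rewrite // eq_sym.
(* Suppose [c'] lies in [D]. By [small] each side of the second separation leaves [D], and a side
   that does not contain both [v] and [c] can do so only in [v] or [c]. If one side contains both,
   nothing is left for the other; if neither does, [h] lies on no side. *)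
have c'D : c' \notin D.
  apply/negP=> c'D.
  have notin D1' D2' : splitting z n c' D1' D2' -> exists2 x, x \in D1' & x \notin D.
    move=> sp; apply/subsetPn/negP=> sD.
    have [D0' N' m' _] := sp; case/negP: D0'; apply/eqP; apply: (small _ c') => //.
    + by apply/negP=> /m'[_ _]; rewrite eqxx.
    + by apply/negP=> /m'[_ _ _]; rewrite eqxx.
  have part D1' D2' : splitting z n c' D1' D2' ->
      (forall x, x \in D1' :\: D -> x \in [set v; c]) \/ v \in D1' /\ c \in D1'.
    move=> sp; have [_ _ m' _] := sp.
    have [[vD' cD']|nvc] := pselect (v \in D1' /\ c \in D1'); [by right|left].
    move=> x; rewrite in_setD => /andP[xD xD']; apply/negPn/negP=> xN.
    have [q qvc qN] : exists2 q, q \in [set v; c] & forall y, y \in [set v; c] -> y \in D1' -> y = q.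
      case: (boolP (v \in D1')) => vD'; [exists v|exists c];
        rewrite ?inE ?eqxx ?orbT // => y; rewrite !inE => /orP[] /eqP -> //.
      + by move=> cD'; case: nvc.
      + by rewrite (negPf vD').
    have [xS xz xn xc' _] := m' _ xD'.
    apply: (@kconn3_small (D1' :\: D :\: [set v; c]) z q n) => //.
    + by apply/subsetP=> y; rewrite !inE => /andP[_ /andP[_ /m'[]]].
    + by apply/set0Pn; exists x; rewrite in_setD xN in_setD xD.
    + apply: nb_sub => a b; rewrite !in_setD => /andP[aN /andP[aD aD']] bS bE ab.
      have [aS az an ac' _] := m' _ aD'.
      have bD : b \notin D.
        apply/negP=> bD; have := nbrD b a bD aS; rewrite es => /(_ ab aD).
        by rewrite !inE (negPf az) /= => h2; case/negP: aN; rewrite !inE.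
      case: (boolP (b \in D1')) => bD'.
        move: bE; rewrite bD bD' !andbT negbK => bvc.
        by rewrite !inE (qN _ bvc bD') eqxx orbT.
      have := nbrE _ _ a b sp aD' bS ab bD'; rewrite !inE => /orP[/orP[->//|/eqP E]|/eqP E].
        by rewrite E nD in bD.
      by rewrite E c'D in bD.
    + by rewrite !inE nD /= andbF.
    + by apply: contraTneq nD => ->; case: (vcn _ qvc).
  have hp D1' D2' : splitting z n c' D1' D2' -> splitting z n c' D2' D1' -> v \in D1' /\ c \in D1' -> False.
    move=> s1 s2 [vD' cD'].
    have [_ _ m1 _] := s1; have [_ _ m2 _] := s2.
    case: (part _ _ s2) => [H|[vD2 _]]; last by case: (m1 _ vD'); rewrite vD2.
    have [x xD2 xD] := notin _ _ s2.
    have := H x; rewrite in_setD xD xD2 => /(_ isT).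
    have [_ _ _ _ xD1] := m2 _ xD2.
    by rewrite !inE => /orP[] /eqP E; rewrite E ?vD' ?cD' in xD1.
  case: (part _ _ sp1) => [H1|]; last exact: (hp _ _ sp1 sp2).
  case: (part _ _ sp2) => [H2|]; last exact: (hp _ _ sp2 sp1).
  have [_ _ _ cov] := sp1.
  have hn : h != n by apply: contraNneq hD => ->.
  have hc' : h != c' by apply: contraNneq hD => ->.
  case/orP: (cov _ hS hz hn hc') => hDi; [have := H1 h|have := H2 h];
    by rewrite in_setD hD hDi !inE (negPf hv) (negPf hc) => /(_ isT).
(* If only [q] among [v] and [c] can lie in [D1'] or equal [c'], the part of [D1'] inside [D] is
   attached to [z], [n] and [q] only, and [small] applies. *)
have meet D1' D2' q : splitting z n c' D1' D2' -> q \in [set v; c] ->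
    (forall y, y \in [set v; c] -> (y \in D1') || (y == c') -> y = q) -> D1' :&: D = set0.
  move=> sp qvc qN; have [_ _ m' _] := sp; have [qS qz qn qD] := vcn _ qvc.
  apply: (small _ q) => //; first exact: subsetIr.
  - by rewrite inE; apply/negP=> /andP[/m'[_ _]]; rewrite eqxx.
  - by rewrite inE (negPf qD) andbF.
  - apply: nb_sub => a b; rewrite !in_setI => /andP[aD' aD] bS bE ab.
    case: (boolP (b \in D)) => bD.
      have bD' : b \notin D1' by move: bE; rewrite bD andbT.
      have := nbrE _ _ a b sp aD' bS ab bD'; rewrite !inE => /orP[->//|/eqP E].
      by rewrite E (negPf c'D) in bD.
    have := nbrD a b aD bS ab bD; rewrite !inE -orbA => /orP[->//|bvc].
    have bvc' : b \in [set v; c] by rewrite !inE.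
    have [_ bz bn _] := vcn _ bvc'.
    rewrite (qN b bvc') ?eqxx ?orbT //.
    case: (boolP (b \in D1')) => //= bD'.
    have := nbrE _ _ a b sp aD' bS ab bD'.
    by rewrite !inE (negPf bz) (negPf bn).
(* Otherwise the other side [D2'] misses [D] and, containing neither [v] nor [c], is not adjacent to
   [n]. Then [z] and [c'] would separate it from [n]. *)
have notboth D1' D2' : splitting z n c' D1' D2' -> splitting z n c' D2' D1' ->
    (v \in D1') || (v == c') -> (c \in D1') || (c == c') -> False.
  move=> s1 s2 hv1 hc1.
  have [D20 N2 m2 _] := s2; have [_ _ m1 _] := s1.
  have vD2 : v \notin D2'.
    by apply/negP=> /m2[_ _ _ ne ni]; case/orP: hv1; rewrite ?(negPf ni) ?(negPf ne).
  have cD2 : c \notin D2'.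
    by apply/negP=> /m2[_ _ _ ne ni]; case/orP: hc1; rewrite ?(negPf ni) ?(negPf ne).
  have [q qvc qN] : exists2 q, q \in [set v; c] &
     forall y, y \in [set v; c] -> (y \in D2') || (y == c') -> y = q.
    case: (eqVneq v c') => [E|ne].
      exists v; rewrite ?inE ?eqxx // => y; rewrite !inE => /orP[] /eqP -> //.
      by rewrite (negPf cD2) /= -E => /eqP.
    exists c; rewrite ?inE ?eqxx ?orbT // => y; rewrite !inE => /orP[] /eqP -> //.
    by rewrite (negPf vD2) (negPf ne).
  have E2 := meet _ _ _ s2 qvc qN.
  have disD x : x \in D2' -> x \notin D.
    by move=> x2; apply/negP=> xD; have : x \in D2' :&: D; [rewrite inE x2 xD|rewrite E2 inE].
  apply: (@kconn3_small D2' z c' n) => //.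
  - by apply/subsetP=> x /m2[].
  - apply: nb_sub => a b aD bS bD ab.
    have := nbrE _ _ a b s2 aD bS ab bD; rewrite !inE => /orP[/orP[->//|/eqP E]|->]; last by rewrite orbT.
    have [aS az _ _ _] := m2 _ aD.
    have := nbrD n a nD aS; rewrite -E es => /(_ ab (disD _ aD)).
    rewrite !inE (negPf az) /= => /orP[] /eqP Ea; by rewrite Ea ?(negPf vD2) ?(negPf cD2) in aD.
  - by apply/negP=> /disD; rewrite nD.
  - by rewrite eq_sym.
have notboth1 := notboth _ _ sp1 sp2; have notboth2 := notboth _ _ sp2 sp1.
have [_ _ m1 cov] := sp1; have [_ _ m2 _] := sp2.
have vS' : v \in [set v; c] by rewrite !inE eqxx.
have cS2 : c \in [set v; c] by rewrite !inE eqxx orbT.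
have [_ _ vn _] := vcn _ vS'; have [_ _ cn _] := vcn _ cS2.
have vc' : v != c'.
  apply/eqP=> E; have cc' : c != c' by rewrite -E.
  case/orP: (cov _ cS' cz cn cc') => cDi; [apply: notboth1|apply: notboth2]; by rewrite ?cDi // E eqxx orbT.
have cc' : c != c'.
  apply/eqP=> E.
  case/orP: (cov _ vS vz vn vc') => cDi; [apply: notboth1|apply: notboth2]; by rewrite ?cDi // E eqxx orbT.
have nboth D1' D2' : splitting z n c' D1' D2' ->
    ~ (v \in D1' /\ c \in D1') -> D1' :&: D = set0.
  move=> sp nb'; case: (boolP (v \in D1')) => vD'.
    apply: (meet _ _ v sp) => // y; rewrite !inE => /orP[] /eqP -> //.
    by rewrite (negPf cc') orbF => cD'; case: nb'.
  by apply: (meet _ _ c sp) => // y; rewrite !inE => /orP[] /eqP -> //; rewrite (negPf vD') (negPf vc').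
have I1 : D1 :&: D = set0.
  by apply: (nboth _ _ sp1) => -[a b]; apply: notboth1; rewrite ?a ?b.
have I2 : D2 :&: D = set0.
  by apply: (nboth _ _ sp2) => -[a b]; apply: notboth2; rewrite ?a ?b.
have Dn : D = [set n].
  apply/eqP; rewrite eqEsubset sub1set nD andbT; apply/subsetP=> x xD; rewrite inE.
  apply/negPn/negP=> xn; have [xS xz _ _] := mD _ xD.
  have xc' : x != c' by apply: contraNneq c'D => <-.
  case/orP: (cov _ xS xz xn xc') => xDi.
    by have : x \in D1 :&: D; [rewrite inE xDi xD|rewrite I1 inE].
  by have : x \in D2 :&: D; [rewrite inE xDi xD|rewrite I2 inE].
have nbn w : w \in S -> w != n -> e n w -> w \in [set z; v; c].
  by move=> wS wn nw; apply: (nbrD n) => //; rewrite Dn inE.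
(* If [n] were not adjacent to [q], then [z] and [q'] would separate [n] from [q]. *)
have enq q q' : [set v; c] = [set q; q'] -> q != q' -> e n q.
  move=> E qq'; apply/negPn/negP=> nq.
  have qvc : q \in [set v; c] by rewrite E !inE eqxx.
  have [qS qz qn qD] := vcn _ qvc.
  apply: (@kconn3_small D z q' q) => //.
  apply: nb_sub => x y xD yS yD xy.
  have := nbrD _ _ xD yS xy yD; rewrite -setUA in_setU E in_set1 => /orP[yz|]; first by rewrite !inE yz.
  rewrite !inE => /orP[/eqP Ey|->]; last by rewrite orbT.
  by move: xD nq; rewrite Dn inE -Ey => /eqP <-; rewrite xy.
have env : e n v by apply: (enq v c) => //; rewrite eq_sym.
have enc : e n c by apply: (enq c v) => //; rewrite setUC.
have fin D1' D2' : splitting z n c' D1' D2' -> v \in D1' -> c \notin D1' ->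
  exists n v c c' D1, [/\ [/\ n \in S, n != z & n != u],
     [/\ v \in S, v != z, v != n & e z v],
     [/\ c \in S, c != z, c != n, c != v & e n c],
     [/\ e n z, e n v & forall w, w \in S -> w != n -> e n w -> w \in [set z; v; c]] &
     [/\ D1 \subset S, v \in D1, c \notin D1,
      forall x, x \in D1 -> [/\ x != z, x != n & x != c'] & c' != v /\ c' != c /\
      nb e S D1 \subset [set z; n; c']]].
  case=> _ N m _ vD' cD'; exists n, v, c, c', D1'; split=> //.
  - by split=> //; rewrite es.
  - split=> //; first by apply/subsetP=> x /m[].
      by move=> x /m[].
    by rewrite ![c' == _]eq_sym.
case/orP: (cov _ vS vz vn vc') => vDi.
  by apply: (fin _ _ sp1 vDi); apply/negP=> cDi; apply: notboth1; rewrite ?vDi ?cDi.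
by apply: (fin _ _ sp2 vDi); apply/negP=> cDi; apply: notboth2; rewrite ?vDi ?cDi.
Qed.

End ThreeConnected.

(** * Models and minors *)

Section MinorModel.

Lemma model_val (T : finType) (P : pred T) (e' : rel {x : T | P x}) (e : rel T) :
  (forall x y, e' x y -> e (val x) (val y)) ->
  model e' setT e [set x | P x] (fun x => [set val x]).
Proof.
move=> H; split.
- by move=> x _; rewrite sub1set inE (valP x).
- by move=> x _; apply/set0Pn; exists (val x); rewrite inE.
- by move=> x _; exact: (@conn1 _ e).
- by move=> x y _ _ xy; rewrite disjoints1 inE.
- by move=> x y _ _ /H xy; exists (val x), (val y); rewrite !inE.
Qed.

Lemma model_setT (K : finType) (k : rel K) (T T' : finType) (e : rel T) (S : {set T}) phi
    (e' : rel T') f :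
  model k setT e S phi -> model e S e' setT f -> has_model k e' setT.
Proof. by move=> m1 m2; exists (fun i => \bigcup_(x in phi i) f x); apply: model_comp m1 m2. Qed.

Lemma minor_has_model (H G : sgraph) : minor H G -> has_model (@adj H) (@adj G) setT.
Proof.
elim=> {G} [G [f [fb fa]]|G v _ IH|G u v _ _ IH|G u v uv _ IH].
- exists (fun x => [set f x]); split.
  + by move=> x _; rewrite subsetT.
  + by move=> x _; apply/set0Pn; exists (f x); rewrite inE.
  + by move=> x _; exact: (@conn1 _ (@adj G)).
  + by move=> x y _ _ xy; rewrite disjoints1 inE (bij_eq fb).
  + by move=> x y _ _ xy; exists (f x), (f y); rewrite !inE fa.
- have [phi m] := IH.
  have mv := @model_val G (fun x => x != v) (@adj (del_vertex v)) (@adj G) (fun x y h => h).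
  by have := model_comp m mv => m'; exists (fun i => \bigcup_(x in phi i) [set val x]);
     case: m' => h1 h2 h3 h4 h5; split=> // i _; rewrite subsetT.
- have [phi [h1 h2 h3 h4 h5]] := IH.
  have mi : model (@adj (del_edge u v)) setT (@adj G) setT (fun x => [set x]).
    by apply: (@model_id G) => // x y _ _ /andP[].
  by exists (fun i => \bigcup_(x in phi i) [set x]); apply: (model_comp (And5 h1 h2 h3 h4 h5) mi).
- have [phi m] := IH.
  have nuv : u != v by apply: contraTneq uv => ->; rewrite adj_irrefl.
  have mv := @model_val G (fun x => x != v) (@adj (contract u v)) (contracted (@adj G) u v)
    (fun x y h => proj2 (andP h)).
  have m1 := model_comp m mv.
  have ES : [set x | x != v] = setT :\ v :> {set G} by apply/setP=> x; rewrite !inE andbT.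
  rewrite ES in m1.
  by exists (fun i => \bigcup_(x in \bigcup_(w in phi i) [set val w]) (if x == u then u |: [set v] else [set x]));
    apply: (model_comp m1 (model_contracted (@adj_sym G) (in_setT u) (in_setT v) nuv uv)).
Qed.

(** Induction on the number of adjacent pairs of [G]: an edge that does not come from [H] is
    deleted; when there is none, [f] is an isomorphism. *)
Lemma spanning_minor (H G : sgraph) (f : H -> G) : bijective f ->
  (forall x y, adj x y -> adj (f x) (f y)) -> minor H G.
Proof.
move En : #|[set p : G * G | adj p.1 p.2]| => n.
elim/ltn_ind: n G f En => n IH G f En fb fa.
have [g fK gK] := fb.
case: (pickP [pred p : G * G | adj p.1 p.2 && ~~ adj (g p.1) (g p.2)]) => [[u v] /= /andP[uv nuv]|none].
  apply: (minor_del_edge uv).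
  apply: (IH _ _ (del_edge u v) f erefl fb); last first.
    move=> x y xy; rewrite /= /del_edge_rel /= fa //=; apply: contra nuv.
    rewrite /same_pair => /orP[] /andP[/eqP <- /eqP <-]; rewrite !fK //.
    by rewrite adj_sym.
  rewrite -En; apply: proper_card; rewrite properE; apply/andP; split.
    by apply/subsetP=> p; rewrite !inE => /andP[].
  apply/subsetPn; exists (u, v); rewrite !inE //= /del_edge_rel /= /same_pair !eqxx.
  by rewrite andbF.
apply: minor_iso; exists f; split=> // x y; apply/idP/idP; last exact: fa.
by move=> xy; have := none (f x, f y); rewrite /= xy !fK /= => /negbFE.
Qed.

Lemma conn_val (T : finType) (P : pred T) (e : rel T) (e' : rel {x : T | P x}) (A : {set T}) :
  (forall x y : {x : T | P x}, e (val x) (val y) -> e' x y) -> (forall x, x \in A -> P x) ->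
  conn e A -> conn e' [set x | val x \in A].
Proof.
move=> ee AP cA D sD D0 cl.
have sA : A \subset [set val x | x in D].
  apply: cA.
  - by apply/subsetP=> _ /imsetP[x xD ->]; have := subsetP sD _ xD; rewrite inE.
  - by case/set0Pn: D0 => x xD; apply/set0Pn; exists (val x); apply: imset_f.
  - move=> _ b /imsetP[x xD ->] bA bD; apply/negP=> xb.
    have := cl x (Sub b (AP _ bA)) xD; rewrite inE ?SubK bA => /(_ isT).
    case: (boolP (Sub b (AP b bA) \in D)) => h; first by case/imsetP: bD; exists (Sub b (AP _ bA)); rewrite ?SubK.
    by move/(_ isT)/negP; apply; apply: ee; rewrite ?SubK.
apply/subsetP=> x; rewrite inE => /(subsetP sA) /imsetP[w wD E].
by rewrite (val_inj E).
Qed.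

(** Induction on the number of vertices: a vertex in no bag is deleted, an edge inside a bag is
    contracted. When neither exists, all bags are singletons and [H] is a spanning subgraph of
    [G]. *)
Lemma has_model_minor (H G : sgraph) : has_model (@adj H) (@adj G) setT -> minor H G.
Proof.
move En : #|G| => n; elim/ltn_ind: n G En => n IH G En [phi [p1 p2 p3 p4 p5]].
have T1 i : i \in [set: H] by rewrite inE.
have nHij i j : adj i j -> i != j by apply: contraTneq => ->; rewrite adj_irrefl.
have lt (v : G) : #|{: {x : G | x != v}}| < n.
  rewrite card_sig -En; apply: (@leq_trans #|[predU1 v & [pred x : G | x != v]]|).
    by rewrite cardU1 inE eqxx.
  exact: max_card.
case: (pickP [pred w | [forall i, w \notin phi i]]) => [w /forallP wN|cov].
  apply: (@minor_del_vertex _ _ w); apply: (IH _ (lt w) (del_vertex w) erefl).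
  have PA i x : x \in phi i -> x != w by move=> xi; apply: contraNneq (wN i) => <-.
  exists (fun i => [set x : del_vertex w | val x \in phi i]); split.
  - by move=> i _; rewrite subsetT.
  - move=> i iT; have /set0Pn[x xi] := p2 i iT.
    by apply/set0Pn; exists (Sub x (PA _ _ xi)); rewrite inE ?SubK.
  - move=> i iT; apply: conn_val (p3 i iT); [by []|exact: PA].
  - move=> i j iT jT ij; rewrite -setI_eq0; apply/eqP/setP=> x; rewrite !inE.
    by apply/negP=> /andP[xi]; rewrite (disjointFr (p4 i j iT jT ij) xi).
  - move=> i j iT jT ij; have [x [y [xi yj xy]]] := p5 i j iT jT ij.
    by exists (Sub x (PA _ _ xi)), (Sub y (PA _ _ yj)); rewrite !inE; split.
case: (pickP [pred t : H * G * G | [&& t.1.2 \in phi t.1.1, t.2 \in phi t.1.1 & adj t.1.2 t.2]]) => [[[i0 u] v]|single].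
  case/and3P=> /= ui vi uv.
  have nuv : u != v by apply: contraTneq uv => ->; rewrite adj_irrefl.
  apply: (minor_contract uv); apply: (IH _ (lt v) (contract u v) erefl).
  pose u' : contract u v := Sub u nuv.
  have phiv j : v \in phi j -> j = i0.
    move=> vj; apply/eqP/negPn/negP=> ji.
    by have := disjointFr (p4 j i0 (T1 j) (T1 i0) ji) vj; rewrite vi.
  have adjC (x y : contract u v) : adj (val x) (val y) -> adj x y.
    move=> xy; rewrite /= /contract_rel /= xy andbT.
    by apply: contraTneq xy => ->; rewrite adj_irrefl.
  have adjv (x : contract u v) : adj v (val x) -> x != u' -> adj u' x /\ adj x u'.
    move=> vx ne; have h : adj u' x.
      by rewrite /= /contract_rel /= eq_sym ne /= ?SubK eqxx vx orbT.
    by split=> //; rewrite adj_sym.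
  exists (fun i => [set x : contract u v | val x \in phi i]); split.
  - by move=> i _; rewrite subsetT.
  - move=> i iT; case: (eqVneq i i0) => [->|ne]; first by apply/set0Pn; exists u'; rewrite inE ?SubK.
    have /set0Pn[x xi] := p2 i iT.
    have xv : x != v by apply: contraNneq ne => E; apply/eqP; apply: phiv; rewrite -E.
    by apply/set0Pn; exists (Sub x xv); rewrite inE ?SubK.
  - move=> i iT; case: (boolP (v \in phi i)) => vi'; last first.
      apply: conn_val (p3 i iT); first exact: adjC.
      by move=> x xi; apply: contraNneq vi' => <-.
    have Ei := phiv _ vi'; subst i => D sD D0 cl.
    (* A closed part of the contracted bag is pulled back to [G]: it receives [v] exactly if it
       contains the merged vertex [u']. *)
    pose D' := [set val x | x in D] :|: (if u' \in D then [set v] else set0).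
    have vD' : (v \in D') = (u' \in D).
      rewrite inE; case: ifP => uD; rewrite !inE ?eqxx ?orbT // orbF.
      by apply/negP=> /imsetP[x _ E]; have := valP x; rewrite -E eqxx.
    have valD' (x : contract u v) : (val x \in D') = (x \in D).
      rewrite inE mem_imset //; last exact: val_inj.
      by case: ifP => _; rewrite ?inE ?(negPf (valP x)) ?orbF.
    have sub : phi i0 \subset D'.
      apply: (p3 i0 iT).
      + apply/subsetP=> x; case: (eqVneq x v) => [->//|xv].
        have -> : x = val (Sub x xv : contract u v) by rewrite ?SubK.
        by rewrite valD' => /(subsetP sD); rewrite inE.
      + by case/set0Pn: D0 => x xD; apply/set0Pn; exists (val x); rewrite valD'.
      + move=> a b aD bi bD; apply/negP=> ab.
        case: (eqVneq a v) => [Ea|av].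
          have bv : b != v by apply: contraNneq bD => ->; rewrite -Ea.
          have Eb : b = val (Sub b bv : contract u v) by rewrite ?SubK.
          rewrite Ea vD' in aD; rewrite Eb valD' in bD.
          have vb : adj v (val (Sub b bv : contract u v)) by rewrite ?SubK -Ea.
          have ne : (Sub b bv : contract u v) != u' by apply: contraNneq bD => ->.
          have [h _] := adjv _ vb ne.
          have bi' : (Sub b bv : contract u v) \in [set x : contract u v | val x \in phi i0] by rewrite inE ?SubK.
          by have := cl _ _ aD bi' bD; rewrite h.
        have Ea : a = val (Sub a av : contract u v) by rewrite ?SubK.
        rewrite Ea valD' in aD.
        case: (eqVneq b v) => [Eb|bv].
          rewrite Eb vD' in bD.
          have va : adj v (val (Sub a av : contract u v)) by rewrite ?SubK -Eb adj_sym.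
          have ne : (Sub a av : contract u v) != u' by apply: contraNneq bD => <-.
          have [_ h] := adjv _ va ne.
          have ui' : u' \in [set x : contract u v | val x \in phi i0] by rewrite inE ?SubK.
          by have := cl _ _ aD ui' bD; rewrite h.
        have Eb : b = val (Sub b bv : contract u v) by rewrite ?SubK.
        rewrite Eb valD' in bD.
        have bi' : (Sub b bv : contract u v) \in [set x : contract u v | val x \in phi i0] by rewrite inE ?SubK.
        have h : adj (Sub a av : contract u v) (Sub b bv : contract u v) by apply: adjC; rewrite ?SubK.
        by have := cl _ _ aD bi' bD; rewrite h.
    by apply/subsetP=> x; rewrite inE => /(subsetP sub); rewrite valD'.
  - move=> i j iT jT ij; rewrite -setI_eq0; apply/eqP/setP=> x; rewrite !inE.
    by apply/negP=> /andP[xi]; rewrite (disjointFr (p4 i j iT jT ij) xi).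
  - move=> i j iT jT ij; have [x [y [xi yj xy]]] := p5 i j iT jT ij.
    have nij := nHij _ _ _ ij; have dij := p4 i j iT jT nij.
    have u'i : u' \in [set x : contract u v | val x \in phi i0] by rewrite inE ?SubK.
    case: (eqVneq x v) => [Ex|xv].
      have Ei : i = i0 by apply: phiv; rewrite -Ex.
      have yv : y != v by apply: contraTneq xy => ->; rewrite Ex adj_irrefl.
      have vb : adj v (val (Sub y yv : contract u v)) by rewrite ?SubK -Ex.
      have ne : (Sub y yv : contract u v) != u'.
        by apply/eqP=> /(congr1 val); rewrite ?SubK => E; have := disjointFr dij (x := u); rewrite Ei ui -E yj => /(_ isT).
      have [h _] := adjv _ vb ne.
      by exists u', (Sub y yv); rewrite Ei; split=> //; rewrite inE ?SubK.
    case: (eqVneq y v) => [Ey|yv].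
      have Ej : j = i0 by apply: phiv; rewrite -Ey.
      have vb : adj v (val (Sub x xv : contract u v)) by rewrite ?SubK -Ey adj_sym.
      have ne : (Sub x xv : contract u v) != u'.
        by apply/eqP=> /(congr1 val); rewrite ?SubK => E; have := disjointFl dij (x := u); rewrite Ej ui -E xi => /(_ isT).
      have [_ h] := adjv _ vb ne.
      by exists (Sub x xv), u'; rewrite Ej; split=> //; rewrite inE ?SubK.
    exists (Sub x xv), (Sub y yv); rewrite !inE ?SubK; split=> //.
    by apply: adjC; rewrite ?SubK.
have /choice[f Hf] : forall i, exists x, phi i = [set x].
  move=> i; have /set0Pn[x xi] := p2 i (T1 i); exists x.
  apply/eqP; rewrite eqEsubset sub1set xi andbT; apply: (p3 i (T1 i)).
  - by rewrite sub1set.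
  - by apply/set0Pn; exists x; rewrite inE.
  - move=> a b; rewrite inE => /eqP -> bi _.
    by have := single (i, x, b); rewrite /= xi bi /= => ->.
have fi : injective f.
  move=> i j E; apply/eqP/negPn/negP=> ij.
  by have := p4 i j (T1 i) (T1 j) ij; rewrite !Hf E -setI_eq0 setIid => /eqP/setP/(_ (f j)); rewrite !inE eqxx.
have fs y : exists x, f x = y.
  have := cov y; rewrite /= => /forallPn[i]; rewrite negbK Hf inE => /eqP ->.
  by exists i.
have /choice[g gK] := fs.
apply: (@spanning_minor H G f); first by exists g => // x; apply: fi; rewrite gK.
by move=> x y xy; have [a [b []]] := p5 x y (T1 x) (T1 y) xy; rewrite !Hf !inE => /eqP -> /eqP ->.
Qed.

End MinorModel.

(** * What a model of $K_5$ or $K_{3,3}$ in $G+uv$ leaves in $G$ *)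

Section Bags.
Variables (T : finType) (e : rel T).
Hypothesis es : symmetric e.
Implicit Types (A B C : {set T}) (L : seq {set T}).

Definition touch A B := exists x y, [/\ x \in A, y \in B & e x y].

Definition bags L := [/\ forall A, A \in L -> A != set0, forall A, A \in L -> conn e A &
  pairwise (fun A B => [disjoint A & B]) L].

Lemma touch_sym A B : touch A B -> touch B A.
Proof. by case=> x [y [? ? ?]]; exists y, x; rewrite es. Qed.

Lemma bags_model (K : finType) (k : rel K) L (f : K -> nat) :
  bags L -> injective f -> (forall i, f i < size L) ->
  (forall i j, k i j -> touch (nth set0 L (f i)) (nth set0 L (f j))) ->
  has_model k e setT.
Proof.
move=> [b1 b2 b3] fi fL ft; exists (fun i => nth set0 L (f i)); split.
- by move=> i _; rewrite subsetT.
- by move=> i _; apply: b1; apply: mem_nth.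
- by move=> i _; apply: b2; apply: mem_nth.
- move=> i j _ _ ij; have /pairwiseP := b3 => /(_ set0) H.
  have ne : f i != f j by apply: contra ij => /eqP /fi ->.
  case: (ltngtP (f i) (f j)) ne => // [lt|gt] _; first by apply: H; rewrite ?inE.
  by rewrite disjoint_sym; apply: H; rewrite ?inE.
- by move=> i j _ _ /ft.
Qed.

Lemma K5_minus_model A0 A1 A2 A3 A4 : bags [:: A0; A1; A2; A3; A4] ->
  touch A0 A1 -> touch A0 A2 -> touch A0 A3 -> touch A1 A2 -> touch A1 A3 ->
  touch A1 A4 -> touch A2 A3 -> touch A2 A4 -> touch A3 A4 ->
  has_model (@adj K5_minus) e setT.
Proof.
move=> bg t01 t02 t03 t12 t13 t14 t23 t24 t34.
apply: (@bags_model _ _ _ (fun i : 'I_5 => i : nat) bg) => // [i j|]; first exact: val_inj.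
have ts := touch_sym.
by case=> -[|[|[|[|[|?]]]]] //= ?; case=> -[|[|[|[|[|?]]]]] //= ?; auto.
Qed.

Lemma K33_minus_model X0 X1 X2 Y0 Y1 Y2 : bags [:: X0; X1; X2; Y0; Y1; Y2] ->
  touch X0 Y1 -> touch X0 Y2 -> touch X1 Y0 -> touch X1 Y1 -> touch X1 Y2 ->
  touch X2 Y0 -> touch X2 Y1 -> touch X2 Y2 ->
  has_model (@adj K33_minus) e setT.
Proof.
move=> bg t01 t02 t10 t11 t12 t20 t21 t22.
pose f (i : 'I_3 + 'I_3) := match i with inl i => i : nat | inr i => (3 + i)%N end.
apply: (@bags_model _ _ _ f bg).
- by move=> [i|i] [j|j] /= E; [congr inl; exact: val_inj|have := ltn_ord i; lia|have := ltn_ord j; lia|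
    congr inr; apply: val_inj; exact: addnI E].
- by case=> i /=; have := ltn_ord i; lia.
have ts := touch_sym.
by case=> -[[|[|[|?]]]] //= ?; case=> -[[|[|[|?]]]] //= ?; auto.
Qed.

End Bags.

Section AddedEdge.
Variables (T : finType) (e : rel T) (u v : T).
Hypotheses (es : symmetric e) (ei : irreflexive e) (uv : u != v).
Implicit Types (A B C : {set T}).

Definition plus_edge : rel T := [rel x y | (x != y) && (e x y || same_pair u v x y)].
Local Notation ep := plus_edge.
Local Notation touch := (touch e).
Local Notation bags := (bags e).

Lemma plus_edgeP x y : ep x y -> [\/ e x y, x = u /\ y = v | x = v /\ y = u].
Proof.
case/andP=> _ /orP[|/orP[] /andP[/eqP -> /eqP ->]]; first by constructor 1.
  by constructor 2.
by constructor 3.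
Qed.

Lemma conn_plus_edge A : conn ep A -> ~ (u \in A /\ v \in A) -> conn e A.
Proof.
move=> cA nuv D sD D0 cl; apply: (cA D) => // x y xD yA yD; apply/negP=> /plus_edgeP[xy|[Ex Ey]|[Ex Ey]].
- by have := cl x y xD yA yD; rewrite xy.
- by apply: nuv; rewrite -Ex -Ey; split=> //; apply: (subsetP sD).
- by apply: nuv; rewrite -Ex -Ey; split=> //; apply: (subsetP sD).
Qed.

Lemma touch_plus_edge A B x y : x \in A -> y \in B -> ep x y ->
  ~ (u \in A /\ v \in B) -> ~ (v \in A /\ u \in B) -> touch A B.
Proof.
move=> xA yB /plus_edgeP[xy|[Ex Ey]|[Ex Ey]] h1 h2.
- by exists x, y.
- by case: h1; rewrite -Ex -Ey.
- by case: h2; rewrite -Ex -Ey.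
Qed.

(** The halves are the components of [u] and [v] in [A]: the new edge is the only one that can join
    different components. *)
Lemma split_bag A : conn ep A -> ~ conn e A -> exists Bu Bv,
  [/\ conn e Bu /\ conn e Bv, Bu \subset A /\ Bv \subset A, u \in Bu /\ v \in Bv,
      [disjoint Bu & Bv] & A \subset Bu :|: Bv].
Proof.
move=> cA ncA.
have [uA vA] : u \in A /\ v \in A by apply: contrapT => h; apply: ncA; apply: conn_plus_edge.
have cu := component_conn es uA; have cv := component_conn es vA.
have clo C x y : (forall a b, a \in C -> b \in A -> e a b -> b \in C) -> u \in C -> v \in C ->
    x \in C -> y \in A -> y \notin C -> ~~ ep x y.
  move=> cl uC vC xC yA yC; apply/negP=> /plus_edgeP[xy|[_ Ey]|[_ Ey]]; first by rewrite (cl x) in yC.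
    by rewrite Ey vC in yC.
  by rewrite Ey uC in yC.
have vN : v \notin component e A u.
  apply/negP=> vC; apply: ncA.
  have sA : A \subset component e A u.
    apply: cA; first exact: component_sub.
      by apply/set0Pn; exists u; apply: component_id.
    move=> x y; apply: clo => //; last exact: component_id.
    by move=> a b aC bA ab; apply: component_closed ab.
  have -> : A = component e A u by apply/eqP; rewrite eqEsubset sA component_sub.
  exact: cu.
exists (component e A u), (component e A v); split=> //.
- by rewrite !component_sub.
- by rewrite !component_id.
- rewrite -setI_eq0; apply/negPn/negP=> I0.
  have := cv (component e A u :&: component e A v) (subsetIr _ _) I0.
  have cl x y : x \in component e A u :&: component e A v -> y \in component e A v ->
      y \notin component e A u :&: component e A v -> ~~ e x y.
    rewrite !inE => /andP[xu xv] yv; rewrite yv andbT => yu; apply/negP=> xy.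
    have yA := subsetP (component_sub e vA) y; rewrite inE in yA.
    have := @component_closed _ e A u x y uA; rewrite !inE => /(_ xu (yA yv) xy).
    by rewrite (negPf yu).
  by move/(_ cl)/subsetP/(_ v (component_id e A v)); rewrite inE (negPf vN).
- apply: cA.
  + by rewrite subUset !component_sub.
  + by apply/set0Pn; exists u; rewrite inE component_id.
  + move=> x y; apply: clo; rewrite ?in_setU ?component_id ?orbT //.
    move=> a b; rewrite !in_setU => /orP[] ac bA ab; apply/orP; [left|right]; exact: component_closed ab.
Qed.

Lemma others_I5 (i : 'I_5) : exists a b c d, uniq [:: i; a; b; c; d].
Proof.
by case: i => -[|[|[|[|[|?]]]]] //= ?;
 [exists (inord 1), (inord 2), (inord 3), (inord 4)|exists (inord 0), (inord 2), (inord 3), (inord 4)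
 |exists (inord 0), (inord 1), (inord 3), (inord 4)|exists (inord 0), (inord 1), (inord 2), (inord 4)
 |exists (inord 0), (inord 1), (inord 2), (inord 3)]; rewrite !inE -!val_eqE /= !inordK.
Qed.

Lemma others_I3 (i : 'I_3) : exists a b, uniq [:: i; a; b].
Proof.
by case: i => -[|[|[|?]]] //= ?;
 [exists (inord 1), (inord 2)|exists (inord 0), (inord 2)|exists (inord 0), (inord 1)];
 rewrite !inE -!val_eqE /= !inordK.
Qed.

(** If all bags stay connected without uv, at most one adjacency is lost. Otherwise uv lies inside a
    bag, whose halves share out the adjacencies to the four other bags: a half that touches three of
    them replaces the bag in a $K_5^-$, and a distribution two by two gives a $K_{3,3}^-$ whose
    missing edge would join the halves. *)
Lemma K5_plus_edge : has_model (@complete_rel 5) ep setT ->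
  has_model (@adj K5_minus) e setT \/ has_model (@adj K33_minus) e setT.
Proof.
case=> phi [_ p2 p3 p4 p5].
have T1 (i : 'I_5) : i \in setT by rewrite inE.
have ne i : phi i != set0 by apply: p2.
have cp i : conn ep (phi i) by apply: p3.
have dis i j : i != j -> [disjoint phi i & phi j] by move=> ij; apply: p4.
have tch i j : i != j -> exists x y, [/\ x \in phi i, y \in phi j & ep x y] by move=> ij; apply: p5.
have [[i nci]|allc] := pselect (exists i, ~ conn e (phi i)); last first.
  have cc i : conn e (phi i) by apply: contrapT => h; apply: allc; exists i.
  have [i [j [ij h]]] : exists i j, i != j /\ forall a b, a != b -> a \notin [:: i; j] \/ b \notin [:: i; j] -> touch (phi a) (phi b).
    have [[i [j [ij ui vj]]]|none] := pselect (exists i j, [/\ i != j, u \in phi i & v \in phi j]).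
      have inj w a b : w \in phi a -> w \in phi b -> a = b.
        by move=> wa wb; apply/eqP/negPn/negP=> /dis/disjointFr/(_ wa); rewrite wb.
      exists i, j; split=> // a b ab h; have [x [y [xa yb xy]]] := tch _ _ ab.
      apply: (touch_plus_edge xa yb xy) => -[h1 h2].
        by rewrite (inj _ _ _ ui h1) (inj _ _ _ vj h2) !inE !eqxx orbT in h; case: h.
      by rewrite (inj _ _ _ vj h1) (inj _ _ _ ui h2) !inE !eqxx orbT in h; case: h.
    exists ord0, ord_max; split=> // a b ab _; have [x [y [xa yb xy]]] := tch _ _ ab.
    apply: (touch_plus_edge xa yb xy) => -[h1 h2]; apply: none; first by exists a, b.
    by exists b, a; rewrite eq_sym.
  have [a [b [c un]]] : exists a b c, uniq [:: i; a; b; c; j].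
    have [a [b [c [d un]]]] := others_I5 i.
    have : j \in [:: i; a; b; c; d].
      have : [set w in [:: i; a; b; c; d]] == setT.
        by rewrite eqEcard subsetT cardsT card_ord cardsE (card_uniqP un).
      by move/eqP/setP/(_ j); rewrite !inE.
    move: un; rewrite !inE /= !inE !negb_or ?andbT => /and4P[/and4P[n1 n2 n3 n4] /and3P[n5 n6 n7] /andP[n8 n9] n10].
    rewrite eq_sym (negPf ij) /= => /or4P[] /eqP ->.
    - by exists b, c, d; rewrite /= !inE !negb_or n2 n3 n4 n1 n8 n9 n10 eq_sym n5 eq_sym n6 eq_sym n7.
    - by exists a, c, d; rewrite /= !inE !negb_or n2 n3 n4 n1 n6 n7 n5 n10 eq_sym n8 eq_sym n9.
    - by exists a, b, d; rewrite /= !inE !negb_or n2 n3 n4 n1 n6 n7 n5 n8 n9 eq_sym n10.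
    - by exists a, b, c; rewrite /= !inE !negb_or n2 n3 n4 n1 n6 n7 n5 n8 n9 n10.
  left; move: un; rewrite /= !inE !negb_or !andbT => /and4P[/and4P[n1 n2 n3 n4] /and3P[n5 n6 n7] /andP[n8 n9] n10].
  have hh x y : x != y -> (x != i) && (x != j) || (y != i) && (y != j) -> touch (phi x) (phi y).
    by move=> xy k; apply: h => //; rewrite !inE !negb_or; case/orP: k; auto.
  have [k1 k2 k3] : [/\ a != i, b != i & c != i] by split; rewrite eq_sym.
  apply: (@K5_minus_model _ e es (phi i) (phi a) (phi b) (phi c) (phi j));
    try (by apply: hh; rewrite // ?k1 ?k2 ?k3 ?n7 ?n9 ?n10 ?orbT).
  split; [by move=> A; rewrite !inE => /or4P[|||/orP[]] /eqP ->|
      by move=> A; rewrite !inE => /or4P[|||/orP[]] /eqP ->|].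
  by rewrite /= !dis.
have [Bu [Bv [[cu cv] [sU sV] [uB vB] dB cov]]] := split_bag (cp i) nci.
have [ui vi] : u \in phi i /\ v \in phi i by rewrite (subsetP sU) // (subsetP sV).
have notin j w : j != i -> w \in phi i -> w \notin phi j.
  by move=> ji wi; rewrite (disjointFl (dis _ _ ji) wi).
have cj j : j != i -> conn e (phi j).
  by move=> ji; apply: conn_plus_edge => // -[h _]; move: (notin _ _ ji ui); rewrite h.
have tj j l : j != i -> l != i -> j != l -> touch (phi j) (phi l).
  move=> ji li jl; have [x [y [xj yl xy]]] := tch _ _ jl.
  by apply: (touch_plus_edge xj yl xy) => -[h _]; [move: (notin _ _ ji ui)|move: (notin _ _ ji vi)]; rewrite h.
have half j : j != i -> touch Bu (phi j) \/ touch Bv (phi j).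
  move=> ji; have ij : i != j by rewrite eq_sym.
  have [x [y [xi yj xy]]] := tch _ _ ij.
  have exy : e x y.
    case/plus_edgeP: xy => // -[_ Ey]; have := notin _ _ ji; rewrite Ey in yj.
      by move/(_ _ vi); rewrite yj.
    by move/(_ _ ui); rewrite yj.
  by have := subsetP cov _ xi; rewrite inE => /orP[xB|xB]; [left|right]; exists x, y.
have u0 : Bu != set0 by apply/set0Pn; exists u.
have v0 : Bv != set0 by apply/set0Pn; exists v.
have [a [b [c [d]]]] := others_I5 i; rewrite /= !inE !negb_or !andbT.
case/and4P=> /and4P[n1 n2 n3 n4] /and3P[n5 n6 n7] /andP[n8 n9] n10.
have disB (B : {set T}) j : B \subset phi i -> j != i -> [disjoint B & phi j].
  by move=> sB ji; apply: disjointWl sB _; apply: dis; rewrite eq_sym.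
have three (B : {set T}) x1 x2 x3 x4 : B \subset phi i -> conn e B -> B != set0 ->
    i != x1 -> i != x2 -> i != x3 -> i != x4 -> x1 != x2 -> x1 != x3 -> x1 != x4 ->
    x2 != x3 -> x2 != x4 -> x3 != x4 ->
    touch B (phi x1) -> touch B (phi x2) -> touch B (phi x3) -> has_model (@adj K5_minus) e setT.
  move=> sB cB B0 i1 i2 i3 i4 k1 k2 k3 k4 k5 k6 t1 t2 t3.
  have [j1 j2 j3 j4] : [/\ x1 != i, x2 != i, x3 != i & x4 != i] by split; rewrite eq_sym.
  apply: (@K5_minus_model _ e es B (phi x1) (phi x2) (phi x3) (phi x4)) => //; try exact: tj.
  split; [by move=> A; rewrite !inE => /or4P[|||/orP[]] /eqP ->|
      by move=> A; rewrite !inE => /or4P[|||/orP[]] /eqP -> //; exact: cj|].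
  by rewrite /= !dis // !disB.
have two x1 x2 x3 x4 :
    i != x1 -> i != x2 -> i != x3 -> i != x4 -> x1 != x2 -> x1 != x3 -> x1 != x4 ->
    x2 != x3 -> x2 != x4 -> x3 != x4 ->
    touch Bu (phi x1) -> touch Bu (phi x2) -> touch Bv (phi x3) -> touch Bv (phi x4) ->
    has_model (@adj K33_minus) e setT.
  move=> i1 i2 i3 i4 k1 k2 k3 k4 k5 k6 t1 t2 t3 t4.
  have [j1 j2 j3 j4] : [/\ x1 != i, x2 != i, x3 != i & x4 != i] by split; rewrite eq_sym.
  apply: (@K33_minus_model _ e es Bu (phi x3) (phi x4) Bv (phi x1) (phi x2)) => //;
    try (by apply: touch_sym); try (by apply: tj; rewrite // eq_sym).
  split; [by move=> A; rewrite !inE => /or4P[|||/or3P[]] /eqP ->|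
      by move=> A; rewrite !inE => /or4P[|||/or3P[]] /eqP -> //; exact: cj|].
  by rewrite /= !andbT; do ![apply/andP; split];
    first [exact: dB|by apply: disB|by rewrite disjoint_sym; apply: disB|by apply: dis; rewrite // eq_sym].
have [m5 m6 m7 m8] : [/\ b != a, c != a, d != a & c != b] by split; rewrite eq_sym.
have [m9 m10] : d != b /\ d != c by split; rewrite eq_sym.
have [ia ib ic id] : [/\ a != i, b != i, c != i & d != i] by split; rewrite eq_sym.
have dec j : j != i -> touch Bu (phi j) \/ ~ touch Bu (phi j) /\ touch Bv (phi j).
  by move=> ji; have [|h] := pselect (touch Bu (phi j)); [left|right; case: (half _ ji)].
case: (dec _ ia) => [ta|[_ ta]]; case: (dec _ ib) => [tb|[_ tb]];
case: (dec _ ic) => [tc|[_ tc]]; case: (dec _ id) => [td|[_ td]];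
first [left; by apply: (three Bu a b c d) | left; by apply: (three Bu a b d c)
 | left; by apply: (three Bu a c d b) | left; by apply: (three Bu b c d a)
 | left; by apply: (three Bv a b c d) | left; by apply: (three Bv a b d c)
 | left; by apply: (three Bv a c d b) | left; by apply: (three Bv b c d a)
 | right; by apply: (two a b c d) | right; by apply: (two a c b d) | right; by apply: (two a d b c)
 | right; by apply: (two b c a d) | right; by apply: (two b d a c) | right; by apply: (two c d a b)].
Qed.

End AddedEdge.

Section AddedEdge33.
Variables (T : finType) (e : rel T) (u v : T).
Hypotheses (es : symmetric e) (ei : irreflexive e) (uv : u != v).
Implicit Types (A B C : {set T}).
Local Notation ep := (plus_edge e u v).
Local Notation touch := (touch e).

(** The two classes are kept as separate families so that they can be exchanged: a split bag may be
    assumed to lie in the first. *)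
Definition bipartite_bags (X Y : 'I_3 -> {set T}) :=
  [/\ forall i, X i != set0 /\ Y i != set0, forall i, conn ep (X i) /\ conn ep (Y i),
      forall i j, i != j -> [disjoint X i & X j] /\ [disjoint Y i & Y j],
      forall i j, [disjoint X i & Y j] &
      forall i j, exists x y, [/\ x \in X i, y \in Y j & ep x y]].

Lemma bipartite_bags_swap X Y : bipartite_bags X Y -> bipartite_bags Y X.
Proof.
case=> b1 b2 b3 b4 b5; split.
- by move=> i; have [] := b1 i.
- by move=> i; have [] := b2 i.
- by move=> i j /b3[].
- by move=> i j; rewrite disjoint_sym.
- move=> i j; have [x [y [xX yY xy]]] := b5 j i; exists y, x; split=> //.
  by move: xy; rewrite /plus_edge /= eq_sym es same_pair_sym /same_pair; do 4!case: eqP.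
Qed.

(** Some half of the split bag touches at least two of the three opposite bags; it replaces the bag,
    and at most one adjacency is lost. *)
Lemma K33_split X Y i : bipartite_bags X Y -> ~ conn e (X i) -> has_model (@adj K33_minus) e setT.
Proof.
case=> b1 b2 b3 b4 b5 nci.
have [Bu [Bv [[cu cv] [sU sV] [uB vB] dB cov]]] := split_bag es (proj1 (b2 i)) nci.
have [ui vi] : u \in X i /\ v \in X i by rewrite (subsetP sU) // (subsetP sV).
have notY j w : w \in X i -> w \notin Y j by move=> wi; rewrite (disjointFr (b4 i j) wi).
have notX j w : j != i -> w \in X i -> w \notin X j.
  by move=> ji wi; have [d _] := b3 _ _ ji; rewrite (disjointFl d wi).
have cY j : conn e (Y j).
  by apply: (conn_plus_edge (proj2 (b2 j))) => -[h _]; move: (notY j _ ui); rewrite h.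
have cX j : j != i -> conn e (X j).
  by move=> ji; apply: (conn_plus_edge (proj1 (b2 j))) => -[h _]; move: (notX j _ ji ui); rewrite h.
have tXY a j : a != i -> touch (X a) (Y j).
  move=> ai; have [x [y [xa yj xy]]] := b5 a j.
  by apply: (touch_plus_edge xa yj xy) => -[h _]; [move: (notX _ _ ai ui)|move: (notX _ _ ai vi)]; rewrite h.
have half j : touch Bu (Y j) \/ touch Bv (Y j).
  have [x [y [xi yj xy]]] := b5 i j.
  have exy : e x y.
    case/plus_edgeP: xy => // -[_ Ey]; rewrite Ey in yj; [move: (notY j _ vi)|move: (notY j _ ui)]; by rewrite yj.
  by have := subsetP cov _ xi; rewrite inE => /orP[xB|xB]; [left|right]; exists x, y.
have u0 : Bu != set0 by apply/set0Pn; exists u.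
have v0 : Bv != set0 by apply/set0Pn; exists v.
have [a [b]] := others_I3 i; rewrite /= !inE !negb_or !andbT => /andP[/andP[n1 n2] n3].
have [p [q]] := others_I3 ord0; rewrite /= !inE !negb_or !andbT => /andP[/andP[m1 m2] m3].
have [ai bi] : a != i /\ b != i by split; rewrite eq_sym.
have two (B : {set T}) x1 x2 x3 : B \subset X i -> conn e B -> B != set0 ->
    x1 != x2 -> x1 != x3 -> x2 != x3 -> touch B (Y x1) -> touch B (Y x2) ->
    has_model (@adj K33_minus) e setT.
  move=> sB cB B0 k1 k2 k3 t1 t2.
  apply: (@K33_minus_model _ e es B (X a) (X b) (Y x3) (Y x1) (Y x2)) => //; try exact: tXY.
  split.
  - by move=> A; rewrite !inE => /or4P[|||/or3P[]] /eqP -> //; have [] := b1 a; have [] := b1 b;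
     have [] := b1 x1; have [] := b1 x2; have [] := b1 x3.
  - by move=> A; rewrite !inE => /or4P[|||/or3P[]] /eqP -> //; apply: cX.
  - have dBX j : j != i -> [disjoint B & X j].
      by move=> ji; apply: disjointWl sB _; rewrite eq_sym in ji; have [] := b3 _ _ ji.
    have dBY j : [disjoint B & Y j] by apply: disjointWl sB _.
    have [dab _] := b3 _ _ n3; have [_ d12] := b3 _ _ k1.
    have [_ d13] := b3 _ _ k2; have [_ d23] := b3 _ _ k3.
    rewrite /= !andbT !dBX // !dBY !b4 dab d12 /=.
    by rewrite ![[disjoint Y x3 & _]]disjoint_sym d13 d23.
have [m1' m2' m3'] : [/\ p != ord0, q != ord0 & q != p] by split; rewrite eq_sym.
case: (half ord0) => t0; case: (half p) => tp; case: (half q) => tq;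
first [by apply: (two Bu ord0 p q)|by apply: (two Bu ord0 q p)|by apply: (two Bu p q ord0)
  |by apply: (two Bv ord0 p q)|by apply: (two Bv ord0 q p)|by apply: (two Bv p q ord0)].
Qed.

Lemma K33_plus_edge : has_model (@bipartite_rel 3 3) ep setT -> has_model (@adj K33_minus) e setT.
Proof.
case=> phi [_ p2 p3 p4 p5].
pose X i := phi (inl i); pose Y i := phi (inr i).
have bXY : bipartite_bags X Y.
  split.
  - by move=> i; split; apply: p2.
  - by move=> i; split; apply: p3.
  - by move=> i j ij; split; apply: p4.
  - by move=> i j; apply: p4.
  - by move=> i j; apply: p5.
have [[i nci]|allX] := pselect (exists i, ~ conn e (X i)); first exact: K33_split bXY nci.
have [[i nci]|allY] := pselect (exists i, ~ conn e (Y i)).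
  exact: K33_split (bipartite_bags_swap bXY) nci.
have cX i : conn e (X i) by apply: contrapT => h; apply: allX; exists i.
have cY i : conn e (Y i) by apply: contrapT => h; apply: allY; exists i.
have [b1 _ b3 b4 b5] := bXY.
have injX w a b : w \in X a -> w \in X b -> a = b.
  by move=> wa wb; apply/eqP/negPn/negP=> /b3[/disjointFr/(_ wa)]; rewrite wb.
have injY w a b : w \in Y a -> w \in Y b -> a = b.
  by move=> wa wb; apply/eqP/negPn/negP=> /b3[_ /disjointFr/(_ wa)]; rewrite wb.
have XY w a b : w \in X a -> w \in Y b -> False.
  by move=> wa; rewrite (disjointFr (b4 a b) wa).
have bX k : X k != set0 by have [] := b1 k.
have bY k : Y k != set0 by have [] := b1 k.
have [i [j h]] : exists i j, forall a b, a != i \/ b != j -> touch (X a) (Y b).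
  have fin i j w1 w2 : [set w1; w2] = [set u; v] -> w1 \in X i -> w2 \in Y j ->
      forall a b, a != i \/ b != j -> touch (X a) (Y b).
    move=> E w1X w2Y a b ab; have [x [y [xa yb xy]]] := b5 a b.
    have uE : u \in [set w1; w2] by rewrite E !inE eqxx.
    have vE : v \in [set w1; w2] by rewrite E !inE eqxx orbT.
    have no w w' : w \in [set w1; w2] -> w' \in [set w1; w2] -> w \in X a -> w' \in Y b -> False.
      rewrite !inE => /orP[] /eqP -> /orP[] /eqP -> hX hY.
      - exact: XY hX hY.
      - by case: ab; rewrite ?(injX _ _ _ hX w1X) ?(injY _ _ _ hY w2Y) eqxx.
      - exact: XY hX w2Y.
      - exact: XY hX w2Y.
    by apply: (touch_plus_edge xa yb xy) => -[h1 h2]; [apply: (no u v)|apply: (no v u)].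
  have [[i [j [ui vj]]]|no1] := pselect (exists i j, u \in X i /\ v \in Y j).
    by exists i, j; apply: (fin _ _ u v).
  have [[i [j [vi uj]]]|no2] := pselect (exists i j, v \in X i /\ u \in Y j).
    by exists i, j; apply: (fin _ _ v u); rewrite // setUC.
  exists ord0, ord0 => a b _; have [x [y [xa yb xy]]] := b5 a b.
  by apply: (touch_plus_edge xa yb xy) => -[h1 h2]; [apply: no1|apply: no2]; exists a, b.
have [a [b]] := others_I3 i; rewrite /= !inE !negb_or !andbT => /andP[/andP[n1 n2] n3].
have [p [q]] := others_I3 j; rewrite /= !inE !negb_or !andbT => /andP[/andP[m1 m2] m3].
have [ai bi] : a != i /\ b != i by split; rewrite eq_sym.
have [pj qj] : p != j /\ q != j by split; rewrite eq_sym.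
apply: (@K33_minus_model _ e es (X i) (X a) (X b) (Y j) (Y p) (Y q)); try (by apply: h; auto).
split.
- by move=> A; rewrite !inE => /or4P[|||/or3P[]] /eqP ->; first [exact: bX|exact: bY].
- by move=> A; rewrite !inE => /or4P[|||/or3P[]] /eqP ->; first [exact: cX|exact: cY].
- have [d1 _] := b3 _ _ n1; have [d2 _] := b3 _ _ n2; have [d3 _] := b3 _ _ n3.
  have [_ d4] := b3 _ _ m1; have [_ d5] := b3 _ _ m2; have [_ d6] := b3 _ _ m3.
  by rewrite /= !andbT d1 d2 d3 d4 d5 d6 !b4.
Qed.

Lemma has_model_mono (K : finType) (k : rel K) (e1 e2 : rel T) :
  subrel e1 e2 -> has_model k e1 setT -> has_model k e2 setT.
Proof.
move=> ee [phi m]; apply: (model_setT m (f := fun x => [set x])).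
by apply: model_id => [|x y _ _]; [exact: subsetT|exact: ee].
Qed.

End AddedEdge33.

Section MissingEdge.
Variables (T : finType) (e : rel T).
Hypotheses (es : symmetric e) (ei : irreflexive e).

(* A model of K minus the edge ab becomes a model of K once an edge is drawn
   between the bags of a and b. *)
Lemma has_model_missing_edge (K : finType) (k k' : rel K) (a b : K) :
  (forall i j, k' i j -> k i j || same_pair a b i j) -> a != b ->
  has_model k e setT -> exists u v : T, u != v /\ has_model k' (plus_edge e u v) setT.
Proof.
move=> kk ab [phi [p1 p2 p3 p4 p5]].
have T1 (i : K) : i \in setT by rewrite inE.
have /set0Pn[u ua] := p2 a (T1 a); have /set0Pn[v vb] := p2 b (T1 b).
have uv : u != v.
  by apply/eqP=> E; have := disjointFr (p4 a b (T1 a) (T1 b) ab) ua; rewrite E vb.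
have ee x y : e x y -> plus_edge e u v x y.
  by move=> xy; rewrite /plus_edge /= xy andbT; apply: contraTneq xy => ->; rewrite ei.
exists u, v; split=> //; exists phi; split=> //.
- move=> i iT D sD D0 cl; apply: (p3 i iT D sD D0) => x y xD yi yD.
  by apply/negP=> /ee xy; have := cl x y xD yi yD; rewrite xy.
- move=> i j iT jT /kk /orP[/(p5 i j iT jT) [x [y [xi yj xy]]]|].
    by exists x, y; split=> //; apply: ee.
  case/orP=> /andP[/eqP -> /eqP ->].
    by exists u, v; rewrite /plus_edge /= uv /same_pair !eqxx orbT.
  by exists v, u; rewrite /plus_edge /= eq_sym uv /same_pair !eqxx !orbT.
Qed.

End MissingEdge.

(** * Crossing parities *)

Section CrossingParity.
Variables (T : finType) (e : rel T) (th : rel T) (rho : T -> T -> T -> bool).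
Hypothesis es : symmetric e.
Implicit Types (A B : {set T}) (a b c x y : T) (f : T -> bool).

(* Contribution of the four endpoints to the parity of the crossings of a curve
   from a to b with a curve from x to y; [f] and [g] are the parities of the
   numbers of points of the two curves above a given vertex. *)
Definition parity f a b g x y :=
  (f x (+) f y) (+) (g a (+) g b) (+) ((th a x (+) th a y) (+) (th b x (+) th b y)).

Hypothesis th_anti : forall x y, x != y -> th x y = ~~ th y x.
Hypothesis rhoE : forall a b x y, e a b -> e x y ->
  a != x -> a != y -> b != x -> b != y -> parity (rho a b) a b (rho x y) x y = false.

(** [f] is the sum modulo 2 of the parities of the edges walked along, so it serves as [rho] for the
    concatenated curve. *)
Inductive walk A : T -> T -> (T -> bool) -> Prop :=
| walk0 a : a \in A -> walk A a a (fun _ => false)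
| walkS a c b f : a \in A -> c \in A -> e a c -> walk A c b f ->
    walk A a b (fun w => rho a c w (+) f w).

(** The parity is additive in the first curve: the terms at an intermediate vertex occur twice and
    cancel. *)
Lemma walk_edge A a b f x y : walk A a b f -> e x y -> x \notin A -> y \notin A ->
  parity f a b (rho x y) x y = false.
Proof.
move=> w xy xA yA; elim: w => [a0 aA|a0 c b0 g aA cA ac _ IH].
  by rewrite /parity; do 2!case: (th _ _); case: (rho _ _ _).
have ne w : w \in A -> (w != x) && (w != y).
  by move=> wA; apply/andP; split; apply: contraTneq wA => ->.
have /andP[ax ay] := ne _ aA; have /andP[cx cy] := ne _ cA.
have := rhoE ac xy ax ay cx cy; move: IH; rewrite /parity.
rewrite [(rho _ _ x (+) g x) (+) _]addbACA.
move: (g x (+) g y) (rho a0 c x (+) rho a0 c y) (rho x y a0) (rho x y c) (rho x y b0)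
  (th a0 x (+) th a0 y) (th c x (+) th c y) (th b0 x (+) th b0 y).
by do 8!case.
Qed.

Lemma walk_walk A B a b f x y g : walk A a b f -> walk B x y g -> [disjoint A & B] ->
  parity f a b g x y = false.
Proof.
move=> wA wB dis; elim: wB => [x0 xB|x0 c y0 h xB cB xc _ IH].
  by rewrite /parity addbb /=; do 2!case: (th _ _).
have nA w : w \in B -> w \notin A by move=> wB; rewrite (disjointFl dis wB).
have := walk_edge wA xc (nA _ xB) (nA _ cB); move: IH; rewrite /parity.
move: (f c) (f x0) (f y0) (h a) (h b) (rho x0 c a) (rho x0 c b) => p1 p2 p3 p4 p5 p6 p7.
move: (th a x0) (th a c) (th a y0) (th b x0) (th b c) (th b y0) => q1 q2 q3 q4 q5 q6.
rewrite [(p6 (+) p4) (+) (p7 (+) p5)]addbACA.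
move: (p4 (+) p5) (p6 (+) p7) => s1 s2.
move: p1 p2 p3 s1 s2 q1 q2 q3 q4 q5 q6.
by do 11!case.
Qed.

Lemma conn_walk A a b : conn e A -> a \in A -> b \in A -> exists f, walk A a b f.
Proof.
move=> cA aA bA.
have sub : A \subset [set c in A | `[< exists f, walk A c b f >]].
  apply: cA.
  - by apply/subsetP=> c; rewrite inE => /andP[].
  - apply/set0Pn; exists b; rewrite inE bA; apply/asboolP.
    by exists (fun _ => false); apply: walk0.
  - move=> c d; rewrite !inE => /andP[cA' /asboolP[f wf]] dA; rewrite dA /= => nd.
    apply/negP=> cd; case/asboolP: nd; exists (fun w => rho d c w (+) f w).
    by apply: walkS; rewrite // es.
by have := subsetP sub _ aA; rewrite inE => /andP[_ /asboolP].
Qed.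

(** Each vertex of [K] is replaced by a vertex of its bag and each edge by a walk through two bags.
    As bags are disjoint, edges of [K] without a common end give disjoint walks and inherit the
    parity equations. *)
Lemma model_parity (K : finType) (k : rel K) : has_model k e [set: T] ->
  exists (t : rel K) (F : K -> K -> K -> bool),
    (forall i j, i != j -> t i j = ~~ t j i) /\
    forall i j l m, k i j -> k l m -> i != l -> i != m -> j != l -> j != m ->
      (F i j l (+) F i j m) (+) (F l m i (+) F l m j)
        (+) ((t i l (+) t i m) (+) (t j l (+) t j m)) = false.
Proof.
case=> phi [_ n0 cn dis ed].
have [b bP] : {b : K -> T & forall i, b i \in phi i}.
  by apply: (@choice K T (fun i x => x \in phi i)) => i; apply/set0Pn/n0; rewrite inE.
have [F FP] : {F : K * K -> T -> bool & forall q,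
    k q.1 q.2 -> walk (phi q.1 :|: phi q.2) (b q.1) (b q.2) (F q)}.
  apply: (@choice _ _ (fun q f => k q.1 q.2 -> walk (phi q.1 :|: phi q.2) (b q.1) (b q.2) f)).
  case=> i j /=.
  case kij: (k i j); last by exists (fun _ => false).
  have [||x [y [xi yj xy]]] := ed i j _ _ kij; rewrite ?inE //.
  have [|||f wf] := @conn_walk (phi i :|: phi j) (b i) (b j).
  - exact: connU (cn i (in_setT i)) (cn j (in_setT j)) xi yj xy.
  - by rewrite inE bP.
  - by rewrite inE bP orbT.
  by exists f.
have disb i j : i != j -> [disjoint phi i & phi j] by move=> ij; apply: dis; rewrite ?inE.
exists (fun i j => th (b i) (b j)), (fun i j l => F (i, j) (b l)); split=> [i j ij|].
  by apply: th_anti; apply: contraTneq (bP i) => ->; rewrite (disjointFl (disb _ _ ij)).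
move=> i j l m ij lm il im jl jm.
have := walk_walk (FP (i, j) ij) (FP (l, m) lm); apply.
by rewrite /= -setI_eq0 setIUl !setIUr !(disjoint_setI0 (disb _ _ _)) ?setU0.
Qed.

(** Moves an equation modulo 2 to the natural numbers, where linear arithmetic can add such
    equations up. *)
Lemma even_xor8 (a b c d p q r s : bool) :
  (a (+) b) (+) (c (+) d) (+) ((p (+) q) (+) (r (+) s)) = false ->
  exists n, (a + b + (c + d) + ((p + q) + (r + s)) = n.*2)%N.
Proof.
move=> H; exists ((a + b + (c + d) + ((p + q) + (r + s)))./2).
by move: a b c d p q r s H; do 8!case.
Qed.

Theorem crossing_K5 : ~ has_model (@complete_rel 5) e [set: T].
Proof.
case/model_parity=> t [F [ta P]].
have tn i j : i != j -> (t i j + t j i = 1)%N by move/ta=> ->; case: (t j i).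
pose v0 : 'I_5 := Ordinal (isT : 0 < 5).
pose v1 : 'I_5 := Ordinal (isT : 1 < 5).
pose v2 : 'I_5 := Ordinal (isT : 2 < 5).
pose v3 : 'I_5 := Ordinal (isT : 3 < 5).
pose v4 : 'I_5 := Ordinal (isT : 4 < 5).
have E i j l m ij lm il im jl jm := even_xor8 (P i j l m ij lm il im jl jm).
have [n1 e1] := E v0 v1 v2 v3 isT isT isT isT isT isT.
have [n2 e2] := E v0 v1 v2 v4 isT isT isT isT isT isT.
have [n3 e3] := E v0 v1 v3 v4 isT isT isT isT isT isT.
have [n4 e4] := E v0 v2 v1 v3 isT isT isT isT isT isT.
have [n5 e5] := E v0 v2 v1 v4 isT isT isT isT isT isT.
have [n6 e6] := E v0 v2 v3 v4 isT isT isT isT isT isT.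
have [n7 e7] := E v0 v3 v1 v2 isT isT isT isT isT isT.
have [n8 e8] := E v0 v3 v1 v4 isT isT isT isT isT isT.
have [n9 e9] := E v0 v3 v2 v4 isT isT isT isT isT isT.
have [n10 e10] := E v0 v4 v1 v2 isT isT isT isT isT isT.
have [n11 e11] := E v0 v4 v1 v3 isT isT isT isT isT isT.
have [n12 e12] := E v0 v4 v2 v3 isT isT isT isT isT isT.
have [n13 e13] := E v1 v2 v3 v4 isT isT isT isT isT isT.
have [n14 e14] := E v1 v3 v2 v4 isT isT isT isT isT isT.
have [n15 e15] := E v1 v4 v2 v3 isT isT isT isT isT isT.
have h01 := tn v1 v0 isT.
have h02 := tn v2 v0 isT.
have h03 := tn v3 v0 isT.
have h04 := tn v4 v0 isT.
have h12 := tn v2 v1 isT.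
have h13 := tn v3 v1 isT.
have h14 := tn v4 v1 isT.
have h23 := tn v3 v2 isT.
have h24 := tn v4 v2 isT.
have h34 := tn v4 v3 isT.
(* Every value of [F] occurs in exactly two equations. Each pair among [v2], [v3], [v4] is compared
   three times in each direction, every other pair an even number of times in each direction. The
   total is congruent to nine, hence odd. *)
move: (congr2 addn (congr2 addn (congr2 addn (congr2 addn (congr2 addn (congr2 addn (congr2 addn (congr2 addn (congr2 addn (congr2 addn (congr2 addn (congr2 addn (congr2 addn (congr2 addn e1 e2) e3) e4) e5) e6) e7) e8) e9) e10) e11) e12) e13) e14) e15) h01 h02 h03 h04 h12 h13 h14 h23 h24 h34; clear.
by do ?[move: (nat_of_bool _) => ?]; lia.
Qed.

Theorem crossing_K33 : ~ has_model (@bipartite_rel 3 3) e [set: T].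
Proof.
case/model_parity=> t [F [ta P]].
have tn i j : i != j -> (t i j + t j i = 1)%N by move/ta=> ->; case: (t j i).
pose l0 : 'I_3 + 'I_3 := inl (Ordinal (isT : 0 < 3)).
pose l1 : 'I_3 + 'I_3 := inl (Ordinal (isT : 1 < 3)).
pose l2 : 'I_3 + 'I_3 := inl (Ordinal (isT : 2 < 3)).
pose r0 : 'I_3 + 'I_3 := inr (Ordinal (isT : 0 < 3)).
pose r1 : 'I_3 + 'I_3 := inr (Ordinal (isT : 1 < 3)).
pose r2 : 'I_3 + 'I_3 := inr (Ordinal (isT : 2 < 3)).
have E i j l m ij lm il im jl jm := even_xor8 (P i j l m ij lm il im jl jm).
have [n1 e1] := E l0 r0 l1 r1 isT isT isT isT isT isT.
have [n2 e2] := E l0 r0 l1 r2 isT isT isT isT isT isT.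
have [n3 e3] := E l0 r1 l1 r0 isT isT isT isT isT isT.
have [n4 e4] := E l0 r1 l1 r2 isT isT isT isT isT isT.
have [n5 e5] := E l0 r2 l1 r0 isT isT isT isT isT isT.
have [n6 e6] := E l0 r2 l1 r1 isT isT isT isT isT isT.
have [n7 e7] := E l0 r0 l2 r1 isT isT isT isT isT isT.
have [n8 e8] := E l0 r0 l2 r2 isT isT isT isT isT isT.
have [n9 e9] := E l0 r1 l2 r0 isT isT isT isT isT isT.
have [n10 e10] := E l0 r1 l2 r2 isT isT isT isT isT isT.
have [n11 e11] := E l0 r2 l2 r0 isT isT isT isT isT isT.
have [n12 e12] := E l0 r2 l2 r1 isT isT isT isT isT isT.
have [n13 e13] := E l1 r0 l2 r1 isT isT isT isT isT isT.
have [n14 e14] := E l1 r0 l2 r2 isT isT isT isT isT isT.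
have [n15 e15] := E l1 r1 l2 r0 isT isT isT isT isT isT.
have [n16 e16] := E l1 r1 l2 r2 isT isT isT isT isT isT.
have [n17 e17] := E l1 r2 l2 r0 isT isT isT isT isT isT.
have [n18 e18] := E l1 r2 l2 r1 isT isT isT isT isT isT.
have hr01 := tn r1 r0 isT.
have hr02 := tn r2 r0 isT.
have hr12 := tn r2 r1 isT.
have h00 := tn r0 l0 isT.
have h01 := tn r1 l0 isT.
have h02 := tn r2 l0 isT.
have h10 := tn r0 l1 isT.
have h11 := tn r1 l1 isT.
have h12 := tn r2 l1 isT.
have h20 := tn r0 l2 isT.
have h21 := tn r1 l2 isT.
have h22 := tn r2 l2 isT.
(* Again every value of [F] occurs twice. Each pair among [r0], [r1], [r2] is compared three times
   in each direction, every other pair an even number of times in each direction, so the total is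
   odd. *)
move: (congr2 addn (congr2 addn (congr2 addn (congr2 addn (congr2 addn (congr2 addn (congr2 addn (congr2 addn (congr2 addn (congr2 addn (congr2 addn (congr2 addn (congr2 addn (congr2 addn (congr2 addn (congr2 addn (congr2 addn e1 e2) e3) e4) e5) e6) e7) e8) e9) e10) e11) e12) e13) e14) e15) e16) e17) e18) hr01 hr02 hr12 h00 h01 h02 h10 h11 h12 h20 h21 h22; clear.
by do ?[move: (nat_of_bool _) => ?]; lia.
Qed.

End CrossingParity.

(** * Bar representations *)

Import Order.TTheory GRing.Theory Num.Theory.
Local Open Scope ring_scope.

(** Most hypotheses that say nothing about the order of the field are cleared before [lra] is
    called. *)
Ltac qlra :=
  intros; repeat match goal with
  | H : ?P |- _ => lazymatch type of P with
    | Prop => lazymatch P with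
      | is_true (Order.lt _ _) => fail
      | is_true (Order.le _ _) => fail
      | is_true (andb _ _) => fail
      | @eq nat _ _ => clear H
      | @eq (Finite.sort _) _ _ => clear H
      | @eq _ _ _ => fail
      | _ \/ _ => fail
      | _ /\ _ => fail
      | _ => clear H
      end
    end
  end; lra.

Section Gap.
Variable R : realFieldType.

Lemma seq_bound (s : seq R) : exists2 M, 0 < M & forall p, p \in s -> - M < p < M.
Proof.
elim: s => [|a s [M M0 IH]]; first by exists 1.
exists (M + `|a|) => [|p]; first by rewrite ltr_wpDr.
have := ler_norm a; have := ler_norm (- a); rewrite normrN => h1 h2.
rewrite inE => /orP[/eqP ->|/IH]; lra.
Qed.

(** A bar representation consists of finitely many numbers compared by strict inequalities, so an
    abscissa may move by less than [d] without passing another coordinate. This is the room in which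
    edges, bars and whole pieces are inserted. *)
Lemma seq_gap (s : seq R) : exists2 d, 0 < d &
  forall p q, p \in s -> q \in s -> p < q -> p + d < q.
Proof.
have one (a : R) (t : seq R) : exists2 d : R, 0 < d & forall q, q \in t -> (a < q -> a + d < q) /\ (q < a -> q + d < a).
  elim: t => [|b t [d d0 IH]]; first by exists 1.
  exists (if a == b then d else Num.min d (`|a - b| / 2)).
    case: eqP => // /eqP ab; rewrite lt_min d0 divr_gt0 // ?normr_gt0 ?subr_eq0 //.
  move=> q; rewrite inE => /orP[/eqP ->|/IH[h1 h2]].
    case: eqP => [->|/eqP ab]; first by rewrite ltxx.
    have := ler_norm (a - b); have := ler_norm (- (a - b)); rewrite normrN => k1 k2.
    have ab2 : 0 < `|a - b| by rewrite normr_gt0 subr_eq0.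
    have le : Num.min d (`|a - b| / 2) <= `|a - b| / 2 by rewrite ge_min lexx orbT.
    split=> lt.
      rewrite ltr0_norm ?subr_lt0 // in le ab2 *; lra.
    rewrite gtr0_norm ?subr_gt0 // in le ab2 *; lra.
  case: eqP => // _.
  have le : Num.min d (`|a - b| / 2) <= d by rewrite ge_min lexx.
  by split=> lt; [have := h1 lt|have := h2 lt]; lra.
elim: s => [|a s [d d0 IH]]; first by exists 1.
have [d' d'0 H] := one a s.
exists (Num.min d d'); first by rewrite lt_min d0.
have l1 : Num.min d d' <= d by rewrite ge_min lexx.
have l2 : Num.min d d' <= d' by rewrite ge_min lexx orbT.
move=> p q; rewrite !inE => /orP[/eqP ->|ps] /orP[/eqP ->|qs] lt.
- by rewrite ltxx in lt.
- by have [/(_ lt)] := H _ qs; lra.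
- by have [_ /(_ lt)] := H _ ps; lra.
- by have := IH _ _ ps qs lt; lra.
Qed.
End Gap.

Section Bars.
Variables (R : realFieldType) (T : finType).
Implicit Types (e : rel T) (S B : {set T}) (u v z a b s w n : T) (y l r : T -> R) (x : T -> T -> R).

(* Weak bar visibility representation: the vertex [w] is the open horizontal
   bar ]l w, r w[ at height [y w], the edge ab is the vertical segment at
   abscissa [x a b] between the bars of a and b. *)
Definition bars e S y l r x :=
  [/\ {in S &, injective y},
      {in S, forall w, l w < r w},
      {in S &, forall a b, e a b -> x a b = x b a /\ l a < x a b < r a},
      {in S &, forall a b, e a b -> {in S, forall w, y a < y w < y b ->
         x a b < l w \/ r w < x a b}} &
      {in S &, forall a b, {in S &, forall a' b', e a b -> e a' b' ->
         x a b = x a' b' -> same_pair a b a' b'}}].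

Definition leftmost e S y l x u z :=
  [/\ {in S, forall w, w != u -> y u < y w},
      {in S, forall w, w != z -> y w < y z},
      {in S, forall w, w != u -> w != z -> x u z < l w} &
      {in S &, forall a b, e a b -> ~~ same_pair u z a b -> x u z < x a b}].

Definition barrep e S u z :=
  exists y l r x, bars e S y l r x /\ leftmost e S y l x u z.

(** These points of bars form the skyline, which stands in for the outer face as seen from a new top
    vertex. *)
Definition visible S y l r s (t : R) := l s < t < r s /\
  {in S, forall w, y s < y w -> t < l w \/ r w < t}.

Lemma bars_sub e e' S S' y l r x : S' \subset S -> {in S' &, subrel e' e} ->
  bars e S y l r x -> bars e' S' y l r x.
Proof.
move=> /subsetP sS ee [h1 h2 h3 h4 h5]; split.
- by move=> a b /sS aS /sS; apply: h1.
- by move=> a /sS; apply: h2.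
- by move=> a b aS bS /(ee _ _ aS bS) /h3; apply; apply: sS.
- by move=> a b aS bS /(ee _ _ aS bS) ab w wS; apply: h4 => //; apply: sS.
- move=> a b aS bS a' b' aS' bS' /(ee _ _ aS bS) ab /(ee _ _ aS' bS') ab'.
  by apply: h5 => //; apply: sS.
Qed.

(** A bar above all others blocks no edge. Only its own edges need care: they descend to visible
    points at distinct abscissae not yet in use. *)
Lemma add_top e B y l r x n t (al be : R) (zt : T -> R) :
  symmetric e -> irreflexive e -> bars e B y l r x -> n \notin B ->
  {in B, forall w, y w < t} -> al < be ->
  {in B, forall s, e n s -> al < zt s < be /\ visible B y l r s (zt s)} ->
  {in B &, forall s s', e n s -> e n s' -> zt s = zt s' -> s = s'} ->
  {in B, forall s, e n s -> {in B &, forall a b, e a b -> zt s != x a b}} ->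
  bars e (n |: B) (fun w => if w == n then t else y w)
    (fun w => if w == n then al else l w) (fun w => if w == n then be else r w)
    (fun a b => if a == n then zt b else if b == n then zt a else x a b).
Proof.
move=> es ei [h1 h2 h3 h4 h5] nB yt ab zv zi zx.
have Bn w : w \in B -> (w == n) = false by move=> wB; apply: contraNF nB => /eqP <-.
have cs w : w \in n |: B -> w = n \/ w \in B by rewrite !inE => /orP[/eqP|]; auto.
split.
- move=> a b /cs[->|aB] /cs[->|bB] //; rewrite ?eqxx ?(Bn _ aB) ?(Bn _ bB).
  + by move=> E; have := yt _ bB; rewrite E ltxx.
  + by move=> E; have := yt _ aB; rewrite E ltxx.
  + exact: h1.
- by move=> w /cs[->|wB]; rewrite ?eqxx ?(Bn _ wB) //; apply: h2.
- move=> a b /cs[->|aB] /cs[->|bB]; rewrite ?eqxx ?(Bn _ aB) ?(Bn _ bB).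
  + by rewrite ei.
  + by case/(zv _ bB).
  + by rewrite es => /(zv _ aB) [_ []].
  + exact: h3.
- move=> a b /cs[->|aB] /cs[->|bB]; rewrite ?eqxx ?(Bn _ aB) ?(Bn _ bB).
  + by rewrite ei.
  + move=> nb w /cs[->|wB]; rewrite ?eqxx ?(Bn _ wB); first by rewrite ltxx.
    by have := yt _ wB; qlra.
  + rewrite es => na w /cs[->|wB]; rewrite ?eqxx ?(Bn _ wB); first by rewrite ltxx andbF.
    by case/andP=> yw _; case: (zv _ aB na) => _ [_]; apply.
  + move=> ab' w /cs[->|wB]; rewrite ?eqxx ?(Bn _ wB); last exact: h4.
    by have := yt _ bB; qlra.
- move=> a b /cs[->|aB] /cs[->|bB]; rewrite ?eqxx ?(Bn _ aB) ?(Bn _ bB);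
  move=> a' b' /cs[->|aB'] /cs[->|bB']; rewrite ?eqxx ?(Bn _ aB') ?(Bn _ bB') ?ei // /same_pair ?eqxx ?[n == _]eq_sym ?(Bn _ aB) ?(Bn _ bB) ?(Bn _ aB') ?(Bn _ bB') ?andbF ?andbT ?orbF //=.
  + by move=> nb nb' /(zi _ _ bB bB' nb nb') ->.
  + by rewrite [e a' n]es => nb nb' /(zi _ _ bB aB' nb nb') ->.
  + by move=> nb ab' E; have := zx _ bB nb _ _ aB' bB' ab'; rewrite E eqxx.
  + by rewrite [e a n]es => nb nb' /(zi _ _ aB bB' nb nb') ->.
  + by rewrite [e a n]es [e a' n]es => nb nb' /(zi _ _ aB aB' nb nb') ->.
  + by rewrite [e a n]es => nb ab' E; have := zx _ aB nb _ _ aB' bB' ab'; rewrite E eqxx.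
  + by move=> ab' nb E; have := zx _ bB' nb _ _ aB bB ab'; rewrite E eqxx.
  + by rewrite [e a' n]es => ab' nb E; have := zx _ aB' nb _ _ aB bB ab'; rewrite E eqxx.
  + exact: h5.
Qed.

(** The lowest bar is never strictly between the ends of an edge, so lengthening it blocks
    nothing. *)
Lemma widen_low e B y l r l' r' x u : bars e B y l r x -> u \in B ->
  {in B, forall w, w != u -> y u < y w} -> l' u <= l u -> r u <= r' u ->
  (forall w, w != u -> l' w = l w /\ r' w = r w) -> bars e B y l' r' x.
Proof.
move=> [h1 h2 h3 h4 h5] uB low lel ler E.
have H w : l' w <= l w /\ r w <= r' w.
  by case: (eqVneq w u) => [->//|/E[-> ->]].
split=> //.
- by move=> w wB; have := h2 _ wB; have := H w; qlra.
- move=> a b aB bB ab; have [E1 E2] := h3 _ _ aB bB ab.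
  by split=> //; have := H a; qlra.
- move=> a b aB bB ab w wB yw; case: (eqVneq w u) => [Ew|/E[-> ->]]; last exact: h4.
  exfalso; move: yw; rewrite Ew => /andP[yau _].
  have : y u <= y a by case: (eqVneq a u) => [->//|/(low _ aB) /ltW].
  qlra.
Qed.

Lemma seq_of_coords (y l r : T -> R) (x : T -> T -> R) : exists C : seq R,
  [/\ forall w, y w \in C, forall w, l w \in C, forall w, r w \in C &
      forall a b, x a b \in C].
Proof.
exists ([seq y w | w : T] ++ [seq l w | w : T] ++ [seq r w | w : T] ++
  [seq x p.1 p.2 | p : T * T]); split=> *; rewrite !mem_cat.
- by rewrite image_f.
- by rewrite image_f ?orbT.
- by rewrite image_f ?orbT.
- by rewrite (image_f (fun p : T * T => x p.1 p.2) (x := (_, _))) ?orbT.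
Qed.

(** [v] is put on top of [B] with the bar ]al, be[, and [z] on top of [v] with a bar over all
    abscissae in use. Hence the edges from [z] into [B] have to pass outside ]al, be[, and the edge
    zv inside. *)
Lemma insert_with e B y l r x u v z (al be zvz : R) (zt et : T -> R) :
  symmetric e -> irreflexive e -> bars e B y l r x ->
  v \notin B -> z \notin B -> v != z -> u \in B -> e z u ->
  {in B, forall w, w != u -> y u < y w} ->
  al < zvz < be ->
  {in B, forall s, e v s -> [/\ al < zt s < be, visible B y l r s (zt s),
     zt s != zvz & {in B &, forall a b, e a b -> zt s != x a b}]} ->
  {in B &, forall s s', e v s -> e v s' -> zt s = zt s' -> s = s'} ->
  {in B &, forall a b, e a b -> zvz != x a b} ->
  {in B, forall s, e z s -> [/\ et s < al \/ be < et s, visible B y l r s (et s) &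
      {in B &, forall a b, e a b -> et s != x a b}]} ->
  {in B &, forall s s', e z s -> e z s' -> et s = et s' -> s = s'} ->
  et u < al ->
  {in B, forall w, w != u -> et u < l w} ->
  {in B &, forall a b, e a b -> et u < x a b} ->
  {in B, forall s, e z s -> s != u -> et u < et s} ->
  barrep e (z |: (v |: B)) u z.
Proof.
move=> es ei br vB zB vz uB ezu low /andP[ald bed] zv zi zx ev ei' lf1 lf2 lf3 lf4.
have [C [Cy Cl Cr Cx]] := seq_of_coords y l r x.
have [M M0 HM] := seq_bound (al :: be :: zvz :: [seq zt w | w : T] ++ [seq et w | w : T] ++ C).
have HMC p : p \in C -> - M < p < M by move=> pC; apply: HM; rewrite !inE !mem_cat pC !orbT.
have HMe w : - M < et w < M by apply: HM; rewrite !inE !mem_cat image_f ?orbT.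
have HMz w : - M < zt w < M by apply: HM; rewrite !inE !mem_cat image_f ?orbT.
have HMa : - M < al < M by apply: HM; rewrite !inE eqxx.
have HMb : - M < be < M by apply: HM; rewrite !inE eqxx ?orbT.
have HM0 : - M < zvz < M by apply: HM; rewrite !inE eqxx ?orbT.
have Bn n w : n \notin B -> w \in B -> (w == n) = false by move=> nB wB; apply: contraNF nB => /eqP <-.
have br1 : bars e (v |: B) _ _ _ _ := @add_top e B y l r x v M al be zt es ei br vB
  (fun w _ => proj2 (andP (HMC _ (Cy w)))) (lt_trans ald bed)
  (fun s sB vs => let: And4 h1 h2 _ _ := zv s sB vs in conj h1 h2) zi
  (fun s sB vs => let: And4 _ _ _ h := zv s sB vs in h).
set y1 := fun w : T => if w == v then M else y w in br1.
set l1 := fun w : T => if w == v then al else l w in br1.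
set r1 := fun w : T => if w == v then be else r w in br1.
set x1 := fun a b : T => if a == v then zt b else if b == v then zt a else x a b in br1.
have zvB : z \notin v |: B by rewrite !inE eq_sym (negPf vz).
have uv : u != v by rewrite (Bn v u).
have c1 w : w \in v |: B -> w = v \/ w \in B by rewrite !inE => /orP[/eqP|]; auto.
pose et1 w := if w == v then zvz else et w.
have visB s t : s \in B -> visible B y l r s t -> t < al \/ be < t -> visible (v |: B) y1 l1 r1 s t.
  move=> sB [h1 h2] h3; rewrite /visible /y1 /l1 /r1 (Bn v s) //; split=> // w /c1[->|wB].
    by rewrite eqxx.
  by rewrite (Bn v w) //; apply: h2.
have visv : visible (v |: B) y1 l1 r1 v zvz.
  rewrite /visible /y1 /l1 /r1 eqxx ald bed; split=> // w /c1[->|wB]; rewrite ?eqxx ?ltxx // (Bn v w) //.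
  by have := HMC _ (Cy w); qlra.
have br2 : bars e (z |: (v |: B)) _ _ _ _ := @add_top e (v |: B) y1 l1 r1 x1 z (M + 1) (- M) M et1 es ei br1 zvB
  _ _ _ _ _.
(* The heights in [B] are below [M], the height of [v]; thus [M + 1] is free for [z]. *)
exists (fun w => if w == z then M + 1 else y1 w), (fun w => if w == z then - M else l1 w),
  (fun w => if w == z then M else r1 w),
  (fun a b => if a == z then et1 b else if b == z then et1 a else x1 a b); split.
  apply: br2.
  - by move=> w _; rewrite /y1; case: eqP => _; have := HMC _ (Cy w); qlra.
  - qlra.
  - move=> s /c1[->|sB] zs; first by rewrite /et1 eqxx.
    have [h1 h2 _] := ev _ sB zs.
    rewrite /et1 (Bn v s) //; split; [exact: HMe|exact: visB].
  - move=> s s' /c1[->|sB] /c1[->|sB'] zs zs' //; rewrite /et1 ?eqxx ?(Bn v s) ?(Bn v s') //.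
    + by case: (ev _ sB' zs') => h _ _ E; exfalso; move: h; rewrite -E; qlra.
    + by case: (ev _ sB zs) => h _ _ E; exfalso; move: h; rewrite E; qlra.
    + exact: ei'.
  - move=> s sv zs a b /c1[->|aB] /c1[->|bB] ab; rewrite ?ei // in ab *;
    rewrite /x1 ?eqxx ?(Bn v a) ?(Bn v b) //; case/c1: sv zs => [->|sB] zs;
    rewrite /et1 ?eqxx ?(Bn v s) //.
    + by case: (zv _ bB ab) => _ _; rewrite eq_sym.
    + have [h _ _ _] := zv _ bB ab; have [h' _ _] := ev _ sB zs.
      by apply/eqP=> E; move: h'; rewrite E; qlra.
    + by rewrite es in ab; case: (zv _ aB ab) => _ _; rewrite eq_sym.
    + rewrite es in ab; have [h _ _ _] := zv _ aB ab; have [h' _ _] := ev _ sB zs.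
      by apply/eqP=> E; move: h'; rewrite E; qlra.
    + exact: zx.
    + by have [_ _] := ev _ sB zs; apply.
have c2 w : w \in z |: (v |: B) -> [\/ w = z, w = v | w \in B].
  by rewrite !inE => /or3P[/eqP|/eqP|]; [constructor 1|constructor 2|constructor 3].
have [uz zv'] : u != z /\ z != v by rewrite (Bn z u) // eq_sym.
split.
- move=> w /c2[->|->|wB] wu; rewrite (Bn z u) // /y1 ?eqxx ?(Bn v u) ?(Bn z w) ?(Bn v w) ?(negPf vz) //.
  + by have := HMC _ (Cy u); qlra.
  + by have := HMC _ (Cy u); qlra.
  + exact: low.
- move=> w /c2[->|->|wB] wu; rewrite ?eqxx // in wu *; rewrite ?(negPf vz) ?(Bn z w) // /y1 ?eqxx ?(Bn v w) //.
  + qlra.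
  + by have := HMC _ (Cy w); qlra.
- move=> w /c2[->|->|wB] wu wz; rewrite ?eqxx // in wz *; rewrite (Bn z u) // /et1 (Bn v u) // ?(negPf vz) ?(Bn z w) // /l1 ?eqxx ?(Bn v w) //.
  exact: lf2.
- move=> a b /c2[->|->|aB] /c2[->|->|bB] ab; rewrite /same_pair ?eqxx ?ei // in ab *;
  rewrite ?[_ == u]eq_sym ?(negPf uz) ?(negPf uv) ?(negPf vz) ?(negPf zv') ?(Bn z u) ?(Bn v u) // /et1 /x1
    ?(Bn z a) ?(Bn v a) ?(Bn z b) ?(Bn v b) ?eqxx ?(negPf vz) ?(negPf zv') ?(Bn v u) ?andbF ?andbT //= ?orbF.
  + by move=> _; qlra.
  + by move=> bu; apply: lf4 => //; rewrite eq_sym.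
  + by move=> _; qlra.
  + by move=> _; have [] := zv _ bB ab; qlra.
  + by rewrite es in ab; move=> au; apply: lf4 => //; rewrite eq_sym.
  + by rewrite es in ab; move=> _; have [] := zv _ aB ab; qlra.
  + by move=> _; apply: lf3.
Qed.
Lemma top_visible e B y l r x z s : symmetric e -> bars e (z |: B) y l r x ->
  {in B, forall w, y w < y z} -> s \in B -> e z s -> visible B y l r s (x z s).
Proof.
move=> es [h1 h2 h3 h4 h5] hi sB zs.
have zS : z \in z |: B by rewrite !inE eqxx.
have inS w : w \in B -> w \in z |: B by rewrite inE orbC => ->.
have [E _] := h3 _ _ zS (inS _ sB) zs; rewrite es in zs.
have [_ k] := h3 _ _ (inS _ sB) zS zs.
rewrite E; split=> // w wB lt; apply: (h4 _ _ (inS _ sB) zS zs _ (inS _ wB)).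
by rewrite lt hi.
Qed.

End Bars.

(** * Inserting a vertex just below the top one *)

Section Insert.
Variables (R : realFieldType) (T : finType).
Implicit Types (e : rel T) (S B : {set T}) (u v z a b s w n : T) (y l r : T -> R) (x : T -> T -> R).

Lemma ex_minimum (P : pred T) (f : T -> R) i0 : P i0 ->
  exists2 i, P i & forall j, P j -> f i <= f j.
Proof. by move=> Pi0; case: (arg_minP f Pi0) => i Pi H; exists i. Qed.

Lemma ex_maximum (P : pred T) (f : T -> R) i0 : P i0 ->
  exists2 i, P i & forall j, P j -> f j <= f i.
Proof. by move=> Pi0; case: (arg_maxP f Pi0) => i Pi H; exists i. Qed.

(* The bar of [v] occupies ]al, be[; the edges from [v], from the top vertex
   [z] and between [v] and [z] are at abscissae [zt], [et] and [zvz]. *)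
Lemma skyline_choice (X Y : pred T) u (xi : T -> R) (d M : R) : 0 < d -> Y u ->
  (forall s s', X s || Y s -> X s' || Y s' -> s != s' ->
     xi s + 8 * d < xi s' \/ xi s' + 8 * d < xi s) ->
  (forall s, X s || Y s -> s != u -> xi u + 8 * d < xi s) ->
  (forall s, xi s + 4 * d < M) ->
  (forall a b c f, xi a < xi b -> xi b < xi c -> xi c < xi f ->
     [&& X a, Y b, X c & Y f] || [&& Y a, X b, Y c & X f] -> False) ->
  (forall a b c, uniq [:: a; b; c] -> {in [set a; b; c], forall w, X w && Y w} -> False) ->
  exists al be zvz zt et, [/\ al < zvz < be,
    forall s, X s -> [/\ al < zt s < be, zt s != zvz &
       xi s - 4 * d < zt s < xi s + 4 * d \/ s = u /\ M <= zt s < M + 10],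
    forall s, Y s -> (et s < al \/ be < et s) /\ xi s - 4 * d < et s < xi s + 4 * d,
    (exists2 s, X s || Y s & xi s - 4 * d < zvz < xi s + 4 * d) \/ M <= zvz &
    et u = xi u /\ xi u < al].
Proof.
move=> d0 Yu sepi xiu near_M noalt nocommon.
have uM := near_M u.
(* If [v] has no neighbour except possibly [u], its bar goes to the right of [M], where only the
   stretched bar of [u] will lie below it. *)
have [[x0 [Xx0 x0u]]|noX] := pselect (exists s, X s /\ s != u); last first.
  exists (M + 1), (M + 4), (M + 3), (fun=> M + 2), xi; split.
  - qlra.
  - move=> s Xs; split; [qlra|by apply/eqP; qlra|right].
    by split; [apply/eqP/negPn/negP=> su; apply: noX; exists s|qlra].
  - by move=> s Ys; have := near_M s; split; [left|]; qlra.
  - right; qlra.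
  - by split; qlra.
pose P := [pred s | X s && (s != u)].
have Px0 : P x0 by rewrite /= Xx0.
have [a0 /andP[Xa0 a0u] mina] := ex_minimum xi Px0.
have [b0 /andP[Xb0 b0u] maxb] := ex_maximum xi Px0.
have NX s : X s -> X s || Y s by move->.
have NY s : Y s -> X s || Y s by move->; rewrite orbT.
have ua := xiu _ (NX _ Xa0) a0u; have ub := xiu _ (NX _ Xb0) b0u.
have ab0 : xi a0 <= xi b0 by apply: mina; rewrite /= Xb0.
have minX s : X s -> s != u -> xi a0 <= xi s by move=> Xs su; apply: mina; rewrite /= Xs.
have maxX s : X s -> s != u -> xi s <= xi b0 by move=> Xs su; apply: maxb; rewrite /= Xs.
(* A neighbour of [z] strictly between [a0] and [b0] would give an alternation that starts with [u],
   itself a neighbour of [z] left of [a0]. *)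
have alt1 yy : Y yy -> xi a0 < xi yy -> xi yy < xi b0 -> False.
  move=> Yy l1 l2; apply: (noalt u a0 yy b0) => //; first qlra.
  by rewrite Yu Xa0 Yy Xb0 orbT.
clear x0 Xx0 x0u Px0 mina maxb.
(* If [u] is no neighbour of [v], the bar of [v] just covers [a0] to [b0]; a common neighbour at
   either end sends its edge to [z] past the bar, at distance 2d instead of d. *)
case: (boolP (X u)) => Xu; last first.
  exists (xi a0 - d), (xi b0 + d), (xi a0 + d / 2), xi,
    (fun s => if s == a0 then xi a0 - 2 * d else if s == b0 then xi b0 + 2 * d else xi s); split.
  - qlra.
  - move=> s Xs; have su : s != u by apply: contraNneq Xu => <-.
    have k1 := minX _ Xs su; have k2 := maxX _ Xs su.
    split; [qlra| |by left; qlra].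
    case: (eqVneq s a0) => [->|sa]; first by apply/eqP; qlra.
    by apply/eqP; have := sepi _ _ (NX _ Xs) (NX _ Xa0) sa; qlra.
  - move=> s Ys; case: eqP => [->|/eqP sa]; first by split; [left|]; qlra.
    case: eqP => [->|/eqP sb]; first by split; [right|]; qlra.
    split; last by qlra.
    have k1 := sepi _ _ (NY _ Ys) (NX _ Xa0) sa.
    have k2 := sepi _ _ (NY _ Ys) (NX _ Xb0) sb.
    case: k1 => k1; first by left; qlra.
    case: k2 => k2; last by right; qlra.
    by exfalso; apply: (alt1 s); rewrite //; qlra.
  - by left; exists a0; [rewrite Xa0|qlra].
  - by rewrite eq_sym (negPf a0u) eq_sym (negPf b0u); split=> //; qlra.
(* Nothing of [z] lies right of [a0]: the bar of [v] runs from [a0] to beyond [M] and reaches [u]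
   there, on its stretched part. *)
have [left3|] := pselect (forall s, Y s -> s != u -> xi s <= xi a0).
  exists (xi a0 - d), (M + 5), (M + 2), (fun s => if s == u then M + 3 else xi s),
    (fun s => if s == a0 then xi a0 - 2 * d else xi s); have aM := near_M a0; split.
  - qlra.
  - move=> s Xs; case: eqP => [->|/eqP su].
      by split; [qlra|apply/eqP; qlra|right; split=> //; qlra].
    have k1 := minX _ Xs su; have k2 := near_M s.
    by split; [qlra|apply/eqP; qlra|left; qlra].
  - move=> s Ys; case: eqP => [->|/eqP sa]; first by split; [left|]; qlra.
    split; last by qlra.
    left; case: (eqVneq s u) => [->|su]; first by qlra.
    by have := sepi _ _ (NY _ Ys) (NX _ Xa0) sa; have := left3 _ Ys su; qlra.
  - right; qlra.
  - by rewrite eq_sym (negPf a0u); split=> //; qlra.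
(* Apart from [u], nothing of [z] lies left of [b0]: the bar of [v] starts right after the edge uz
   and reaches [u] at its left end. *)
have [right4|] := pselect (forall s, Y s -> s != u -> xi b0 <= xi s).
  move=> _.
  exists (xi u + d), (xi b0 + d), (xi u + 3 * d), (fun s => if s == u then xi u + 2 * d else xi s),
    (fun s => if s == b0 then xi b0 + 2 * d else xi s); split.
  - qlra.
  - move=> s Xs; case: eqP => [->|/eqP su].
      by split; [qlra|apply/eqP; qlra|left; qlra].
    have k1 := maxX _ Xs su; have k2 := xiu _ (NX _ Xs) su.
    by split; [qlra|apply/eqP; qlra|left; qlra].
  - move=> s Ys; case: eqP => [->|/eqP sa]; first by split; [right|]; qlra.
    split; last by qlra.
    case: (eqVneq s u) => [->|su]; first by left; qlra.
    by right; have := sepi _ _ (NY _ Ys) (NX _ Xb0) sa; have := right4 _ Ys su; qlra.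
  - by left; exists u; rewrite ?Yu ?orbT //; qlra.
  - by rewrite eq_sym (negPf b0u); split=> //; qlra.
move=> /existsNP[y' /not_implyP[Yy' /not_implyP[y'u /negP]]].
rewrite -ltNge => y'b.
move=> /existsNP[y1 /not_implyP[Yy1 /not_implyP[y1u /negP]]].
rewrite -ltNge => y1a; exfalso.
(* Now [z] has neighbours at or beyond both [a0] and [b0]. Together with [u] they alternate with
   those of [v], unless [u], [a0], [b0] are three common neighbours. *)
have y1b : xi b0 <= xi y1 by rewrite leNgt; apply/negP=> k; apply: (alt1 y1).
have y'a : xi y' <= xi a0 by rewrite leNgt; apply/negP=> k; apply: (alt1 y').
have uy' := xiu _ (NY _ Yy') y'u.
case: (eqVneq y' a0) => [E|ne].
  case: (eqVneq y1 b0) => [E1|ne1].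
    apply: (nocommon u a0 b0).
      rewrite /= !inE negb_or eq_sym a0u [u == _]eq_sym b0u /= andbT.
      by apply: contraTneq y'b => <-; rewrite E ltxx.
    by move=> w; rewrite !inE => /orP[/orP[]|] /eqP ->; rewrite ?Xu ?Yu ?Xa0 ?Xb0 -?E -?E1 ?Yy' ?Yy1.
  have k := sepi _ _ (NY _ Yy1) (NX _ Xb0) ne1.
  apply: (noalt u a0 b0 y1); rewrite -?E; try qlra.
  by rewrite Xu Yy' Xb0 Yy1.
have k := sepi _ _ (NY _ Yy') (NX _ Xa0) ne.
apply: (noalt u y' a0 y1); try qlra.
by rewrite Xu Yy' Xa0 Yy1.
Qed.

(** In [e'] the top vertex [z] is joined to all neighbours of [v] and of [z]. These edges are shared
    out between the two bars; the last two hypotheses exclude the obstructions. *)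
Lemma insert_under_top e e' B u v z y l r x :
  symmetric e -> irreflexive e -> symmetric e' -> irreflexive e' ->
  v \notin B -> z \notin B -> v != z -> u \in B -> e z u ->
  bars e' (z |: B) y l r x -> leftmost e' (z |: B) y l x u z ->
  {in B &, subrel e e'} -> {in B, forall s, e v s || e z s -> e' z s} ->
  (forall a b c d, a \in B -> b \in B -> c \in B -> d \in B ->
     x z a < x z b -> x z b < x z c -> x z c < x z d ->
     [&& e v a, e z b, e v c & e z d] || [&& e z a, e v b, e z c & e v d] -> False) ->
  (forall a b c, a \in B -> b \in B -> c \in B -> uniq [:: a; b; c] ->
     {in [set a; b; c], forall w, e v w && e z w} -> False) ->
  barrep R e (z |: (v |: B)) u z.
Proof.
move=> es ei es' ei' vB zB vz uB ezu br [lw hi lfl lfx] ee enb noalt nocommon.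
have inS w : w \in B -> w \in z |: B by rewrite inE orbC => ->.
have zS : z \in z |: B by rewrite !inE eqxx.
have Bn n w : n \notin B -> w \in B -> (w == n) = false by move=> nB wB; apply: contraNF nB => /eqP <-.
have [C [Cy Cl Cr Cx]] := seq_of_coords y l r x.
have [M0 M00 HM0] := seq_bound C.
have [d8 d80 gap8] := seq_gap C.
pose d := d8 / 8.
have d0 : 0 < d by rewrite divr_gt0.
have gap p q : p \in C -> q \in C -> p < q -> p + 8 * d < q.
  move=> pC qC pq; have -> : 8 * d = d8 by rewrite /d; qlra.
  exact: gap8.
pose M := M0 + 4 * d.
have HM p : p \in C -> p + 4 * d < M by move/HM0; rewrite /M; qlra.
pose xi s := x z s.
have xiC s : xi s \in C by exact: Cx.
have [h1 h2 h3 h4 h5] := br.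
have ul w : w \in B -> w != u -> y u < y w by move=> wB; apply: lw; apply: inS.
have yz w : w \in B -> y w < y z by move=> wB; apply: hi; rewrite ?inS // (Bn z w).
have ezu' : e' z u by apply: enb; rewrite // ezu orbT.
have xuz : x u z = xi u by rewrite /xi; have [-> _] := h3 _ _ zS (inS _ uB) ezu'.
have xi_inj s s' : s \in B -> s' \in B -> e' z s -> e' z s' -> xi s = xi s' -> s = s'.
  move=> sB sB' zs zs' /(h5 _ _ zS (inS _ sB) _ _ zS (inS _ sB') zs zs').
  rewrite /same_pair eqxx /= => /orP[/eqP //|/andP[/eqP E _]].
  by rewrite E sB in zB.
have xi_ne s a b : s \in B -> e' z s -> a \in B -> b \in B -> e' a b -> xi s != x a b.
  move=> sB zs aB bB ab; apply/eqP => /(h5 _ _ zS (inS _ sB) _ _ (inS _ aB) (inS _ bB) zs ab).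
  by rewrite /same_pair (Bn z a) // (Bn z b) // !andbF.
have sepi s s' : s \in B -> s' \in B -> e' z s -> e' z s' -> s != s' ->
    xi s + 8 * d < xi s' \/ xi s' + 8 * d < xi s.
  move=> sB sB' zs zs' ne; case: (ltgtP (xi s) (xi s')) => [lt|lt|E].
  - by left; apply: gap.
  - by right; apply: gap.
  - by rewrite (xi_inj s s') ?eqxx in ne.
have xiu s : s \in B -> e' z s -> s != u -> xi u + 8 * d < xi s.
  move=> sB zs su; apply: gap; rewrite ?xiC // -xuz; apply: lfx => //; first exact: inS.
  by rewrite /same_pair eqxx (negPf su) (Bn z s) // !andbF.
(* The bar of [u] is stretched because [skyline_choice] may draw the edge uv at an abscissa from [M]
   up to [M + 10]. *)
pose r' w := if w == u then M + 10 else r w.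
have br' : bars e B y l r' x.
  apply: (@widen_low _ _ e B y l r l r' x u) => //.
  - by apply: (bars_sub _ _ br) => [|a b aB bB]; [exact: subsetUr|exact: ee].
  - by rewrite /r' eqxx; have := HM _ (Cr u); qlra.
  - by move=> w wu; rewrite /r' (negPf wu).
have rr' w : r w <= r' w by rewrite /r'; case: eqP => [->|//]; have := HM _ (Cr u); qlra.
have nu s w : s \in B -> w \in B -> y s < y w -> w != u.
  move=> sB wB lt; apply: contraTneq lt => ->; rewrite -leNgt.
  by case: (eqVneq s u) => [->//|/(ul _ sB)/ltW].
pose near s (t : R) := xi s - 4 * d < t < xi s + 4 * d.
have near_vis s t : s \in B -> e' z s -> near s t -> visible B y l r' s t.
  move=> sB zs nt; have [E /andP[l1 l2]] := h3 _ _ zS (inS _ sB) zs.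
  have [_ /andP[l3 l4]] : x s z = x z s /\ l s < x s z < r s.
    by have := h3 _ _ (inS _ sB) zS; rewrite es' => /(_ zs) [].
  have g1 := gap _ _ (Cl s) (Cx s z) l3; have g2 := gap _ _ (Cx s z) (Cr s) l4.
  move: nt g1 g2; rewrite /near /xi E => nt g1 g2; split; first by have := rr' s; qlra.
  move=> w wB lt; rewrite /r' (negPf (nu s w _ _ _)) //.
  have := h4 _ _ (inS _ sB) zS; rewrite es' => /(_ zs w (inS _ wB)).
  rewrite lt yz // => /(_ isT) [k|k]; [left|right].
    by have := gap _ _ (Cx s z) (Cl w) k; qlra.
  by have := gap _ _ (Cr w) (Cx s z) k; qlra.
have near_ne s t : s \in B -> e' z s -> near s t -> {in B &, forall a b, e a b -> t != x a b}.
  move=> sB zs nt a b aB bB ab; apply/eqP=> E; have ab' := ee _ _ aB bB ab.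
  have := xi_ne _ _ _ sB zs aB bB ab'; rewrite neq_lt; move: nt; rewrite /near E => nt /orP[k|k].
    by have := gap _ _ (xiC s) (Cx a b) k; qlra.
  by have := gap _ _ (Cx a b) (xiC s) k; qlra.
have near_inj s s' t : s \in B -> s' \in B -> e' z s -> e' z s' -> near s t -> near s' t -> s = s'.
  move=> sB sB' zs zs' n1 n2; apply/eqP/negPn/negP=> /(sepi _ _ sB sB' zs zs').
  by move: n1 n2; rewrite /near; qlra.
have near_M s t : near s t -> t < M by have := HM _ (xiC s); rewrite /near; qlra.
have fin al be zvz zt et :
    al < zvz < be ->
    {in B, forall s, e v s -> [/\ al < zt s < be, zt s != zvz &
       near s (zt s) \/ s = u /\ M <= zt s < M + 10]} ->
    {in B, forall s, e z s -> (et s < al \/ be < et s) /\ near s (et s)} ->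
    (exists s, [/\ s \in B, e' z s & near s zvz]) \/ M <= zvz ->
    et u = xi u -> xi u < al -> barrep R e (z |: (v |: B)) u z.
  move=> hz hzt het hn eu ua.
  have vN s : s \in B -> e v s -> e' z s by move=> sB vs; apply: enb; rewrite // vs.
  have zN s : s \in B -> e z s -> e' z s by move=> sB vs; apply: enb; rewrite // vs orbT.
  have far t a b : M <= t -> t != x a b.
    by move=> Mt; apply/eqP=> E; have := HM _ (Cx a b); rewrite -E; qlra.
  apply: (insert_with es ei br' vB zB vz uB ezu (zvz := zvz) (al := al) (be := be) (zt := zt) (et := et)) => //.
  - move=> s sB vs; have [k1 k2 k3] := hzt _ sB vs; split=> //; case: k3 => [k|[-> k]].
    + by apply: near_vis; rewrite ?vN.
    + split; last by move=> w wB lt; right; rewrite /r' (negPf (nu u w uB wB lt)); have := HM _ (Cr w); qlra.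
      have := HM _ (Cl u); rewrite /r' eqxx; qlra.
    + by apply: near_ne k; rewrite ?vN.
    + by move=> a b aB bB ab; apply: far; qlra.
  - move=> s s' sB sB' vs vs' E.
    have [_ _ k] := hzt _ sB vs; have [_ _ k'] := hzt _ sB' vs'.
    case: k k' => [k|[Es k]] [k'|[Es' k']]; last by rewrite Es Es'.
    + by apply: (near_inj s s' (zt s)) => //; rewrite ?vN // E.
    + by exfalso; have := near_M _ _ k; rewrite E; qlra.
    + by exfalso; have := near_M _ _ k'; rewrite -E; qlra.
  - move=> a b aB bB ab; case: hn => [[s [sB zs k]]|k]; last exact: far.
    by apply: (near_ne s).
  - move=> s sB zs; have [k1 k2] := het _ sB zs; split=> //.
    + by apply: near_vis; rewrite ?zN.
    + by apply: near_ne k2; rewrite ?zN.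
  - move=> s s' sB sB' zs zs' E; have [_ k] := het _ sB zs; have [_ k'] := het _ sB' zs'.
    by apply: (near_inj s s' (et s)) => //; rewrite ?zN // E.
  - by rewrite eu.
  - by move=> w wB wu; rewrite eu -xuz; apply: lfl; rewrite ?inS // (Bn z w).
  - move=> a b aB bB ab; rewrite eu -xuz; apply: lfx; rewrite ?inS // ?ee //.
    by rewrite /same_pair (Bn z a) // (Bn z b) // !andbF.
  - move=> s sB zs su; have [_] := het _ sB zs; rewrite eu /near.
    by have := xiu _ sB (zN _ sB zs) su; qlra.
have NV s : s \in B -> e v s || e z s -> e' z s by exact: enb.
have [|||||||al [be [zvz [zt [et [c1 c2 c3 c4 [c5 c6]]]]]]] :=
  @skyline_choice [pred s | (s \in B) && e v s] [pred s | (s \in B) && e z s] u xi d M.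
- by [].
- by rewrite /= uB ezu.
- by move=> s s'; rewrite /= -!andb_orr => /andP[sB ns] /andP[sB' ns'] ne; apply: sepi; rewrite ?NV.
- by move=> s; rewrite /= -!andb_orr => /andP[sB ns] su; apply: xiu; rewrite ?NV.
- by move=> s; apply: HM.
- move=> a b c f l1 l2 l3 h.
  have [aB bB cB fB] : [/\ a \in B, b \in B, c \in B & f \in B].
    by case/orP: h => /and4P[/andP[? _] /andP[? _] /andP[? _] /andP[? _]].
  by apply: (noalt a b c f) => //; move: h; rewrite /= aB bB cB fB.
- move=> a b c un H.
  have [Ha Hb Hc] : [/\ a \in B, b \in B & c \in B].
    by split; [have := H a|have := H b|have := H c]; rewrite !inE eqxx ?orbT => /(_ isT) /andP[/andP[]].
  apply: (nocommon a b c) => // w /H /andP[/andP[_ ->] /andP[_ ->]]; by [].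
apply: (fin al be zvz zt et) => //.
- by move=> s sB vs; apply: c2; rewrite /= sB.
- by move=> s sB zs; apply: c3; rewrite /= sB.
- case: c4 => [[s sXY k]|]; [left|by right]; exists s.
  by move: sXY; rewrite /= -andb_orr => /andP[sB ns]; split; rewrite // NV.
Qed.

End Insert.

(** * Disjoint connected sets on the skyline *)

Section Noncrossing.
Variables (R : realFieldType) (T : finType).
Implicit Types (e : rel T) (S B P Q : {set T}) (u v z a b s w n : T) (y l r : T -> R) (x : T -> T -> R).

Lemma component_adjacent e P n p : symmetric e -> conn e P -> n \in P -> p \in P -> p != n ->
  exists2 w, w \in component e (P :\ n) p & e w n.
Proof.
move=> es cP nP pP pn.
have pPn : p \in P :\ n by rewrite !inE pn.
apply: contrapT => no.
have := cP (component e (P :\ n) p).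
have sP : component e (P :\ n) p \subset P by apply: subset_trans (component_sub _ pPn) (subD1set _ _).
have c0 : component e (P :\ n) p != set0 by apply/set0Pn; exists p; apply: component_id.
move/(_ sP c0) => sub; have /sub : forall a b, a \in component e (P :\ n) p ->
    b \in P -> b \notin component e (P :\ n) p -> ~~ e a b; last first.
  by move/subsetP/(_ _ nP)/(subsetP (component_sub e pPn)); rewrite !inE eqxx.
move=> a b aC bP bC; apply/negP=> ab; case: (eqVneq b n) => [E|bn]; first by apply: no; exists a; rewrite // -E.
by case/negP: bC; apply: component_closed ab; rewrite // !inE bn.
Qed.

(** Remove the highest bar [n]. If it belongs to [P], say, a component of the rest of [P] contains a
    neighbour of [n], which becomes visible within the range of [n]; no visible point of [Q] lies in
    that range. So the lost point can be replaced and the alternation persists among fewer bars. *)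
Lemma noncrossing e B y l r x P Q s1 s2 s3 s4 t1 t2 t3 t4 :
  symmetric e -> bars e B y l r x -> P \subset B -> Q \subset B ->
  [disjoint P & Q] -> conn e P -> conn e Q ->
  s1 \in P -> s2 \in Q -> s3 \in P -> s4 \in Q ->
  visible B y l r s1 t1 -> visible B y l r s2 t2 ->
  visible B y l r s3 t3 -> visible B y l r s4 t4 ->
  t1 < t2 -> t2 < t3 -> t3 < t4 -> False.
Proof.
move=> es; move Ek : #|B| => k.
elim: k B Ek P Q s1 s2 s3 s4 t1 t2 t3 t4.
  move=> B /eqP; rewrite cards_eq0 => /eqP -> P Q s1 s2 s3 s4 t1 t2 t3 t4 _.
  by rewrite subset0 => /eqP -> _ _ _ _; rewrite inE.
move=> k IH B Ek P Q s1 s2 s3 s4 t1 t2 t3 t4 br sP sQ dPQ cP cQ m1 m2 m3 m4 v1 v2 v3 v4 lt1 lt2 lt3.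
have s1B := subsetP sP _ m1.
have [n nB maxn] : exists2 n, n \in B & forall w, w \in B -> y w <= y n by apply: (ex_maximum (P := mem B) y s1B).
have [h1 h2 h3 h4 h5] := br.
have yn w : w \in B -> w != n -> y w < y n.
  move=> wB wn; rewrite lt_neqAle (maxn _ wB) andbT; apply: contra wn => /eqP E.
  by rewrite (h1 _ _ wB nB E).
have En : #|B :\ n| = k by move: Ek; rewrite (cardsD1 n) nB => -[].
have br' : bars e (B :\ n) y l r x by apply: (bars_sub _ _ br) => //; apply: subD1set.
have vis' s t : s != n -> visible B y l r s t -> visible (B :\ n) y l r s t.
  by move=> sn [k1 k2]; split=> // w; rewrite !inE => /andP[_]; apply: k2.
have out s t : s \in B -> s != n -> visible B y l r s t -> t < l n \/ r n < t.
  by move=> sB sn [_ k2]; apply: k2 => //; apply: yn.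
have inn t : visible B y l r n t -> l n < t < r n by case.
have sD (A : {set T}) : A \subset B -> n \notin A -> A \subset B :\ n.
  by move=> sA nA; apply/subsetP=> a aA; rewrite !inE (subsetP sA) // andbT; apply: contraNneq nA => <-.
have escape (A : {set T}) p : A \subset B -> conn e A -> n \in A -> p \in A -> p != n ->
    exists (C : {set T}) w (t : R), [/\ [/\ C \subset A, C \subset B :\ n, conn e C, p \in C & w \in C],
      visible (B :\ n) y l r w t & l n < t < r n].
  move=> sA cA nA pA pn; have pAn : p \in A :\ n by rewrite !inE pn.
  have [w wC wn] := component_adjacent es cA nA pA pn.
  have sC : component e (A :\ n) p \subset A :\ n := component_sub _ pAn.
  have wA : w \in A :\ n := subsetP sC _ wC.
  have wB : w \in B by apply: (subsetP sA); move: wA; rewrite !inE => /andP[].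
  have wn' : w != n by move: wA; rewrite !inE => /andP[].
  have [E k1] := h3 _ _ wB nB wn.
  exists (component e (A :\ n) p), w, (x w n); split.
  - split=> //.
    + exact: subset_trans sC (subD1set _ _).
    + by apply: subset_trans sC (setSD _ sA).
    + exact: (component_conn es pAn).
    + exact: component_id.
  - split=> // w'; rewrite !inE => /andP[w'n w'B] lt.
    by apply: (h4 _ _ wB nB wn) => //; rewrite lt yn.
  - by rewrite E; have := h3 _ _ nB wB; rewrite es => /(_ wn) [].
have dsub (A C : {set T}) : C \subset A -> forall A' : {set T}, [disjoint A & A'] -> [disjoint C & A'].
  by move=> sC A'; apply: disjointWl.
case: (boolP (n \in P)) => nP.
  have nQ : n \notin Q by rewrite (disjointFr dPQ nP).
  have sQ' := sD _ sQ nQ.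
  have neQ s : s \in Q -> s != n by move=> sQ1; apply: contraNneq nQ => <-.
  have o2 := out _ _ (subsetP sQ _ m2) (neQ _ m2) v2.
  have o4 := out _ _ (subsetP sQ _ m4) (neQ _ m4) v4.
  have v2' := vis' _ _ (neQ _ m2) v2; have v4' := vis' _ _ (neQ _ m4) v4.
  case: o2 => o2; last first.
    have n3 : s3 != n by apply/eqP=> E; move: v3; rewrite E => /inn; qlra.
    have [C [w [t [[C1 C2 C3 C4 C5] vw tn]]]] := escape _ _ sP cP nP m3 n3.
    apply: (IH _ En C Q w s2 s3 s4 t t2 t3 t4 br' C2 sQ' (dsub _ _ C1 _ dPQ) C3 cQ C5 m2 C4 m4 vw v2' (vis' _ _ n3 v3) v4') => //; qlra.
  case: o4 => o4; last first.
    have n1 : s1 != n by apply/eqP=> E; move: v1; rewrite E => /inn; qlra.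
    have [C [w [t [[C1 C2 C3 C4 C5] vw tn]]]] := escape _ _ sP cP nP m1 n1.
    apply: (IH _ En C Q s1 s2 w s4 t1 t2 t t4 br' C2 sQ' (dsub _ _ C1 _ dPQ) C3 cQ C4 m2 C5 m4 (vis' _ _ n1 v1) v2' vw v4') => //; qlra.
  (* Both points of [Q] lie left of [n]: the new point comes last, and [P] and [Q] exchange their
     roles. *)
  have n3 : s3 != n by apply/eqP=> E; move: v3; rewrite E => /inn; qlra.
  have [C [w [t [[C1 C2 C3 C4 C5] vw tn]]]] := escape _ _ sP cP nP m3 n3.
  have dQC : [disjoint Q & C] by rewrite disjoint_sym; apply: dsub dPQ.
  apply: (IH _ En Q C s2 s3 s4 w t2 t3 t4 t br' sQ' C2 dQC cQ C3 m2 C4 m4 C5 v2' (vis' _ _ n3 v3) v4' vw) => //; qlra.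
have sP' := sD _ sP nP.
have neP s : s \in P -> s != n by move=> sQ1; apply: contraNneq nP => <-.
have v1' := vis' _ _ (neP _ m1) v1; have v3' := vis' _ _ (neP _ m3) v3.
case: (boolP (n \in Q)) => nQ; last first.
  have neQ s : s \in Q -> s != n by move=> sQ1; apply: contraNneq nQ => <-.
  exact: (IH _ En P Q s1 s2 s3 s4 t1 t2 t3 t4 br' sP' (sD _ sQ nQ) dPQ cP cQ m1 m2 m3 m4
    v1' (vis' _ _ (neQ _ m2) v2) v3' (vis' _ _ (neQ _ m4) v4)).
have o1 := out _ _ s1B (neP _ m1) v1.
have o3 := out _ _ (subsetP sP _ m3) (neP _ m3) v3.
have dQP : [disjoint Q & P] by rewrite disjoint_sym.
case: o1 => o1; last first.
  have n2 : s2 != n by apply/eqP=> E; move: v2; rewrite E => /inn; qlra.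
  have [C [w [t [[C1 C2 C3 C4 C5] vw tn]]]] := escape _ _ sQ cQ nQ m2 n2.
  apply: (IH _ En C P w s1 s2 s3 t t1 t2 t3 br' C2 sP' (dsub _ _ C1 _ dQP) C3 cP C5 m1 C4 m3 vw v1' (vis' _ _ n2 v2) v3') => //; qlra.
case: o3 => o3; last first.
  have n4 : s4 != n by apply/eqP=> E; move: v4; rewrite E => /inn; qlra.
  have [C [w [t [[C1 C2 C3 C4 C5] vw tn]]]] := escape _ _ sQ cQ nQ m4 n4.
  have dPC : [disjoint P & C] by rewrite disjoint_sym; apply: dsub dQP.
  apply: (IH _ En P C s1 w s3 s4 t1 t t3 t4 br' sP' C2 dPC cP C3 m1 C5 m3 C4 v1' vw v3' (vis' _ _ n4 v4)) => //; qlra.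
have n2 : s2 != n by apply/eqP=> E; move: v2; rewrite E => /inn; qlra.
have [C [w [t [[C1 C2 C3 C4 C5] vw tn]]]] := escape _ _ sQ cQ nQ m2 n2.
have dPC : [disjoint P & C] by rewrite disjoint_sym; apply: dsub dQP.
apply: (IH _ En P C s1 s2 s3 w t1 t2 t3 t br' sP' C2 dPC cP C3 m1 C4 m3 C5 v1' (vis' _ _ n2 v2) v3' vw) => //; qlra.
Qed.

Lemma barrep_flip e S u z : symmetric e -> u \in S -> z \in S -> e u z ->
  barrep R e S u z -> barrep R e S z u.
Proof.
move=> es uS zS uz [y [l [r [x [[h1 h2 h3 h4 h5] [f1 f2 f3 f4]]]]]].
have [Euz _] := h3 _ _ uS zS uz.
exists (fun w => - y w), l, r, x; split; split=> //.
- by move=> a b aS bS /oppr_inj; apply: h1.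
- move=> a b aS bS ab w wS; rewrite !ltrN2 => /andP[k1 k2].
  by have [-> _] := h3 _ _ aS bS ab; rewrite es in ab; apply: h4; rewrite ?k1 ?k2.
- by move=> w wS wz; rewrite ltrN2; apply: f2.
- by move=> w wS wz; rewrite ltrN2; apply: f1.
- by move=> w wS wz wu; rewrite -Euz; apply: f3.
- by move=> a b aS bS ab ns; rewrite -Euz; apply: f4 => //; move: ns; rewrite /same_pair orbC.
Qed.
End Noncrossing.

(** * Gluing two representations along an edge *)

Section Glue.
Variables (R : realFieldType) (T : finType).
Implicit Types (e : rel T) (S B P Q : {set T}) (u v z a b s w n : T) (y l r : T -> R) (x : T -> T -> R).

(* The representation of [S2] is squeezed into a thin box lying immediately to
   the right of the edge cd and just above the bar of c. *)
Lemma glue_up e e1 e2 S1 S2 u z c d y1 l1 r1 x1 y2 l2 r2 x2 :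
  symmetric e -> symmetric e1 -> symmetric e2 ->
  u \in S1 -> z \in S1 -> u != z -> c \in S1 -> d \in S1 -> c \in S2 -> d \in S2 -> c != d ->
  (forall w, w \in S1 -> w \in S2 -> w = c \/ w = d) -> e1 c d ->
  {in S1 &, subrel e e1} -> {in S2 &, subrel e e2} ->
  (forall a b, e a b -> a \in S1 :|: S2 -> b \in S1 :|: S2 ->
     a \in S1 /\ b \in S1 \/ a \in S2 /\ b \in S2) ->
  bars e1 S1 y1 l1 r1 x1 -> leftmost e1 S1 y1 l1 x1 u z ->
  bars e2 S2 y2 l2 r2 x2 -> leftmost e2 S2 y2 l2 x2 c d ->
  y1 c < y1 d -> barrep R e (S1 :|: S2) u z.
Proof.
move=> es es1 es2 uS zS uz c1 d1 c2 d2 cd S12 ecd ee1 ee2 eS br1 lf1 br2 lf2 ycd.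
have [C1 [Cy Cl Cr Cx]] := seq_of_coords y1 l1 r1 x1.
have [g g0 gap] := seq_gap C1.
have [C2 [Dy Dl Dr Dx]] := seq_of_coords y2 l2 r2 x2.
have [M M0 HM] := seq_bound C2.
have [h11 h12 h13 h14 h15] := br1; have [h21 h22 h23 h24 h25] := br2.
have [f11 f12 f13 f14] := lf1; have [f21 f22 _ _] := lf2.
(* No coordinate of the first representation lies in ]x0, x0 + g]. All abscissae of the second are
   sent into ]x0 + dl, x0 + 3 dl[, clear of both ends. *)
pose x0 := x1 c d; pose dl := g / 4.
have dl0 : 0 < dl by rewrite divr_gt0.
have gE : g = 4 * dl by rewrite /dl; qlra.
pose phi (t : R) := x0 + 2 * dl + dl * (t / M).
have phi_lt p q : p < q -> phi p < phi q by move=> pq; rewrite /phi ltrD2l ltr_pM2l // ltr_pM2r // invr_gt0.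
have phi_box (t : R) : t \in C2 -> x0 + dl < phi t < x0 + 3 * dl.
  move/HM=> /andP[k1 k2]; rewrite /phi.
  have : -1 < t / M < 1 by rewrite ltr_pdivlMr // ltr_pdivrMr // mulN1r mul1r k1.
  case/andP=> k3 k4; have : dl * (-1) < dl * (t / M) by rewrite ltr_pM2l.
  have : dl * (t / M) < dl * 1 by rewrite ltr_pM2l.
  qlra.
(* Relative height in the second piece, 0 at [c] and 1 at [d]. Scaled by [g], the bars strictly
   between fit below the next bar above [c]. *)
pose hh w := (y2 w - y2 c) / (y2 d - y2 c).
have y2cd : y2 c < y2 d by apply: f21; rewrite // eq_sym.
have dy0 : 0 < y2 d - y2 c by rewrite subr_gt0.
pose ny w := if w \in S1 then y1 w else y1 c + g * hh w.
pose nl w := if w \in S1 then l1 w else phi (l2 w).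
pose nr w := if w \in S1 then r1 w else phi (r2 w).
pose nx a b := if (a \in S1) && (b \in S1) then x1 a b else phi (x2 a b).
have inS w : w \in S1 :|: S2 -> w \in S1 \/ w \notin S1 /\ w \in S2.
  by rewrite inE; case: (boolP (w \in S1)) => //= _; [left|right].
have D_ne w : w \notin S1 -> w != c /\ w != d by move=> wS; split; apply: contraNneq wS => ->.
have hh01 w : w \notin S1 -> w \in S2 -> 0 < hh w < 1.
  move=> wS w2; have [wc wd] := D_ne _ wS.
  rewrite /hh; apply/andP; split; first by rewrite divr_gt0 // subr_gt0 f21.
  by rewrite ltr_pdivrMr // mul1r; have := f22 _ w2 wd; qlra.
have nyD w : w \notin S1 -> w \in S2 -> y1 c < ny w < y1 c + g.
  move=> wS w2; rewrite /ny (negPf wS); have /andP[k1 k2] := hh01 _ wS w2.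
  have : 0 < g * hh w by rewrite mulr_gt0.
  have : g * hh w < g * 1 by rewrite ltr_pM2l.
  qlra.
have gapd : y1 c + g < y1 d by apply: gap.
have ny1 w : w \in S1 -> ny w = y1 w by rewrite /ny => ->.
have nx1 a b : a \in S1 -> b \in S1 -> nx a b = x1 a b by rewrite /nx => -> ->.
have nl1 w : w \in S1 -> nl w = l1 w by rewrite /nl => ->.
have nr1 w : w \in S1 -> nr w = r1 w by rewrite /nr => ->.
have nl2 w : w \notin S1 -> nl w = phi (l2 w) by rewrite /nl => /negPf ->.
have nr2 w : w \notin S1 -> nr w = phi (r2 w) by rewrite /nr => /negPf ->.
have hh_lt a b : y2 a < y2 b -> hh a < hh b.
  by move=> ab; rewrite /hh ltr_pM2r ?invr_gt0 //; qlra.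
have ny2 a b : a \in S2 -> b \in S2 -> ny a < ny b -> y2 a < y2 b.
  move=> a2 b2 lt; case: (ltgtP (y2 a) (y2 b)) => // [ba|E]; exfalso; last first.
    by rewrite (h21 _ _ a2 b2 E) ltxx in lt.
  have ab : a != b by apply: contraTneq lt => ->; rewrite ltxx.
  case: (boolP (b \in S1)) => b1.
    case: (S12 _ b1 b2) => Eb; subst b.
      rewrite [ny c]ny1 // in lt; case: (boolP (a \in S1)) => a1.
        case: (S12 _ a1 a2) => Ea; subst a; first by rewrite eqxx in ab.
        by rewrite ny1 // in lt; qlra.
      by have := nyD _ a1 a2; qlra.
    by have := f22 _ a2 ab; qlra.
  case: (boolP (a \in S1)) => a1.
    case: (S12 _ a1 a2) => Ea; subst a.
      by have := f21 _ b2; rewrite eq_sym => /(_ ab); qlra.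
    by rewrite [ny d]ny1 // in lt; have := nyD _ b1 b2; qlra.
  move: lt; rewrite /ny (negPf a1) (negPf b1) ltrD2l ltr_pM2l //.
  by have := hh_lt _ _ ba; qlra.
have eD a b : a \in S1 :|: S2 -> b \in S1 :|: S2 -> e a b -> ~~ ((a \in S1) && (b \in S1)) ->
    [/\ a \in S2, b \in S2 & nx a b = phi (x2 a b)].
  move=> aS bS ab nab; rewrite /nx (negPf nab).
  by case: (eS _ _ ab aS bS) nab => [[-> ->] //|[a2 b2] _]; split.
have x1box a b : x1 a b <= x0 \/ x0 + g < x1 a b.
  by case: (leP (x1 a b) x0) => k; [left|right; apply: (gap _ _ (Cx c d) (Cx a b) k)].
have cdin w : w \in S2 -> w \in S1 -> l1 w + g < x0 /\ x0 + g < r1 w.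
  have [E /andP[k1 k2]] := h13 _ _ c1 d1 ecd.
  have ec : e1 d c by rewrite es1.
  have [_ /andP[k3 k4]] := h13 _ _ d1 c1 ec; rewrite -E in k3 k4.
  move=> w2 w1; case: (S12 _ w1 w2) => ->.
    by split; [exact: gap (Cl c) (Cx c d) k1|exact: gap (Cx c d) (Cr c) k2].
  by split; [exact: gap (Cl d) (Cx c d) k3|exact: gap (Cx c d) (Cr d) k4].
have edgeD a b : a \in S2 -> b \in S2 -> e a b -> x2 a b = x2 b a /\ nl a < phi (x2 a b) < nr a.
  move=> a2 b2 /(ee2 _ _ a2 b2) ab; have [E /andP[k1 k2]] := h23 _ _ a2 b2 ab; split=> //.
  case: (boolP (a \in S1)) => a1; last by rewrite nl2 // nr2 // !phi_lt.
  rewrite nl1 // nr1 //; have := cdin _ a2 a1; have := phi_box _ (Dx a b); qlra.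
have xuz0 : x1 u z <= x0.
  case: (boolP (same_pair u z c d)) => [|ns]; last by apply: ltW; apply: f14.
  rewrite /same_pair /x0 => /orP[] /andP[/eqP Ec /eqP Ed]; first by rewrite Ec Ed.
  by have [-> _] := h13 _ _ c1 d1 ecd; rewrite Ec Ed.
exists ny, nl, nr, nx; split; split.
- move=> a b /inS[a1|[a1 a2]] /inS[b1|[b1 b2]].
  + by rewrite !ny1 //; apply: h11.
  + rewrite ny1 // => E; exfalso; have /andP[k1 k2] := nyD _ b1 b2.
    by rewrite -E in k1 k2; have := gap _ _ (Cy c) (Cy a) k1; qlra.
  + rewrite [ny b]ny1 // => E; exfalso; have /andP[k1 k2] := nyD _ a1 a2.
    by rewrite E in k1 k2; have := gap _ _ (Cy c) (Cy b) k1; qlra.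
  + move=> E; apply: h21 => //; case: (ltgtP (y2 a) (y2 b)) => // k; exfalso; have := hh_lt _ _ k;
      move: E; rewrite /ny (negPf a1) (negPf b1) => /addrI; rewrite -(ltr_pM2l g0); qlra.
- move=> w /inS[w1|[w1 w2]]; first by rewrite nl1 // nr1 //; apply: h12.
  by rewrite nl2 // nr2 //; apply: phi_lt; apply: h22.
- move=> a b aS bS ab; case: (boolP ((a \in S1) && (b \in S1))) => [/andP[a1 b1]|nab].
    by rewrite !nx1 // nl1 // nr1 //; apply: h13 => //; apply: ee1.
  have [a2 b2 ->] := eD _ _ aS bS ab nab.
  have [E k] := edgeD _ _ a2 b2 ab; split=> //.
  by rewrite /nx [(b \in S1) && _]andbC (negPf nab) E.
- move=> a b aS bS ab w wS /andP[lo up]; case: (boolP ((a \in S1) && (b \in S1))) => [/andP[a1 b1]|nab].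
    rewrite nx1 //; case: (inS _ wS) => [w1|[w1 w2]].
      rewrite nl1 // nr1 //; apply: (h14 _ _ a1 b1) => //; first exact: ee1.
      by move: lo up; rewrite !ny1 // => -> ->.
    rewrite nl2 // nr2 //; have := phi_box _ (Dl w); have := phi_box _ (Dr w).
    by case: (x1box a b) => k k1 k2; [left|right]; qlra.
  have [a2 b2 ->] := eD _ _ aS bS ab nab.
  case: (inS _ wS) => [w1|[w1 w2]]; last first.
    rewrite nl2 // nr2 //; have := h24 _ _ a2 b2 (ee2 _ _ a2 b2 ab) _ w2.
    by rewrite !ny2 // => /(_ isT) [k|k]; [left|right]; apply: phi_lt.
  have loc : y1 c <= ny a.
    case: (boolP (a \in S1)) => a1; last by have := nyD _ a1 a2; qlra.
    by rewrite ny1 //; case: (S12 _ a1 a2) => ->; qlra.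
  have cw : y1 c < y1 w by rewrite -(ny1 w) //; qlra.
  have cw' := gap _ _ (Cy c) (Cy w) cw.
  rewrite [ny w]ny1 // in lo up.
  case: (boolP (b \in S1)) => b1; last by have := nyD _ b1 b2; qlra.
  rewrite [ny b]ny1 // in up.
  case: (S12 _ b1 b2) => Eb; rewrite Eb in up; first qlra.
  rewrite nl1 // nr1 //; have := phi_box _ (Dx a b).
  have := h14 _ _ c1 d1 ecd _ w1; rewrite cw up => /(_ isT) [k|k] k'.
    by left; have := gap _ _ (Cx c d) (Cl w) k; rewrite -/x0; qlra.
  by right; rewrite -/x0 in k; qlra.
- move=> a b aS bS a' b' aS' bS' ab ab'.
  case: (boolP ((a \in S1) && (b \in S1))) => [/andP[a1 b1]|nab];
  case: (boolP ((a' \in S1) && (b' \in S1))) => [/andP[a1' b1']|nab'].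
  + by rewrite !nx1 //; apply: h15; rewrite // ?ee1.
  + have [a2 b2 ->] := eD _ _ aS' bS' ab' nab'; rewrite nx1 // => E; exfalso.
    by have := phi_box _ (Dx a' b'); case: (x1box a b); rewrite E; qlra.
  + have [a2 b2 ->] := eD _ _ aS bS ab nab; rewrite nx1 // => E; exfalso.
    by have := phi_box _ (Dx a b); case: (x1box a' b'); rewrite E; qlra.
  + have [a2 b2 ->] := eD _ _ aS bS ab nab.
    have [a2' b2' ->] := eD _ _ aS' bS' ab' nab' => E.
    apply: h25; rewrite ?ee2 //; case: (ltgtP (x2 a b) (x2 a' b')) => // /phi_lt; rewrite E ltxx //.
- move=> w /inS[w1|[w1 w2]] wu; rewrite [ny u]ny1 //; first by rewrite ny1 //; apply: f11.
  have : y1 u <= y1 c by case: (eqVneq c u) => [->//|/(f11 _ c1)/ltW].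
  by have := nyD _ w1 w2; qlra.
- move=> w /inS[w1|[w1 w2]] wu; rewrite [ny z]ny1 //; first by rewrite ny1 //; apply: f12.
  have : y1 d <= y1 z by case: (eqVneq d z) => [->//|/(f12 _ d1)/ltW].
  by have := nyD _ w1 w2; qlra.
- move=> w /inS[w1|[w1 w2]] wu wz; rewrite [nx u z]nx1 //; first by rewrite nl1 //; apply: f13.
  by rewrite nl2 //; have := phi_box _ (Dl w); qlra.
- move=> a b aS bS ab ns; rewrite [nx u z]nx1 //.
  case: (boolP ((a \in S1) && (b \in S1))) => [/andP[a1 b1]|nab].
    by rewrite nx1 //; apply: f14; rewrite // ee1.
  by have [a2 b2 ->] := eD _ _ aS bS ab nab; have := phi_box _ (Dx a b); qlra.
Qed.

(** If [d] is below [c] in the first representation, the second is turned upside down, which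
    exchanges the ends of its leftmost edge. *)
Lemma glue e e1 e2 S1 S2 u z c d :
  symmetric e -> symmetric e1 -> symmetric e2 ->
  u \in S1 -> z \in S1 -> u != z -> c \in S1 -> d \in S1 -> c \in S2 -> d \in S2 -> c != d ->
  (forall w, w \in S1 -> w \in S2 -> w = c \/ w = d) -> e1 c d -> e2 c d ->
  {in S1 &, subrel e e1} -> {in S2 &, subrel e e2} ->
  (forall a b, e a b -> a \in S1 :|: S2 -> b \in S1 :|: S2 ->
     a \in S1 /\ b \in S1 \/ a \in S2 /\ b \in S2) ->
  barrep R e1 S1 u z -> barrep R e2 S2 c d -> barrep R e (S1 :|: S2) u z.
Proof.
move=> es es1 es2 uS zS uz c1 d1 c2 d2 cd S12 ecd ecd2 ee1 ee2 eS.
case=> [y1 [l1 [r1 [x1 [br1 lf1]]]]] rep2.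
have [h1 _ _ _ _] := br1.
case: (ltgtP (y1 c) (y1 d)) => [lt|lt|E].
- have [y2 [l2 [r2 [x2 [br2 lf2]]]]] := rep2.
  by apply: (@glue_up e e1 e2 S1 S2 u z c d y1 l1 r1 x1 y2 l2 r2 x2).
- have [y2 [l2 [r2 [x2 [br2 lf2]]]]] := barrep_flip es2 c2 d2 ecd2 rep2.
  apply: (@glue_up e e1 e2 S1 S2 u z d c y1 l1 r1 x1 y2 l2 r2 x2) => //.
  + by rewrite eq_sym.
  + by move=> w w1 w2; case: (S12 w w1 w2); auto.
  + by rewrite es1.
- by move: cd; rewrite (h1 _ _ c1 d1 E) eqxx.
Qed.
End Glue.

(** * Rooted triangles and four-cycles completed to $K_5$ and $K_{3,3}$ *)

Section KfreeFacts.
Variables (T : finType).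
Implicit Types (e : rel T) (S B D : {set T}).

Lemma Kfree_sub e e' S S' : S \subset S' -> {in S &, subrel e e'} ->
  Kfree e' S' -> Kfree e S.
Proof. by move=> sS ee; apply: Kfree_minor (model_id sS ee). Qed.

Lemma model_card (K : finType) (k : rel K) e S : has_model k e S -> (#|K| <= #|S|)%N.
Proof.
case=> phi [p1 p2 _ p4 _].
have /choice[f Hf] : forall i, exists x, x \in phi i.
  by move=> i; apply/set0Pn; apply: p2; rewrite inE.
have fi : injective f.
  move=> i j E; apply/eqP/negPn/negP=> ij.
  have := p4 i j; rewrite !inE => /(_ isT isT ij) d.
  by have := disjointFr d (Hf i); rewrite E Hf.
rewrite -cardsT -(card_imset _ fi); apply: subset_leq_card.
by apply/subsetP=> x /imsetP[i _ ->]; apply: (subsetP (p1 i _)); rewrite ?inE.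
Qed.

Lemma Kfree_small e S : (#|S| <= 4)%N -> Kfree e S.
Proof.
move=> S4; split=> /model_card; first by rewrite card_ord; lia.
by rewrite card_sum !card_ord; lia.
Qed.

Lemma has_model_triangle e S B x1 x2 x3 f p q : symmetric e ->
  model [rel a b | a != b] [set x1; x2; x3] e B f ->
  {in [set x1; x2; x3], forall t, t \in f t} -> uniq [:: x1; x2; x3] ->
  B \subset S -> p \in S -> q \in S -> p \notin B -> q \notin B -> p != q ->
  e p q -> {in [set x1; x2; x3], forall w, e p w && e q w} ->
  has_model (@complete_rel 5) e S.
Proof.
move=> es [f1 f2 f3 f4 f5] tf un sB pS qS pB qB pq epq epw.
pose A := [:: f x1; f x2; f x3; [set p]; [set q]].
have [m1 m2 m3] : [/\ x1 \in [set x1; x2; x3], x2 \in [set x1; x2; x3] & x3 \in [set x1; x2; x3]].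
  by rewrite !inE !eqxx !orbT.
move: un; rewrite /= !inE !negb_or !andbT => /andP[/andP[n12 n13] n23].
have dB n t : n \notin B -> t \in [set x1; x2; x3] -> [disjoint f t & [set n]].
  move=> nB tT; rewrite disjoint_sym disjoints1; apply: contra nB => nf.
  exact: (subsetP (f1 _ tT)).
have ex n t : n \in [set p; q] -> t \in [set x1; x2; x3] ->
    exists x y, [/\ x \in f t, y \in [set n] & e x y].
  move=> nn tT; exists t, n; split; [exact: tf|by rewrite inE|].
  by rewrite es; have /andP[] := epw _ tT; move: nn; rewrite !inE => /orP[] /eqP ->.
have [mp mq] : p \in [set p; q] /\ q \in [set p; q] by rewrite !inE !eqxx orbT.
have sym (C D : {set T}) : (exists x y, [/\ x \in C, y \in D & e x y]) ->
   (exists x y, [/\ x \in D, y \in C & e x y]).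
  by case=> a [b [? ? ?]]; exists b, a; rewrite es.
exists (fun i : 'I_5 => nth set0 A i); split.
- case=> -[|[|[|[|[|?]]]]] //= ? _; rewrite ?sub1set //; apply: subset_trans (f1 _ _) sB => //.
- case=> -[|[|[|[|[|?]]]]] //= ? _; rewrite ?f2 //; apply/set0Pn; eexists; rewrite inE; exact: eqxx.
- case=> -[|[|[|[|[|?]]]]] //= ? _; try (exact: f3); exact: (@conn1 _ e).
- case=> -[|[|[|[|[|?]]]]] //= ? [[|[|[|[|[|?]]]]] //= ?] _ _ _;
    rewrite ?f4 ?dB // 1?eq_sym // 1?disjoint_sym ?dB //.
  + by rewrite disjoints1 inE eq_sym.
  + by rewrite disjoints1 inE.
- case=> -[|[|[|[|[|?]]]]] //= ? [[|[|[|[|[|?]]]]] //= ?] _ _ _;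
   try (by apply: f5; rewrite //= eq_sym); try (by apply: ex); try (by apply: sym; apply: ex).
  + by exists p, q; rewrite !inE.
  + by apply: sym; exists p, q; rewrite !inE.
Qed.

(** The classes are [x1], [x2], [p] and [y1], [y2], [q]: the cycle joins the x to the y, and the
    edge pq completes the model. *)
Lemma has_model_four_cycle e S B x1 x2 y1 y2 f p q : symmetric e ->
  model [rel a b | (a \in [set x1; x2]) != (b \in [set x1; x2])]
    [set x1; x2; y1; y2] e B f ->
  {in [set x1; x2; y1; y2], forall t, t \in f t} -> uniq [:: x1; x2; y1; y2] ->
  B \subset S -> p \in S -> q \in S -> p \notin B -> q \notin B -> p != q ->
  e p q -> e p y1 -> e p y2 -> e q x1 -> e q x2 ->
  has_model (@bipartite_rel 3 3) e S.
Proof.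
move=> es [f1 f2 f3 f4 f5] tf un sB pS qS pB qB pq epq py1 py2 qx1 qx2.
have [m1 m2 m3 m4] : [/\ x1 \in [set x1; x2; y1; y2], x2 \in [set x1; x2; y1; y2],
    y1 \in [set x1; x2; y1; y2] & y2 \in [set x1; x2; y1; y2]] by rewrite !inE !eqxx !orbT.
move: un; rewrite /= !inE !negb_or !andbT.
case/and3P=> /and3P[n12 n13 n14] /andP[n23 n24] n34.
pose A1 := [:: f x1; f x2; [set p]]; pose A2 := [:: f y1; f y2; [set q]].
have dB n t : n \notin B -> t \in [set x1; x2; y1; y2] -> [disjoint f t & [set n]].
  move=> nB tT; rewrite disjoint_sym disjoints1; apply: contra nB => nf.
  exact: (subsetP (f1 _ tT)).
have sym (C D : {set T}) : (exists x y, [/\ x \in C, y \in D & e x y]) ->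
   (exists x y, [/\ x \in D, y \in C & e x y]).
  by case=> a [b [? ? ?]]; exists b, a; rewrite es.
have exy a b : a \in [set x1; x2; y1; y2] -> b \in [set x1; x2; y1; y2] ->
   (a \in [set x1; x2]) != (b \in [set x1; x2]) -> exists x y, [/\ x \in f a, y \in f b & e x y].
  by move=> *; apply: f5.
have xyne : [/\ y1 \notin [set x1; x2], y2 \notin [set x1; x2], x1 \in [set x1; x2] & x2 \in [set x1; x2]].
  by rewrite !inE !eqxx ![_ == x1]eq_sym ![_ == x2]eq_sym (negPf n13) (negPf n14) (negPf n23) (negPf n24) orbT.
have [ny1 ny2 nx1 nx2] := xyne.
have ex n t : e n t -> t \in [set x1; x2; y1; y2] -> exists x y, [/\ x \in [set n], y \in f t & e x y].
  by move=> nt tT; exists n, t; split; [rewrite inE|exact: tf|].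
have adj i j : exists x y, [/\ x \in nth set0 A1 (i : 'I_3), y \in nth set0 A2 (j : 'I_3) & e x y].
  case: i => -[|[|[|?]]] //= ?; case: j => -[|[|[|?]]] //= ?.
  + by apply: exy; rewrite // nx1 (negPf ny1).
  + by apply: exy; rewrite // nx1 (negPf ny2).
  + by apply: sym; apply: ex.
  + by apply: exy; rewrite // nx2 (negPf ny1).
  + by apply: exy; rewrite // nx2 (negPf ny2).
  + by apply: sym; apply: ex.
  + exact: ex.
  + exact: ex.
  + by exists p, q; rewrite !inE.
exists (fun i : 'I_3 + 'I_3 => match i with inl i => nth set0 A1 i | inr i => nth set0 A2 i end); split.
- case=> -[[|[|[|?]]] //= ?] _; rewrite ?sub1set //; apply: subset_trans (f1 _ _) sB => //.
- case=> -[[|[|[|?]]] //= ?] _; rewrite ?f2 //; apply/set0Pn; eexists; rewrite inE; exact: eqxx.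
- case=> -[[|[|[|?]]] //= ?] _; try (exact: f3); exact: (@conn1 _ e).
- case=> -[[|[|[|?]]] //= ?] [] [[|[|[|?]]] //= ?] _ _ _;
    rewrite ?f4 ?dB // 1?eq_sym // 1?disjoint_sym ?dB // ?f4 // 1?eq_sym //.
  + by rewrite disjoints1 inE eq_sym.
  + by rewrite disjoints1 inE.
- by case=> i [] j _ _; rewrite /bipartite_rel /= // => _; apply: sym; apply: adj.
Qed.

End KfreeFacts.

(** * Representations of degenerate graphs *)

Section Special.
Variables (R : realFieldType) (T : finType).
Implicit Types (e : rel T) (S B D : {set T}) (u v z a b w : T) (y l r : T -> R) (x : T -> T -> R).

Lemma bars_flip e S y l r x : symmetric e -> bars e S y l r x ->
  bars e S (fun w => - y w) l r x.
Proof.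
move=> es [h1 h2 h3 h4 h5]; split=> //.
- by move=> a b aS bS /oppr_inj; apply: h1.
- move=> a b aS bS ab w wS; rewrite !ltrN2 => /andP[k1 k2].
  by have [-> _] := h3 _ _ aS bS ab; rewrite es in ab; apply: h4; rewrite ?k1 ?k2.
Qed.

Lemma barrep_edge e u z : irreflexive e -> u != z -> barrep R e [set u; z] u z.
Proof.
move=> ei uz; exists (fun w => if w == z then 1 else 0), (fun=> 0), (fun=> 1), (fun _ _ => 1 / 2).
have c w : w \in [set u; z] -> w = u \/ w = z by rewrite !inE => /orP[] /eqP; auto.
have same a b : a \in [set u; z] -> b \in [set u; z] -> e a b -> (a = u /\ b = z) \/ (a = z /\ b = u).
  by move=> /c[->|->] /c[->|->]; rewrite ?ei; auto.
split; split.
- by move=> a b /c[->|->] /c[->|->] //; rewrite eqxx (negPf uz) => E; exfalso; lra.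
- by move=> w _; lra.
- by move=> a b _ _ _; split=> //; lra.
- by move=> a b _ _ _ w /c[->|->]; do ?case: eqP => _; lra.
- move=> a b aS bS a' b' aS' bS' ab ab' _; case: (same a b) => // -[-> ->];
  by case: (same a' b') => // -[-> ->]; rewrite /same_pair !eqxx ?orbT.
- by move=> w /c[->|->] wu; rewrite ?eqxx ?(negPf uz) // in wu *; lra.
- by move=> w /c[->|->] wu; rewrite ?eqxx ?(negPf uz) // in wu *; lra.
- by move=> w /c[->|->] wu wz; rewrite ?eqxx // in wu wz *.
- by move=> a b aS bS ab; case: (same a b) => // -[-> ->]; rewrite /same_pair !eqxx ?orbT.
Qed.

(** The possible edge of [z] is drawn left of everything, down to the bar of [u], which is
    lengthened for it. *)
Lemma barrep_pendant_top e B u z y l r x : symmetric e -> irreflexive e ->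
  bars e B y l r x -> z \notin B -> u \in B ->
  {in B, forall w, w != u -> y u < y w} ->
  {in B, forall w, e z w -> w = u} -> barrep R e (z |: B) u z.
Proof.
move=> es ei br zB uB low zu.
have [C [Cy Cl Cr Cx]] := seq_of_coords y l r x.
have [M M0 HM] := seq_bound C.
pose l' w := if w == u then - M - 10 else l w.
have br' : bars e B y l' r x.
  apply: (widen_low br uB low) => //.
  - by rewrite /l' eqxx; have := HM _ (Cl u); qlra.
  - by move=> w wu; rewrite /l' (negPf wu).
have Bz w : w \in B -> (w == z) = false by move=> wB; apply: contraNF zB => /eqP <-.
have br2 := @add_top _ _ e B y l' r x z M (- M - 2) M (fun=> - M - 1) es ei br' zB
  (fun w _ => proj2 (andP (HM _ (Cy w)))).
do 4!eexists; split; first apply: br2.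
- by qlra.
- move=> s sB zs; rewrite (zu _ sB zs); split; first by qlra.
  split; first by rewrite /l' eqxx; have := HM _ (Cr u); qlra.
  move=> w wB lt; left; have wu : w != u by apply: contraTneq lt => ->; rewrite ltxx.
  by rewrite /l' (negPf wu); have := HM _ (Cl w); qlra.
- by move=> s s' sB sB' /(zu _ sB) -> /(zu _ sB') ->.
- by move=> s sB zs a b aB bB ab; apply/eqP=> E; have := HM _ (Cx a b); rewrite -E; qlra.
have c w : w \in z |: B -> w = z \/ w \in B by rewrite !inE => /orP[/eqP|]; auto.
split.
- move=> w /c[->|wB] wu; rewrite ?eqxx (Bz u) //; first by have := HM _ (Cy u); qlra.
  by rewrite (Bz w) //; apply: low.
- move=> w /c[->|wB] wz; rewrite ?eqxx // in wz *.
  by rewrite (Bz w) //; have := HM _ (Cy w); qlra.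
- move=> w /c[->|wB] wu wz; rewrite ?eqxx // in wz *.
  by rewrite (Bz u) // (Bz w) // /l' (negPf wu); have := HM _ (Cl w); qlra.
- have uz := Bz _ uB.
  move=> a b /c[->|aB] /c[->|bB] ab; rewrite ?ei // in ab *; rewrite /same_pair ?eqxx ?uz ?(Bz a) ?(Bz b) //=.
  + by rewrite (zu _ bB ab) eqxx orbT.
  + by rewrite es in ab; rewrite (zu _ aB ab) eqxx.
  + by move=> _; have := HM _ (Cx a b); qlra.
Qed.

Lemma bars_edgeless e D : {in D &, forall a b, ~~ e a b} ->
  exists y l r x, bars (R := R) e D y l r x.
Proof.
move=> H; exists (fun w => (enum_rank w)%:R), (fun=> 0), (fun=> 1), (fun _ _ => 0); split.
- move=> a b _ _ /eqP; rewrite eqr_nat => /eqP E; apply: enum_rank_inj; exact: val_inj.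
- by move=> w _; lra.
- by move=> a b aD bD ab; have := H _ _ aD bD; rewrite ab.
- by move=> a b aD bD ab; have := H _ _ aD bD; rewrite ab.
- by move=> a b aD bD a' b' _ _ ab; have := H _ _ aD bD; rewrite ab.
Qed.

(** If [u] has a neighbour besides [z], the graph without [z] is represented with [u] as the lower
    end of such an edge. Otherwise [u] is isolated once [z] is gone and can be put below any
    representation of the rest. *)
Lemma barrep_pendant e S u z : symmetric e -> irreflexive e -> Kfree e S ->
  (forall S' a b, S' \proper S -> Kfree e S' -> a \in S' -> b \in S' -> e a b -> barrep R e S' a b) ->
  u \in S -> z \in S -> e u z -> {in S, forall w, e z w -> w = u} -> barrep R e S u z.
Proof.
move=> es ei kf IH uS zS uz zu.
have unz : u != z by apply: contraTneq uz => ->; rewrite ei.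
rewrite -(setD1K zS).
have zN : z \notin S :\ z by rewrite !inE eqxx.
have uB : u \in S :\ z by rewrite !inE unz.
have sz (A : {set T}) : A \subset S -> Kfree e A by move=> sA; apply: Kfree_sub kf.
have zu' : {in S :\ z, forall w, e z w -> w = u} by move=> w; rewrite !inE => /andP[_]; apply: zu.
case: (pickP [pred b | (b \in S :\ z) && e u b]) => [b /andP[bB ub]|none].
  have pr : S :\ z \proper S by rewrite properD1.
  have [y [l [r [x [br [lf _ _ _]]]]]] := IH _ _ _ pr (sz _ (proper_sub pr)) uB bB ub.
  exact: (barrep_pendant_top es ei br zN uB lf zu').
have D_proper : S :\ z :\ u \proper S.
  by apply: sub_proper_trans (subD1set _ _) (properD1 zS).
have [y [l [r [x br]]]] : exists y l r x, bars (R := R) e (S :\ z :\ u) y l r x.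
  case: (boolP [exists a in S :\ z :\ u, exists b in S :\ z :\ u, e a b]).
    case/exists_inP=> a aD /exists_inP[b bD ab].
    have [y [l [r [x [br _]]]]] := IH _ _ _ D_proper (sz _ (proper_sub D_proper)) aD bD ab.
    by exists y, l, r, x.
  move=> no; apply: bars_edgeless => a b aD bD; apply: contra no => ab.
  by apply/exists_inP; exists a => //; apply/exists_inP; exists b.
have uD : u \notin S :\ z :\ u by rewrite !inE eqxx.
have [C [Cy Cl Cr Cx]] := seq_of_coords (fun w => - y w) l r x.
have [M M0 HM] := seq_bound C.
(* A new lowest bar is a new highest one in the mirror image. *)
have br2 := @add_top _ _ e (S :\ z :\ u) _ l r x u M 0 1 (fun=> 0) es ei (bars_flip es br) uD
  (fun w _ => proj2 (andP (HM _ (Cy w)))).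
have nou : {in S :\ z :\ u, forall s, ~~ e u s}.
  by move=> s; rewrite in_setD1 => /andP[_ sB]; have := none s; rewrite /= sB => /= ->.
have v1 : {in S :\ z :\ u, forall s, e u s -> 0 < (0 : R) < 1 /\
    visible (S :\ z :\ u) (fun w => - y w) l r s 0}.
  by move=> s sB us; have := nou _ sB; rewrite us.
have v2 : {in S :\ z :\ u &, forall s s', e u s -> e u s' -> 0 = 0 :> R -> s = s'}.
  by move=> s s' sB _ us; have := nou _ sB; rewrite us.
have v3 : {in S :\ z :\ u, forall s, e u s ->
    {in S :\ z :\ u &, forall a b, e a b -> 0 != x a b}}.
  by move=> s sB us; have := nou _ sB; rewrite us.
have br3 := bars_flip es (br2 ltr01 v1 v2 v3); rewrite (setD1K uB) in br3.
apply: (barrep_pendant_top es ei br3 zN uB _ zu') => w wB wu /=.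
by rewrite eqxx (negPf wu) ltrN2; have := HM _ (Cy w) => /andP[].
Qed.

End Special.

Local Close Scope ring_scope.

(** * Induction steps for small and for 3-connected graphs *)

Section Induction.
Variables (R : realFieldType) (T : finType).
Implicit Types (e : rel T) (S B D : {set T}) (u v z a b w : T).

(** The relation varies as well, because the induction passes to contracted graphs and to graphs
    with an additional edge. *)
Definition representable_below S := forall S' e' a b, #|S'| < #|S| ->
  symmetric e' -> irreflexive e' -> Kfree e' S' ->
  a \in S' -> b \in S' -> e' a b -> barrep R e' S' a b.

(** [contracted] has a loop at [a] when [a] and [n] are adjacent; the induction is over irreflexive
    relations. *)
Definition contraction e a n : rel T := [rel x y | (x != y) && contracted e a n x y].

Lemma contraction_sym e a n : symmetric e -> symmetric (contraction e a n).
Proof. by move=> es x y; rewrite /contraction /= eq_sym (contracted_sym a n es). Qed.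

Lemma contraction_irr e a n : irreflexive (contraction e a n).
Proof. by move=> x; rewrite /contraction /= eqxx. Qed.

Lemma Kfree_contraction e S a n : symmetric e -> Kfree e S -> a \in S -> n \in S ->
  a != n -> e a n -> Kfree (contraction e a n) (S :\ n).
Proof.
move=> es kf aS nS an ean.
have kf1 := Kfree_minor (model_contracted es aS nS an ean) kf.
by apply: Kfree_sub kf1 => // x y _ _ /andP[].
Qed.

Lemma setD2K (S : {set T}) v z : v \in S -> z \in S -> v != z ->
  z |: (v |: (S :\ z :\ v)) = S /\ z |: (S :\ z :\ v) = S :\ v.
Proof.
move=> vS zS vz; split.
  by rewrite setD1K ?setD1K // !inE vz.
by apply/setP=> w; rewrite !inE; case: (eqVneq w z) => [->|_] //=; rewrite zS eq_sym vz.
Qed.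

(** Some vertex [v] is deleted and the rest made complete, which creates no forbidden model on so
    few vertices. At most two vertices other than [z] remain, too few for an obstruction to
    inserting [v]. *)
Lemma barrep_small e S u z : symmetric e -> irreflexive e -> #|S| <= 4 ->
  representable_below S -> u \in S -> z \in S -> e u z -> barrep R e S u z.
Proof.
move=> es ei S4 IH uS zS uz.
have unz : u != z by apply: contraTneq uz => ->; rewrite ei.
have sS : [set u; z] \subset S by rewrite subUset !sub1set uS.
case: (eqVneq [set u; z] S) => [<-|ne]; first exact: barrep_edge.
have [v vS vN] : exists2 v, v \in S & v \notin [set u; z].
  by apply/subsetPn; apply: contra ne => sb; rewrite eqEsubset sS.
move: vN; rewrite !inE negb_or => /andP[vu vz].
have [E1 E2] := setD2K vS zS vz.
set B := S :\ z :\ v in E1 E2.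
have mB w : (w \in B) = [&& w != v, w != z & w \in S] by rewrite !inE.
have B2 : #|B| <= 2.
  by move: S4; rewrite (cardsD1 z S) zS (cardsD1 v (S :\ z)) in_setD1 vz vS -/B; lia.
pose e' : rel T := [rel a b | a != b].
have es' : symmetric e' by move=> a b; rewrite /e' /= eq_sym.
have ei' : irreflexive e' by move=> a; rewrite /e' /= eqxx.
have uB : u \in B by rewrite mB unz uS eq_sym vu.
have cS : #|S :\ v| < #|S| by rewrite [X in _ < X](cardsD1 v) vS.
have := IH (S :\ v) e' u z cS es' ei' _ _ _ unz.
case=> [|||y [l [r [x [br lf]]]]].
- by apply: Kfree_small; apply: leq_trans S4; apply: ltnW.
- by rewrite !inE eq_sym vu.
- by rewrite !inE eq_sym vz.
rewrite -E1; rewrite -E2 in br lf.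
have no3 a b c : uniq [:: a; b; c] -> a \in B -> b \in B -> c \in B -> False.
  move=> un aB bB cB; have : #|[set w in [:: a; b; c]]| <= #|B|.
    by apply: subset_leq_card; apply/subsetP=> w; rewrite in_set !in_cons in_nil orbF => /or3P[] /eqP ->.
  by rewrite cardsE (card_uniqP un) => /leq_trans/(_ B2).
apply: (insert_under_top es ei es' ei' _ _ vz uB _ br lf).
- by rewrite mB eqxx.
- by rewrite mB eqxx andbF.
- by rewrite es.
- by move=> a b _ _ ab; rewrite /e' /=; apply: contraTneq ab => ->; rewrite ei.
- by move=> w; rewrite mB => /and3P[_ wz _] _; rewrite /e' /= eq_sym.
- move=> a b c d aB bB cB dB l1 l2 _ _; apply: (no3 a b c) => //.
  rewrite /= !inE negb_or !andbT; apply/andP; split; [apply/andP; split|];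
    apply: contraTneq isT => E; move: l1 l2; rewrite E ?ltxx //.
  by move=> h1 h2; have := lt_trans h1 h2; rewrite ltxx.
- by move=> a b c aB bB cB un _; apply: (no3 a b c).
Qed.

(** If the neighbours of [v] and [z] alternate, [noncrossing] excludes two disjoint links, so there
    is a rooted four-cycle and with the edge zv a $K_{3,3}$. Three common neighbours give a rooted
    triangle and a $K_5$. *)
Lemma barrep_removable e S u v z : symmetric e -> irreflexive e -> Kfree e S ->
  representable_below S -> u \in S -> z \in S -> e u z ->
  v \in S -> v != z -> v != u -> e z v -> kconn e 2 (S :\ z :\ v) -> barrep R e S u z.
Proof.
move=> es ei kf IH uS zS uz vS vz vu ezv cB.
have unz : u != z by apply: contraTneq uz => ->; rewrite ei.
have [E1 E2] := setD2K vS zS vz.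
set B := S :\ z :\ v in E1 E2 cB.
have mB w : (w \in B) = [&& w != v, w != z & w \in S] by rewrite !inE.
have sBS : B \subset S by apply/subsetP=> w; rewrite mB => /and3P[].
have vB : v \notin B by rewrite mB eqxx.
have zB : z \notin B by rewrite mB eqxx andbF.
have uB : u \in B by rewrite mB unz uS eq_sym vu.
have zv : z != v by rewrite eq_sym.
have cS : #|S :\ v| < #|S| by rewrite [X in _ < X](cardsD1 v) vS.
pose e' := contraction e z v.
have es' : symmetric e' by apply: contraction_sym.
have ei' : irreflexive e' := contraction_irr e z v.
have kf' : Kfree e' (S :\ v) by apply: Kfree_contraction.
have := IH (S :\ v) e' u z cS es' ei' kf' _ _ _.
case=> [|||y [l [r [x [br lf]]]]].
- by rewrite !inE eq_sym vu.
- by rewrite !inE eq_sym vz.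
- by rewrite /e' /contraction /contracted /= unz uz.
rewrite -E1; rewrite -E2 in br lf.
have ee : {in B &, subrel e e'}.
  move=> a b _ _ ab; rewrite /e' /contraction /contracted /= ab andbT.
  by apply: contraTneq ab => ->; rewrite ei.
have enb : {in B, forall s, e v s || e z s -> e' z s}.
  move=> s sB h; rewrite /e' /contraction /contracted /= eqxx.
  have -> : z != s by apply: contraNneq zB => ->.
  by case/orP: h => ->; rewrite ?orbT.
have top : {in B, forall w, (y w < y z)%R}.
  case: lf => _ hi _ _ w wB; apply: hi; first by rewrite inE wB orbT.
  by apply: contraNneq zB => <-.
have vis s : s \in B -> e' z s -> visible B y l r s (x z s) by apply: (top_visible es' br top).
have brB : bars e B y l r x by apply: (bars_sub _ _ br) => [|a b aB bB]; [exact: subsetUr|exact: ee].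
have neq a b : (x z a < x z b)%R -> a != b by apply: contraTneq => ->; rewrite ltxx.
have four a b c d p q : a \in B -> b \in B -> c \in B -> d \in B ->
    (x z a < x z b)%R -> (x z b < x z c)%R -> (x z c < x z d)%R ->
    e q a -> e p b -> e q c -> e p d -> p \in S -> q \in S -> p \notin B -> q \notin B ->
    p != q -> e p q -> e' z a -> e' z b -> e' z c -> e' z d -> False.
  move=> aB bB cB' dB l1 l2 l3 qa pb qc pd pS qS pB qB pq epq za zb zc zd.
  have un : uniq [:: a; c; b; d].
    rewrite /= !inE !negb_or !andbT (neq a b) // (neq c d) //.
    rewrite (neq a c) ?(neq a d) ?(neq b d) // 1?eq_sym ?(neq b c) //;
     by [exact: lt_trans l2 l3|exact: lt_trans l1 (lt_trans l2 l3)|exact: lt_trans l1 l2].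
  have [|f [mf tf]] := rooted_four_cycle es cB aB cB' bB dB un.
    move=> P Q sP sQ dPQ cP cQ aP cP' bQ dQ.
    exact: (noncrossing es brB sP sQ dPQ cP cQ aP bQ cP' dQ (vis _ aB za) (vis _ bB zb) (vis _ cB' zc) (vis _ dB zd)).
  case: kf => _; apply.
  exact: (has_model_four_cycle es mf tf un sBS pS qS pB qB pq epq pb pd qa qc).
apply: (insert_under_top es ei es' ei' vB zB vz uB _ br lf) => //; first by rewrite es.
- move=> a b c d aB bB cB' dB l1 l2 l3 h.
  case/orP: h => /and4P[h1 h2 h3 h4].
  + by apply: (four a b c d z v) => //; apply: enb; rewrite // ?h1 ?h2 ?h3 ?h4 ?orbT.
  + by apply: (four a b c d v z) => //; rewrite 1?es //; apply: enb; rewrite // ?h1 ?h2 ?h3 ?h4 ?orbT.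
- move=> a b c aB bB cB' un H.
  have [f [mf tf]] := rooted_triangle es cB aB bB cB' un.
  case: kf => kf5 _; apply: kf5.
  apply: (has_model_triangle es mf tf un sBS zS vS zB vB zv ezv) => w /H /andP[-> ->]; by [].
Qed.

(** The vertex [n] of degree three is contracted into its neighbour [c], which provides the edges zc
    and vc. An obstruction to reinserting [n] would be an alternation of [v] and [c] with two
    neighbours of [z]; but [v] and [c] are adjacent and the rest of [B] is connected, against
    [noncrossing]. *)
Lemma barrep_degree_three e S u z : symmetric e -> irreflexive e -> Kfree e S ->
  kconn e 3 S -> 3 < #|S| -> representable_below S -> u \in S -> z \in S -> e u z ->
  (forall v, v \in S -> v != z -> v != u -> e z v -> ~ kconn e 2 (S :\ z :\ v)) ->
  barrep R e S u z.
Proof.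
move=> es ei kf cS S3 IH uS zS uz nobad.
have unz : u != z by apply: contraTneq uz => ->; rewrite ei.
have [n [v [c [c' [D1 [[nS nz nu] [vS vz vn ezv] [cS' cz cn cv enc] [enz env nbn]
  [sD1 vD1 cD1 D1P [c'v [c'c nbD1]]]]]]]]] := degree_three_neighbour es cS uS zS S3 nobad.
have [E1 E2] := setD2K nS zS nz.
set B := S :\ z :\ n in E1 E2.
have mB w : (w \in B) = [&& w != n, w != z & w \in S] by rewrite !inE.
have sBS : B \subset S by apply/subsetP=> w; rewrite mB => /and3P[].
have nB : n \notin B by rewrite mB eqxx.
have zB : z \notin B by rewrite mB eqxx andbF.
have uB : u \in B by rewrite mB unz uS eq_sym nu.
have vB : v \in B by rewrite mB vn vz.
have cB : c \in B by rewrite mB cn cz.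
have cSn : #|S :\ n| < #|S| by rewrite [X in _ < X](cardsD1 n) nS.
pose e' := contraction e c n.
have es' : symmetric e' by apply: contraction_sym.
have ei' : irreflexive e' := contraction_irr e c n.
have kf' : Kfree e' (S :\ n) by apply: Kfree_contraction; rewrite // es.
have := IH (S :\ n) e' u z cSn es' ei' kf' _ _ _.
case=> [|||y [l [r [x [br lf]]]]].
- by rewrite !inE eq_sym nu.
- by rewrite !inE eq_sym nz.
- by rewrite /e' /contraction /contracted /= unz uz.
rewrite -E1; rewrite -E2 in br lf.
have ne_e a b : e a b -> a != b by apply: contraTneq => ->; rewrite ei.
have ee a b : e a b -> e' a b.
  by move=> ab; rewrite /e' /contraction /contracted /= ab ne_e.
have e'vc : e' v c by rewrite /e' /contraction /contracted /= eqxx env !orbT andbT eq_sym.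
have e'zc : e' z c by rewrite /e' /contraction /contracted /= eqxx enz !orbT andbT eq_sym.
have e'e a b : a != c -> b != c -> e' a b -> e a b.
  by move=> ac bc; rewrite /e' /contraction /contracted /= (negPf ac) (negPf bc) !orbF => /andP[].
have enb : {in B, forall s, e n s || e z s -> e' z s}.
  move=> s; rewrite mB => /and3P[sn sz sS] /orP[ns|/ee //].
  have := nbn _ sS sn ns; rewrite !inE (negPf sz) /= => /orP[] /eqP -> //; exact: ee.
have top : {in B, forall w, (y w < y z)%R}.
  case: lf => _ hi _ _ w wB; apply: hi; first by rewrite inE wB orbT.
  by apply: contraNneq zB => <-.
have vis s : s \in B -> e' z s -> visible B y l r s (x z s) by apply: (top_visible es' br top).
have brB : bars e' B y l r x by apply: (bars_sub _ _ br) => //; exact: subsetUr.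
have neq a b : (x z a < x z b)%R -> a != b by apply: contraTneq => ->; rewrite ltxx.
have nbB w : w \in B -> e n w -> w \in [set v; c].
  rewrite mB => /and3P[wn wz wS] nw; have := nbn _ wS wn nw.
  by rewrite !inE (negPf wz).
(* [v] and [c] do not separate two vertices of B, as c' does not lie on the far side. *)
pose B0 := B :\ v :\ c.
have kill (F : {set T}) : F \subset B0 -> F != set0 -> c' \notin F ->
    (forall a b, a \in F -> b \in B0 -> b \notin F -> ~~ e a b) -> False.
  move=> sF F0 c'F cl.
  have mF a : a \in F -> [/\ a \in B, a != v & a != c].
    by move=> aF; have := subsetP sF _ aF; rewrite in_setD1 in_setD1 => /and3P[].
  have mS a : a \in F -> [/\ a \in S, a != z & a != n].
    by move/mF=> [aB _ _]; move: aB; rewrite mB => /and3P[].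
  have outF a b : a \in F -> b \in S -> b \notin F -> e a b -> b \in [set z; v; c].
    move=> aF bS bF ab; rewrite !inE; apply/negPn/negP; rewrite !negb_or => /andP[/andP[bz bv] bc].
    have bn : b != n.
      apply: contraTneq ab => ->; rewrite es; apply/negP=> na.
      have [aB av ac] := mF _ aF; have := nbB _ aB na.
      by rewrite !inE (negPf av) (negPf ac).
    by have := cl a b aF; rewrite /B0 in_setD1 in_setD1 mB bv bc bn bz bS ab => /(_ isT bF).
  have D1nb a b : a \in D1 -> b \in S -> b \notin D1 -> e a b -> b \in [set z; n; c'].
    by move=> aD bS bD ab; apply: (subsetP nbD1); apply/nbP; split=> //; exists a.
  (* Edges leaving this set end in [z] or [v], since [c'] is not in [F] and [c] has no neighbour in
     [D1]. So [z] and [v] would separate it from [n]. *)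
  have c1 : F :&: D1 = set0.
    apply/eqP/negPn/negP=> F10.
    apply: (kconn3_small cS _ F10 _ nS) => //.
    - by apply/subsetP=> a; rewrite inE => /andP[/mS[]].
    - apply: nb_sub => a b; rewrite !in_setI => /andP[aF aD] bS bFD ab.
      rewrite in_set2; case: (boolP (b \in F)) => bF.
        have bD : b \notin D1 by move: bFD; rewrite bF.
        have := D1nb _ _ aD bS bD ab; have [_ bz bn] := mS _ bF.
        rewrite !inE (negPf bz) (negPf bn) /= => /eqP E; by rewrite -E bF in c'F.
      have := outF _ _ aF bS bF ab; rewrite !inE => /orP[h|/eqP Eb]; first exact: h.
      have bD : b \notin D1 by rewrite Eb.
      have := D1nb a b aD bS bD ab.
      by rewrite Eb !inE (negPf cz) (negPf cn) eq_sym (negPf c'c).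
    - by rewrite inE; apply/negP=> /andP[/mS[_ _]]; rewrite eqxx.
    - exact: nz.
    - by rewrite eq_sym.
  (* Being in [D1], [v] has no neighbour in [F]; so [z] and [c] separate [F] from [v]. *)
  apply: (kconn3_small cS (D := F) (a := z) (b := c) _ F0 _ vS) => //.
  - by apply/subsetP=> a /mS[].
  - apply: nb_sub => a b aF bS bF ab.
    have := outF _ _ aF bS bF ab; rewrite !inE => /orP[/orP[->//|/eqP E]|->]; last by rewrite orbT.
    have aD : a \notin D1.
      by apply/negP=> aD; have : a \in F :&: D1; [rewrite inE aF|rewrite c1 inE].
    have [aS az an] := mS _ aF.
    have := D1nb v a vD1 aS aD; rewrite -E es => /(_ ab).
    by rewrite !inE (negPf az) (negPf an) /= => /eqP Ec; rewrite -Ec aF in c'F.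
  - by apply/negP=> /mF[_]; rewrite eqxx.
  - by rewrite eq_sym.
have linked y1 y2 : y1 \in B0 -> y2 \in B0 -> y2 \in component e' B0 y1.
  move=> y1B y2B; apply/negPn/negP=> nl.
  set F := component e' B0 y1 in nl.
  have sF : F \subset B0 := component_sub _ y1B.
  have clF a b : a \in F -> b \in B0 -> b \notin F -> ~~ e a b.
    by move=> aF bB bF; apply/negP=> /ee ab; case/negP: bF; apply: component_closed ab.
  case: (boolP (c' \in F)) => c'F.
    apply: (kill (B0 :\: F)); rewrite ?subsetDl // ?in_setD ?c'F //.
      by apply/set0Pn; exists y2; rewrite in_setD nl.
    move=> a b; rewrite in_setD => /andP[aF aB] bB; rewrite in_setD bB andbT negbK => bF.
    by rewrite es; apply: clF.
  by apply: (kill F) => //; apply/set0Pn; exists y1; apply: component_id.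
have cvc : conn e' [set v; c].
  apply: (@connU _ _ es' [set v] [set c] v c) => //; rewrite ?inE //; exact: (@conn1 _ e').
have cross p q y1 y2 : [set p; q] = [set v; c] -> y1 \in B0 -> y2 \in B0 ->
    let P := [set v; c] in let Q := component e' B0 y1 in
    [/\ P \subset B, Q \subset B, [disjoint P & Q], conn e' Q & y1 \in Q /\ y2 \in Q].
  move=> _ y1B y2B /=; have sQ := component_sub e' y1B; split.
  - by rewrite subUset !sub1set vB.
  - by apply: subset_trans sQ _; apply/subsetP=> w; rewrite in_setD1 in_setD1 => /and3P[].
  - rewrite disjoint_sym disjoints_subset; apply: subset_trans sQ _.
    by apply/subsetP=> w; rewrite !inE => /and5P[/negPf -> /negPf ->].
  - exact: component_conn.
  - by split; [exact: component_id|exact: linked].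
have inB0 p q w : [set p; q] = [set v; c] -> w \in B -> w != p -> w != q -> w \in B0.
  move=> E wB wp wq; rewrite in_setD1 in_setD1 wB andbT.
  have : w \notin [set v; c] by rewrite -E !inE negb_or wp.
  by rewrite !inE negb_or andbC.
have pair p q : p \in B -> q \in B -> e n p -> e n q -> p != q -> [set p; q] = [set v; c].
  move=> pB qB np nq pq; have := nbB _ pB np; have := nbB _ qB nq.
  rewrite !inE => /orP[] /eqP Eq /orP[] /eqP Ep; rewrite Ep Eq ?eqxx // in pq *.
  by rewrite setUC.
apply: (insert_under_top es ei es' ei' nB zB nz uB _ br lf) => //; first by rewrite es.
- by move=> a b _ _; apply: ee.
- move=> a b d f aB bB dB fB l1 l2 l3 h.
  have [nab nbd ndf] := And3 (neq _ _ l1) (neq _ _ l2) (neq _ _ l3).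
  have nad := neq _ _ (lt_trans l1 l2); have nbf := neq _ _ (lt_trans l2 l3).
  have naf := neq _ _ (lt_trans l1 (lt_trans l2 l3)).
  have [za zb zd zf] : [/\ e' z a, e' z b, e' z d & e' z f].
    by case/orP: h => /and4P[h1 h2 h3 h4]; split; apply: enb; rewrite // ?h1 ?h2 ?h3 ?h4 ?orbT.
  case/orP: h => /and4P[h1 h2 h3 h4].
    have E := pair _ _ aB dB h1 h3 nad.
    have b0 : b \in B0 by apply: (inB0 a d); rewrite // eq_sym.
    have f0 : f \in B0 by apply: (inB0 a d); rewrite // eq_sym.
    have [sP sQ dPQ cQ [m2 m4]] := cross _ _ _ _ E b0 f0.
    have m1 : a \in [set v; c] by rewrite -E !inE eqxx.
    have m3 : d \in [set v; c] by rewrite -E !inE eqxx orbT.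
    exact: (noncrossing es' brB sP sQ dPQ cvc cQ m1 m2 m3 m4 (vis _ aB za) (vis _ bB zb) (vis _ dB zd) (vis _ fB zf)).
  have E := pair _ _ bB fB h2 h4 nbf.
  have a0 : a \in B0 by apply: (inB0 b f).
  have d0 : d \in B0 by apply: (inB0 b f); rewrite // eq_sym.
  have [sP sQ dPQ cQ [m2 m4]] := cross _ _ _ _ E a0 d0.
  have m1 : b \in [set v; c] by rewrite -E !inE eqxx.
  have m3 : f \in [set v; c] by rewrite -E !inE eqxx orbT.
  have dQP : [disjoint component e' B0 a & [set v; c]] by rewrite disjoint_sym.
  exact: (noncrossing es' brB sQ sP dQP cQ cvc m2 m1 m4 m3 (vis _ aB za) (vis _ bB zb) (vis _ dB zd) (vis _ fB zf)).
- move=> a b d aB bB dB /=; rewrite !inE !negb_or !andbT => /andP[/andP[nab nad] nbd] H.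
  have h w : w \in [set a; b; d] -> w \in B -> e n w by move=> /H /andP[].
  have E := pair _ _ aB bB (h a _ aB) (h b _ bB) nab.
  have : d \in [set v; c] by apply: nbB; rewrite // h // !inE eqxx orbT.
  rewrite -E; last first.
  - by rewrite !inE eqxx orbT.
  - by rewrite !inE eqxx.
  by rewrite !inE eq_sym (negPf nad) eq_sym (negPf nbd).
Qed.

End Induction.

(** * Separations of order at most two *)

Section Separable.
Variables (R : realFieldType) (T : finType).
Implicit Types (e : rel T) (S B D : {set T}) (u v z a b w : T).

Definition with_edge e c d : rel T := [rel a b | e a b || same_pair c d a b].

Lemma with_edge_sym e c d : symmetric e -> symmetric (with_edge e c d).
Proof. by move=> es a b; rewrite /with_edge /= es same_pair_sym /same_pair; case: eqP; case: eqP; case: eqP; case: eqP. Qed.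

Lemma with_edge_irr e c d : irreflexive e -> c != d -> irreflexive (with_edge e c d).
Proof.
move=> ei cd a; rewrite /with_edge /= ei /same_pair /=.
by case: (eqVneq a c) => [->|_]; rewrite ?(negPf cd) ?andbF.
Qed.

(* A connected set [D] attached to both [c] and [d] plays the role of the edge cd. *)
Lemma Kfree_with_edge e S S' D c d : symmetric e -> Kfree e S -> S' \subset S ->
  D \subset S -> [disjoint S' & D] -> c \in S' -> conn e (c |: D) ->
  e c d \/ (exists2 w, w \in D & e w d) -> Kfree (with_edge e c d) S'.
Proof.
move=> es kf sS sD dis cS cD wd.
apply: Kfree_minor (model_absorb es cS sS sD dis cD _) kf.
move=> x y xS yS /=; rewrite /with_edge /= => /orP[|]; first by left.
rewrite /same_pair => /orP[] /andP[/eqP -> /eqP ->]; case: wd => [cd|[w wD wd]].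
- by left.
- by right; left; split=> //; exists w.
- by left; rewrite es.
- by right; right; split=> //; exists w; rewrite // es.
Qed.

(* [D] minimizes first the number of its attachments, then its size; hence it is
   connected, and the rest of the graph joins its two attachments c and d. *)
Lemma barrep_separable e S u z : symmetric e -> irreflexive e -> Kfree e S ->
  representable_below R S -> u \in S -> z \in S -> e u z ->
  ~ kconn e 3 S -> barrep R e S u z.
Proof.
move=> es ei kf IH uS zS uz nk.
have unz : u != z by apply: contraTneq uz => ->; rewrite ei.
have zu : e z u by rewrite es.
pose valid (D : {set T}) := [/\ D \subset S, D != set0, u \notin D /\ z \notin D,
  #|nb e S D| < 3 & D :|: nb e S D != S].
(* As uz is an edge, a side that contains [u] or [z] has both in its closed neighbourhood, and then
   the opposite side avoids both. *)
have exv : exists D, valid D.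
  have [D sD [D0 lt ne]] := kconn_not nk.
  have [[uD zD]|h] := pselect (u \notin D /\ z \notin D); first by exists D.
  have uzD : u \in D :|: nb e S D /\ z \in D :|: nb e S D.
    case: (boolP (u \in D)) => uD.
      split; rewrite inE ?uD //; case: (boolP (z \in D)) => //= zD.
      by apply/nbP; split=> //; exists u.
    case: (boolP (z \in D)) => zD; last by case: h.
    by split; rewrite inE ?zD // (negPf uD) /=; apply/nbP; split=> //; exists z.
  have nbs : nb e S (S :\: (D :|: nb e S D)) \subset nb e S D.
    apply: nb_sub => x y; rewrite !in_setD in_setU negb_or => /andP[/andP[xD xN] xS] yS.
    rewrite yS andbT negbK in_setU => /orP[yD|//] xy.
    by case/negP: xN; apply/nbP; split=> //; exists y; rewrite // es.
  exists (S :\: (D :|: nb e S D)); split.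
  - exact: subsetDl.
  - apply: contra ne; rewrite setD_eq0 => sS; rewrite eqEsubset sS andbT subUset sD /=.
    by apply/subsetP=> y /nbP[].
  - by rewrite !in_setD; case: uzD => -> ->.
  - exact: leq_ltn_trans (subset_leq_card nbs) lt.
  - case/set0Pn: D0 => x xD; apply/eqP=> E; have := subsetP sD _ xD.
    rewrite -E in_setU in_setD in_setU xD /= => /(subsetP nbs) /nbP[_]; by rewrite xD.
(* The factor [#|T|.+1] exceeds every [#|D|], which makes the measure lexicographic. *)
have [D [sD D0 [uD zD] lt ne] minD] :=
  min_measure (fun D => #|nb e S D| * #|T|.+1 + #|D|) exv.
have min1 D' : valid D' -> #|nb e S D| <= #|nb e S D'|.
  move=> /minD h; rewrite leqNgt; apply/negP=> lt'.
  have t : #|D'| <= #|T| := max_card _.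
  move: h t lt'; clear; nia.
have min2 D' : valid D' -> #|nb e S D'| <= #|nb e S D| -> #|D| <= #|D'|.
  by move=> /minD h le; move: h le; clear; nia.
have outD a b : a \in D -> b \in S -> b \notin D -> e a b -> b \in nb e S D.
  by move=> aD bS bD ab; apply/nbP; split=> //; exists a.
have ltS1 : #|S :\: D| < #|S|.
  apply: proper_card; rewrite properE subsetDl /=; case/set0Pn: D0 => x xD.
  by apply/subsetPn; exists x; rewrite ?(subsetP sD) // in_setD xD.
have glue_at c d e12 : c != d -> c \in S :\: D -> d \in S :\: D -> nb e S D \subset [set c; d] ->
    symmetric e12 -> irreflexive e12 -> e12 c d -> subrel e e12 -> Kfree e12 (S :\: D) ->
    Kfree e12 (D :|: [set c; d]) -> #|D :|: [set c; d]| < #|S| -> barrep R e S u z.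
  move=> cd cS dS sN es12 ei12 ecd ee kf1 kf2 lt2.
  have ES : S = (S :\: D) :|: (D :|: [set c; d]).
    have [cS0 dS0] : c \in S /\ d \in S by move: cS dS; rewrite !in_setD => /andP[_ ->] /andP[_ ->].
    apply/setP=> w; rewrite !inE; case: (boolP (w \in D)) => [/(subsetP sD) ->|] //=.
    case: (boolP (w \in S)) => //= wS _; apply/esym/negP=> /orP[] /eqP E;
    by rewrite E ?cS0 ?dS0 in wS.
  have uS1 : u \in S :\: D by rewrite in_setD uD.
  have zS1 : z \in S :\: D by rewrite in_setD zD.
  rewrite ES; apply: (glue (e1 := e12) (e2 := e12) (c := c) (d := d)) => //.
  - by rewrite !inE eqxx orbT.
  - by rewrite !inE eqxx !orbT.
  - move=> w; rewrite !inE => /andP[/negPf -> _] /= /orP[] /eqP; auto.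
  - by move=> a b _ _; apply: ee.
  - by move=> a b _ _; apply: ee.
  - rewrite -ES => a b ab aS bS.
    have h x y : x \in D -> y \in S -> e x y -> y \in D :|: [set c; d].
      move=> xD yS xy; rewrite in_setU; case: (boolP (y \in D)) => //= yD.
      exact: (subsetP sN) (outD _ _ xD yS yD xy).
    case: (boolP (a \in D)) => aD.
      by right; split; [rewrite in_setU aD|exact: h ab].
    case: (boolP (b \in D)) => bD; last by left; rewrite !in_setD aD bD.
    by right; split; [apply: (h b a); rewrite // es|rewrite in_setU bD].
  - by apply: IH => //; exact: ee.
  - by apply: IH; rewrite // !inE eqxx ?orbT.
have sD2 c d : c \in S -> d \in S -> D :|: [set c; d] \subset S.
  by move=> cS dS; rewrite subUset sD subUset !sub1set cS.
have uSD : u \in S :\: D by rewrite in_setD uD.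
have zSD : z \in S :\: D by rewrite in_setD zD.
(* With [c] as the only possible attachment, any edge cd outside [D] serves for gluing. If [D]
   together with [c] and [d] is all of [S], then cd is uz and [d] is a pendant vertex. *)
have few c d : c \in S :\: D -> d \in S :\: D -> e c d -> nb e S D \subset [set c] -> barrep R e S u z.
  move=> cS dS cd sN.
  have ncd : c != d by apply: contraTneq cd => ->; rewrite ei.
  have [cS0 dS0] : c \in S /\ d \in S by move: cS dS; rewrite !in_setD => /andP[_ ->] /andP[_ ->].
  case: (eqVneq (D :|: [set c; d]) S) => [E|neS]; last first.
    apply: (glue_at c d e) => //.
    - by apply: subset_trans sN _; rewrite sub1set !inE eqxx.
    - by apply: Kfree_sub kf; rewrite ?subsetDl.
    - by apply: Kfree_sub kf; rewrite ?sD2.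
    - by apply: proper_card; rewrite properEneq neS sD2.
  have uzcd w : w \in S :\: D -> w = c \/ w = d.
    by rewrite -{1}E !inE => /andP[/negPf ->] /= /orP[] /eqP; auto.
  have IH' S' a b : S' \proper S -> Kfree e S' -> a \in S' -> b \in S' -> e a b -> barrep R e S' a b.
    by move=> pr; apply: IH => //; apply: proper_card.
  have dpend w : w \in S -> e d w -> w = c.
    move=> wS dw; case: (boolP (w \in D)) => wD; last first.
      have wSD : w \in S :\: D by rewrite in_setD wD.
      by case: (uzcd _ wSD) => // Ew; move: dw; rewrite Ew ei.
    have dD : d \notin D by move: dS; rewrite in_setD => /andP[].
    have := subsetP sN d; rewrite es in dw.
    by move/(_ (outD _ _ wD dS0 dD dw)); rewrite inE eq_sym (negPf ncd).
  case: (uzcd _ uSD) (uzcd _ zSD) => Eu [] Ez; subst.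
  - by rewrite eqxx in unz.
  - exact: barrep_pendant.
  - by apply: barrep_flip => //; apply: barrep_pendant.
  - by rewrite eqxx in unz.
case: (ltnP #|nb e S D| 2) => [le1|ge2].
  case: (eqVneq (nb e S D) set0) => [N0|/set0Pn[c cN]].
    by apply: (few u z); rewrite // N0 sub0set.
  have [cS cD _] := nbP _ _ _ _ cN.
  have sN : nb e S D \subset [set c].
    have /eqP <- // : [set c] == nb e S D by rewrite eqEcard sub1set cN cards1.
  have cSD : c \in S :\: D by rewrite in_setD cD.
  case: (pickP [pred d | (d \in S :\: D) && e c d]) => [d /andP[dS cd]|none].
    exact: (few c d).
  have [uc zc] : u != c /\ z != c.
    by split; apply: contraTneq isT => E; [have := none z|have := none u]; rewrite /= -E ?zSD ?uSD ?uz ?zu.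
  (* [c] has no neighbour outside [D], so [D] enlarged by [c] has no attachment at all, against the
     choice of [D]. *)
  have nbF : nb e S (c |: D) \subset set0.
    apply: nb_sub => x y; rewrite !in_setU1 negb_or => /orP[/eqP ->|xD] yS /andP[yc yD] xy.
      by have := none y; rewrite /= in_setD yD yS xy.
    by have := subsetP sN _ (outD _ _ xD yS yD xy); rewrite inE (negPf yc).
  have : #|nb e S D| <= #|nb e S (c |: D)|.
    apply: min1; split.
    - by rewrite subUset sub1set cS.
    - by apply/set0Pn; exists c; rewrite !inE eqxx.
    - by rewrite !in_setU1 !negb_or uc zc.
    - by apply: leq_ltn_trans (subset_leq_card nbF) _; rewrite cards0.
    - apply: contraTneq uS => <-; rewrite in_setU in_setU1 (negPf uc) (negPf uD) /=.
      by apply/negP=> /(subsetP nbF); rewrite inE.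
  move/leq_trans/(_ (subset_leq_card nbF)); rewrite cards0 leqn0 cards_eq0 => /eqP N0.
  by rewrite N0 inE in cN.
have N2 : #|nb e S D| == 2 by rewrite eqn_leq ge2 -ltnS lt.
have [c [d [cd EN]]] : exists c d, c != d /\ nb e S D = [set c; d].
  exact/cards2P.
have [cN dN] : c \in nb e S D /\ d \in nb e S D by rewrite EN !inE !eqxx orbT.
have [cS cD [c0 c0D c0c]] := nbP _ _ _ _ cN.
have [dS dD [d0 d0D d0d]] := nbP _ _ _ _ dN.
have cSD : c \in S :\: D by rewrite in_setD cD.
have dSD : d \in S :\: D by rewrite in_setD dD.
have cDconn : conn e D.
  apply: contrapT => /conn_not[E sE [E0 ED clE]].
  have nbE : nb e S E \subset nb e S D.
    apply: nb_sub => x y xE yS yE xy; apply: (outD x) => //; first exact: (subsetP sE).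
    by apply/negP=> yD; have := clE _ _ xE yD yE; rewrite xy.
  have : #|D| <= #|E|.
    apply: min2; last exact: subset_leq_card.
    split=> //.
    - exact: subset_trans sE sD.
    - by split; [apply: contra uD|apply: contra zD]; apply: (subsetP sE).
    - exact: leq_ltn_trans (subset_leq_card nbE) lt.
    - apply: contra ne => /eqP ES; rewrite eqEsubset; apply/andP; split; last by rewrite -{1}ES setUSS.
      by rewrite subUset sD; apply/subsetP=> y /nbP[].
  by rewrite leqNgt proper_card // properEneq ED.
(* Suppose [S :\: D] falls apart with [u] and [z] on the side of [a]. The side of [b] without [b] is
   attached to [b] only; if it is empty, [D] with [b] is attached to [a] only. Either way there are
   fewer than two attachments. *)
have separated a b (Ea Eb : {set T}) : nb e S D = [set a; b] -> S :\: D = Ea :|: Eb ->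
    [disjoint Ea & Eb] -> a \in Ea -> b \in Eb ->
    (forall x y, x \in Ea -> y \in Eb -> ~~ e x y) -> u \in Ea -> z \in Ea -> False.
  move=> ENab ESD dis aEa bEb noe uE zE.
  have memSD y : y \in S -> y \notin D -> (y \in Ea) || (y \in Eb).
    by move=> yS yD; rewrite -in_setU -ESD in_setD yD.
  have EbSD y : y \in Eb -> y \in S /\ y \notin D.
    by move=> yE; have : y \in S :\: D; [rewrite ESD in_setU yE orbT|rewrite in_setD => /andP[]].
  have small (F : {set T}) q : F \subset S -> F != set0 -> u \notin F -> z \notin F ->
      nb e S F \subset [set q] -> F :|: nb e S F != S -> False.
    move=> sF F0 uF zF sN neF; have lt1 := subset_leq_card sN; rewrite cards1 in lt1.
    have : #|nb e S D| <= #|nb e S F| by apply: min1; split=> //; apply: leq_ltn_trans lt1 _.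
    by move=> h; have := leq_trans ge2 (leq_trans h lt1).
  have [bS bD] := EbSD _ bEb.
  have ub : u != b by apply: contraTneq uE => ->; rewrite (disjointFl dis bEb).
  have zb : z != b by apply: contraTneq zE => ->; rewrite (disjointFl dis bEb).
  have uEb : u \notin Eb by rewrite (disjointFr dis uE).
  have zEb : z \notin Eb by rewrite (disjointFr dis zE).
  case: (eqVneq (Eb :\ b) set0) => [E0|E0]; last first.
    have nbF : nb e S (Eb :\ b) \subset [set b].
      apply: nb_sub => x y; rewrite !in_setD1 => /andP[xb xE] yS yF xy; rewrite inE.
      have [xS xD] := EbSD _ xE.
      case: (boolP (y \in D)) => yD.
        have := outD y x yD xS xD; rewrite es => /(_ xy); rewrite ENab !inE (negPf xb) orbF => /eqP Exa.
        by move: xE; rewrite Exa (disjointFr dis aEa).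
      case/orP: (memSD _ yS yD) => yE; first by have := noe _ _ yE xE; rewrite es xy.
      by move: yF; rewrite yE andbT negbK.
    apply: (small (Eb :\ b) b) => //.
    - by apply/subsetP=> x; rewrite in_setD1 => /andP[_ /EbSD[]].
    - by rewrite in_setD1 (negPf uEb) andbF.
    - by rewrite in_setD1 (negPf zEb) andbF.
    - apply: contraTneq uS => <-; rewrite in_setU in_setD1 (negPf uEb) andbF /=.
      by apply/negP=> /(subsetP nbF); rewrite inE (negPf ub).
  have Eb1 y : y \in Eb -> y = b.
    by move=> yE; apply/eqP/negPn/negP=> yb; have : y \in Eb :\ b; [rewrite in_setD1 yb|rewrite E0 inE].
  have nbF : nb e S (b |: D) \subset [set a].
    apply: nb_sub => x y; rewrite !in_setU1 negb_or => /orP[/eqP ->|xD] yS /andP[yb yD] xy.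
      case/orP: (memSD _ yS yD) => yE; first by have := noe _ _ yE bEb; rewrite es xy.
      by rewrite (Eb1 _ yE) eqxx in yb.
    by have := outD _ _ xD yS yD xy; rewrite ENab !inE (negPf yb) orbF.
  have [uF zF] : u \notin b |: D /\ z \notin b |: D by rewrite !in_setU1 !negb_or ub zb.
  apply: (small (b |: D) a) => //.
  - by rewrite subUset sub1set bS.
  - by apply/set0Pn; exists b; rewrite !inE eqxx.
  - apply/eqP=> ES; have : u \in [set a] /\ z \in [set a].
      split; apply: (subsetP nbF); [move: uS|move: zS]; rewrite -{1}ES in_setU ?(negPf uF) ?(negPf zF) //.
    by rewrite !inE => -[/eqP Eu /eqP Ez]; rewrite Eu Ez eqxx in unz.
set P := component e (S :\: D) c.
have sP : P \subset S :\: D := component_sub e cSD.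
have cP : c \in P := component_id e _ c.
have linked : d \in P.
  apply/negPn/negP=> dP.
  have noe x y : x \in P -> y \in S :\: D :\: P -> ~~ e x y.
    move=> xP; rewrite in_setD => /andP[yP yS]; apply/negP=> xy; case/negP: yP.
    exact: component_closed xy.
  have dis : [disjoint P & S :\: D :\: P].
    by rewrite disjoint_sym disjoints_subset; apply/subsetP=> x; rewrite in_setD in_setC => /andP[].
  have US : S :\: D = P :|: (S :\: D :\: P).
    by rewrite -{1}(setID (S :\: D) P) (setIidPr sP).
  have dQ : d \in S :\: D :\: P by rewrite in_setD dP dSD.
  have stay x y : e x y -> x \in S :\: D -> y \in S :\: D -> x \in P -> y \in P.
    by move=> xy xS yS xP; apply: component_closed xy.
  case: (boolP (u \in P)) => uP.
    by apply: (separated c d P _ EN US dis cP dQ noe uP); apply: (stay u).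
  have zP : z \notin P by apply: contra uP; apply: (stay z u).
  have dis' : [disjoint S :\: D :\: P & P] by rewrite disjoint_sym.
  have EN' : nb e S D = [set d; c] by rewrite EN setUC.
  have US' : S :\: D = (S :\: D :\: P) :|: P by rewrite setUC -US.
  apply: (separated d c _ P EN' US' dis' dQ cP).
  - by move=> x y xQ yP; rewrite es; apply: noe.
  - by rewrite in_setD uP uSD.
  - by rewrite in_setD zP zSD.
have cPd : c \in P :\ d by rewrite in_setD1 cd.
have [w wX wd] := component_adjacent es (component_conn es cSD) linked cP cd.
(* [X] leads outside [D] from [c] to a neighbour of [d]. Absorbed by [c], it justifies the edge cd
   in the piece of [D]. *)
set X := component e (P :\ d) c in wX.
have sX : X \subset P :\ d := component_sub e cPd.
have cX : c \in X := component_id e _ c.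
have XS x : x \in X -> [/\ x \in S, x \notin D & x != d].
  move/(subsetP sX); rewrite in_setD1 => /andP[xd /(subsetP sP)].
  by rewrite in_setD => /andP[-> ->].
apply: (glue_at c d (with_edge e c d)) => //.
- by rewrite EN.
- exact: with_edge_sym.
- exact: with_edge_irr.
- by rewrite /with_edge /= /same_pair !eqxx orbT.
- by move=> a b ab; rewrite /with_edge /= ab.
- apply: (Kfree_with_edge (S := S) (D := D)) => //.
  + exact: subsetDl.
  + by rewrite disjoints_subset; apply/subsetP=> x; rewrite in_setD in_setC => /andP[].
  + have cc : c \in [set c] by rewrite inE.
    have ecc0 : e c c0 by rewrite es.
    exact: (connU es (@conn1 _ e c) cDconn cc c0D ecc0).
  + by right; exists d0.
- apply: (Kfree_with_edge (S := S) (D := X :\ c)) => //.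
  + exact: sD2.
  + by apply/subsetP=> x; rewrite in_setD1 => /andP[_ /XS[]].
  + rewrite disjoint_sym disjoints_subset; apply/subsetP=> x.
    rewrite in_setD1 => /andP[xc /XS[_ xD xd]].
    by rewrite in_setC in_setU (negPf xD) !inE (negPf xc) (negPf xd).
  + by rewrite !inE eqxx orbT.
  + by rewrite setD1K //; apply: component_conn.
  + case: (eqVneq w c) => [<-|wc]; first by left.
    by right; exists w; rewrite // in_setD1 wc.
- apply: proper_card; rewrite properEneq sD2 // andbT -EN; exact: ne.
Qed.

Theorem Kfree_barrep e S u z : symmetric e -> irreflexive e -> Kfree e S ->
  u \in S -> z \in S -> e u z -> barrep R e S u z.
Proof.
move En : #|S| => n; elim/ltn_ind: n => n IHn in S e u z En *.
move=> es ei kf uS zS uz.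
have IH : representable_below R S.
  by move=> S' e' a b lt es' ei' kf' aS bS ab; apply: (IHn #|S'|); rewrite // -En.
have unz : u != z by apply: contraTneq uz => ->; rewrite ei.
case: (leqP #|S| 4) => [S4|S4]; first exact: barrep_small.
have [cS|nc] := pselect (kconn e 3 S); last exact: barrep_separable.
have [[v [vS vz vu ezv c2]]|no] := pselect (exists v, [/\ v \in S, v != z, v != u, e z v & kconn e 2 (S :\ z :\ v)]).
  exact: (barrep_removable es ei kf IH uS zS uz vS vz vu ezv c2).
apply: barrep_degree_three => //; first exact: ltnW.
by move=> v vS vz vu ezv c2; apply: no; exists v.
Qed.

End Separable.

Local Open Scope ring_scope.

(** * Polygonal chains *)

Section Segments.
Variable R : realFieldType.
Implicit Types (P Q X Y Z : R * R) (s t : R).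

Definition lexlt P Q := (P.1 < Q.1) || ((P.1 == Q.1) && (P.2 < Q.2)).

(** Twice the signed area of the triangle PQX; negative when [X] is below the line PQ directed from
    left to right. *)
Definition orient P Q X :=
  (Q.1 - P.1) * (X.2 - P.2) - (Q.2 - P.2) * (X.1 - P.1).

Definition on_segment P Q s : R * R :=
  (P.1 + s * (Q.1 - P.1), P.2 + s * (Q.2 - P.2)).

Definition disjoint_segments P Q X Y := forall s t, 0 <= s <= 1 -> 0 <= t <= 1 ->
  on_segment P Q s <> on_segment X Y t.

(* Whether the upward ray from [X] meets the segment [PQ]; comparing points
   lexicographically amounts to tilting the ray infinitesimally. *)
Definition ray P Q X := (lexlt P X (+) lexlt Q X) &&
  (if lexlt P Q then orient P Q X < 0 else 0 < orient P Q X).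

Lemma lexltE P Q : lexlt P Q <-> P.1 < Q.1 \/ P.1 = Q.1 /\ P.2 < Q.2.
Proof.
rewrite /lexlt; split=> [/orP[->|/andP[/eqP-> ->]]|[->|[-> ->]]] //; first by left.
  by right.
by rewrite eqxx orbT.
Qed.

Lemma lexlt_anti P Q : P != Q -> lexlt P Q = ~~ lexlt Q P.
Proof.
case: P Q => p1 p2 [q1 q2] /eqP ne; apply/idP/idP => [/lexltE/= H|].
  by apply/negP=> /lexltE/= H'; qlra.
rewrite /lexlt /=; case: (ltgtP p1 q1) => //= E; rewrite -leNgt le_eqVlt.
by case/orP=> [/eqP F|//]; case: ne; rewrite E F.
Qed.

Lemma lexlt_trans P Q X : lexlt P Q -> lexlt Q X -> lexlt P X.
Proof. by move=> /lexltE H1 /lexltE H2; apply/lexltE; qlra. Qed.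

Lemma rayC P Q X : ray P Q X = ray Q P X.
Proof.
rewrite /ray addbC; case: eqVneq (@lexlt_anti P Q) => [->//|_ /(_ isT) ->].
have -> : orient P Q X = - orient Q P X by rewrite /orient; ring.
by case: (lexlt Q P); rewrite /= ?oppr_lt0 ?oppr_gt0.
Qed.

Lemma lexlt_between P Q X : lexlt P X -> lexlt X Q -> orient P Q X = 0 ->
  exists2 s, 0 <= s <= 1 & on_segment P Q s = X.
Proof.
case: P Q X => p1 p2 [q1 q2] [x1 x2]; rewrite /on_segment /orient.
move=> /lexltE/= H1 /lexltE/= H2 E; have [lt|ge] := ltP p1 q1.
  exists ((x1 - p1) / (q1 - p1)).
    by rewrite ler_pdivlMr ?ler_pdivrMr ?subr_gt0 //; qlra.
  have n : q1 - p1 != 0 by rewrite subr_eq0 gt_eqF.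
  have -> : x2 = p2 + (x1 - p1) * (q2 - p2) / (q1 - p1).
    by apply: (mulfI n); rewrite mulrDr [_ * (_ / _)]mulrC divfK //; lra.
  by congr (_, _); rewrite /=; field.
have lt : p2 < q2 by qlra.
exists ((x2 - p2) / (q2 - p2)).
  by rewrite ler_pdivlMr ?ler_pdivrMr ?subr_gt0 //; qlra.
congr (_, _); last by field; lra.
have -> : q1 = p1 by qlra.
by rewrite subrr mulr0; qlra.
Qed.

Lemma lexlt_convex P X Y t : lexlt P X -> lexlt P Y -> 0 <= t <= 1 ->
  lexlt P (on_segment X Y t).
Proof.
case: P X Y => p1 p2 [x1 x2] [y1 y2] /lexltE/= H1 /lexltE/= H2 H; apply/lexltE => /=.
have [->|t0] := eqVneq t 0; first by qlra.
have [->|t1] := eqVneq t 1; first by qlra.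
have {}H : 0 < t < 1 by rewrite !lt_neqAle [0 == t]eq_sym t0 t1; qlra.
case: H1 => [H1|[H1 H1']]; case: H2 => [H2|[H2 H2']]; [left; nra|left; nra|left; nra|].
by right; split; nra.
Qed.

Lemma lexlt_convexr P X Y t : lexlt X P -> lexlt Y P -> 0 <= t <= 1 ->
  lexlt (on_segment X Y t) P.
Proof.
case: P X Y => p1 p2 [x1 x2] [y1 y2] /lexltE/= H1 /lexltE/= H2 H; apply/lexltE => /=.
have [->|t0] := eqVneq t 0; first by qlra.
have [->|t1] := eqVneq t 1; first by qlra.
have {}H : 0 < t < 1 by rewrite !lt_neqAle [0 == t]eq_sym t0 t1; qlra.
case: H1 => [H1|[H1 H1']]; case: H2 => [H2|[H2 H2']]; [left; nra|left; nra|left; nra|].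
by right; split; nra.
Qed.

(** Along XY the function [orient P Q] is affine. A change of sign would give a zero, and that point
    lies on PQ because XY stays lexicographically between [P] and [Q]. *)
Lemma same_side P Q X Y : disjoint_segments P Q X Y ->
  lexlt P X -> lexlt X Q -> lexlt P Y -> lexlt Y Q ->
  (orient P Q X < 0) = (orient P Q Y < 0).
Proof.
move=> dis PX XQ PY YQ.
have key t : 0 <= t <= 1 -> orient P Q (on_segment X Y t) <> 0.
  move=> t01 E.
  have [s s01 H] := lexlt_between (lexlt_convex PX PY t01) (lexlt_convexr XQ YQ t01) E.
  exact: dis s01 t01 H.
have E t : orient P Q (on_segment X Y t) = orient P Q X + t * (orient P Q Y - orient P Q X).
  by rewrite /orient /=; ring.
move: (orient P Q X) (orient P Q Y) {PX XQ PY YQ} E => a d E.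
have n0 : a <> 0 by have := key 0; rewrite E mul0r addr0; apply; lra.
have n1 : d <> 0 by have := key 1; rewrite E mul1r addrC subrK; apply; lra.
have meet : (a < 0 < d) || (d < 0 < a) -> False.
  move=> H; apply: (key (a / (a - d))).
    case/orP: H => H; last by rewrite ler_pdivlMr ?ler_pdivrMr ?subr_gt0 //; lra.
    by rewrite ler_ndivlMr ?ler_ndivrMr ?subr_lt0 //; lra.
  by rewrite E; field; lra.
by apply/idP/idP => H; rewrite ltNge; apply/negP=> H'; apply: meet; lra.
Qed.

(** Cramer's rule gives the parameters of the common point of the two lines. The signs give t > 0
    and s < 1; the other bounds follow from the lexicographic order of the ends. *)
Lemma crossing_meet P Q X Y (a b c : R) : a = orient P Q X -> b = orient X Y Q ->
  c = orient P Q Y - a -> 0 < - a / c -> 0 < - b / c ->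
  lexlt P X -> lexlt X Q -> lexlt Q Y -> exists s t,
  [/\ 0 <= s <= 1, 0 <= t <= 1 & on_segment P Q s = on_segment X Y t].
Proof.
move=> aE bE cE t0 s1 PX XQ QY; have c0 : c != 0.
  by apply: contraTneq t0 => ->; rewrite invr0 mulr0 ltxx.
have E : on_segment P Q (1 - - b / c) = on_segment X Y (- a / c).
  case: P Q X Y {PX XQ QY} aE bE cE c0 {t0 s1} => p1 p2 [q1 q2] [x1 x2] [y1 y2].
  rewrite /orient /on_segment /= => -> -> -> c0; congr (_, _); field; exact: c0.
exists (1 - - b / c), (- a / c).
move: (- a / c) (- b / c) t0 s1 E {aE bE cE c0} => t s' t0 s0 E.
move: E PX XQ QY; rewrite /on_segment.
case: P Q X Y => p1 p2 [q1 q2] [x1 x2] [y1 y2] /= [E1 E2].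
move=> /lexltE/= H1 /lexltE/= H2 /lexltE/= H3.
split; last by rewrite E1 E2.
  apply/andP; split; last by lra.
  rewrite leNgt; apply/negP=> s1.
  case: H1 => [H1|[H1 H1']]; nra.
apply/andP; split; first by lra.
rewrite leNgt; apply/negP=> t1; nra.
Qed.

Definition segment_parity P Q X Y :=
  (ray P Q X (+) ray P Q Y) (+) (ray X Y P (+) ray X Y Q)
    (+) ((lexlt P X (+) lexlt P Y) (+) (lexlt Q X (+) lexlt Q Y)).

Lemma disjoint_segments_rev P Q X Y :
  disjoint_segments P Q X Y -> disjoint_segments Q P X Y.
Proof.
move=> dis s t s01 t01 E; apply: (dis (1 - s) t) => //; first by lra.
by rewrite -E /on_segment; congr (_, _); ring.
Qed.

Lemma disjoint_segments_sym P Q X Y :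
  disjoint_segments P Q X Y -> disjoint_segments X Y P Q.
Proof. by move=> dis s t s01 t01 E; apply: dis t01 s01 _; rewrite E. Qed.

Lemma disjoint_segments_ends P Q X Y : disjoint_segments P Q X Y ->
  [/\ P != X, P != Y, Q != X & Q != Y].
Proof.
have s0 (U V : R * R) : on_segment U V 0 = U.
  by case: U => ? ?; rewrite /on_segment /= !mul0r !addr0.
have s1 (U V : R * R) : on_segment U V 1 = V.
  by case: V => ? ?; rewrite /on_segment /= !mul1r !(addrC _ (_ - _)) !subrK.
have i0 : 0 <= (0 : R) <= 1 by rewrite lexx ler01.
have i1 : 0 <= (1 : R) <= 1 by rewrite lexx ler01.
move=> dis; split; apply/eqP=> E.
- by apply: (dis _ _ i0 i0); rewrite !s0.
- by apply: (dis _ _ i0 i1); rewrite s0 s1.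
- by apply: (dis _ _ i1 i0); rewrite s0 s1.
- by apply: (dis _ _ i1 i1); rewrite !s1.
Qed.

(** Lexicographically positive vectors form a cone, so [C] in $Cv = Aw + Bu$ is positive. This finds
    the sign of the determinant of two directions, vertical ones included, from a linear relation
    with a third. *)
Lemma lexpos_coef (A B C u1 u2 v1 v2 w1 w2 : R) : 0 < A -> 0 < B ->
  C * v1 = A * w1 + B * u1 -> C * v2 = A * w2 + B * u2 ->
  0 < u1 \/ u1 = 0 /\ 0 < u2 -> 0 < v1 \/ v1 = 0 /\ 0 < v2 ->
  0 < w1 \/ w1 = 0 /\ 0 < w2 -> 0 < C.
Proof.
move=> A0 B0 E1 E2 Hu Hv Hw; rewrite ltNge; apply/negP=> C0.
have v0 : 0 <= v1 by lra.
have := mulr_le0_ge0 C0 v0; rewrite E1 => le0.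
have Bu : 0 <= B * u1 by rewrite mulr_ge0 ?(ltW B0) //; lra.
have Aw : 0 <= A * w1 by rewrite mulr_ge0 ?(ltW A0) //; lra.
case: Hu => [Hu|[u0 Hu]]; first by have := mulr_gt0 B0 Hu; lra.
case: Hw => [Hw|[w0 Hw]]; first by have := mulr_gt0 A0 Hw; lra.
have := mulr_gt0 B0 Hu; have := mulr_gt0 A0 Hw => H1 H2.
have Cv2 : 0 < C * v2 by lra.
case: Hv => [Hv|[_ Hv]]; last by have := mulr_le0_ge0 C0 (ltW Hv); lra.
have C00 : C = 0.
  have : C * v1 = 0 by rewrite E1 u0 w0 !mulr0 addr0.
  by move/eqP; rewrite mulf_eq0 (gt_eqF Hv) orbF => /eqP.
by rewrite C00 mul0r ltxx in Cv2.
Qed.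

(** If PQ ends before [X], no ray meets a segment. If XY lies in the range of PQ, both its ends are
    on one side of PQ. If [X], [Q], [Y] follow in this order, [X] is below PQ exactly if [Q] is not
    below XY, since otherwise the segments would meet. *)
Lemma segment_parity_sorted P Q X Y : disjoint_segments P Q X Y ->
  lexlt P Q -> lexlt X Y -> lexlt P X -> segment_parity P Q X Y = false.
Proof.
move=> dis PQ XY PX; have PY := lexlt_trans PX XY.
have [nPX nPY nQX nQY] := disjoint_segments_ends dis.
rewrite /segment_parity /ray PQ XY PX PY.
have [-> ->] : lexlt X P = false /\ lexlt Y P = false.
  by rewrite (lexlt_anti nPX) in PX; rewrite (lexlt_anti nPY) in PY; split; apply: negbTE.
rewrite (@lexlt_anti X Q) 1?eq_sym // (@lexlt_anti Y Q) 1?eq_sym //.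
case QX: (lexlt Q X); first by rewrite (lexlt_trans QX XY).
have XQ : lexlt X Q by rewrite lexlt_anti 1?eq_sym // QX.
case QY: (lexlt Q Y) => /=; last first.
  have YQ : lexlt Y Q by rewrite lexlt_anti 1?eq_sym // QY.
  by rewrite (same_side dis PX XQ PY YQ) !addbb.
have meets := crossing_meet erefl erefl erefl.
have no : ~ exists s t, [/\ 0 <= s <= 1, 0 <= t <= 1 & on_segment P Q s = on_segment X Y t].
  by case=> s [t [s01 t01]]; apply: dis.
have a0 : orient P Q X <> 0.
  move=> E; have [s s01 H] := lexlt_between PX XQ E; apply: no.
  exists s, 0; split=> //; first by rewrite lexx ler01.
  by rewrite H; case: (X) => ? ?; rewrite /on_segment /= !mul0r !addr0.
have b0 : orient X Y Q <> 0.
  move=> E; have [t t01 H] := lexlt_between XQ QY E; apply: no.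
  exists 1, t; split=> //; first by rewrite lexx ler01.
  by rewrite H; case: (Q) => ? ?; rewrite /on_segment /= !mul1r !(addrC _ (_ - _)) !subrK.
have [sgn sgn'] : (orient P Q X < 0 -> orient X Y Q < 0 -> 0 < orient P Q Y - orient P Q X) /\
    (0 < orient P Q X -> 0 < orient X Y Q -> orient P Q Y - orient P Q X < 0).
  move: PQ XY XQ; rewrite /orient !lexltE.
  case: P Q X Y {dis PX PY nPX nPY nQX nQY QX QY meets no a0 b0} => p1 p2 [q1 q2] [x1 x2] [y1 y2] /= PQ XY XQ.
  split=> A0 B0; [rewrite -oppr_gt0 in A0; rewrite -oppr_gt0 in B0|rewrite -oppr_gt0].
    apply: (@lexpos_coef _ _ _ (q1 - p1) (q2 - p2) (q1 - x1) (q2 - x2) (y1 - x1) (y2 - x2) A0 B0);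
      by [ring|lra].
  apply: (@lexpos_coef _ _ _ (q1 - p1) (q2 - p2) (q1 - x1) (q2 - x2) (y1 - x1) (y2 - x2) A0 B0);
    by [ring|lra].
move/eqP: a0; move/eqP: b0; rewrite !neq_lt.
case/orP=> b0; case/orP=> a0; rewrite ?a0 ?b0 ?(lt_gtF a0) ?(lt_gtF b0) //; exfalso; apply: no; apply: meets => //.
- by rewrite divr_gt0 ?oppr_gt0 // sgn.
- by rewrite divr_gt0 ?oppr_gt0 // sgn.
- by rewrite -mulrNN -invrN divr_gt0 ?opprK // oppr_gt0 sgn'.
- by rewrite -mulrNN -invrN divr_gt0 ?opprK // oppr_gt0 sgn'.
Qed.

Lemma segment_parityCl P Q X Y : segment_parity Q P X Y = segment_parity P Q X Y.
Proof. by rewrite /segment_parity !(rayC Q P) [ray X Y Q (+) _]addbC [_ (+) (lexlt P X (+) _)]addbC. Qed.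

Lemma segment_parityCr P Q X Y : segment_parity P Q Y X = segment_parity P Q X Y.
Proof.
by rewrite /segment_parity !(rayC Y X) [ray P Q Y (+) _]addbC [lexlt P Y (+) _]addbC
  [lexlt Q Y (+) _]addbC.
Qed.

Lemma segment_parity_sym P Q X Y : disjoint_segments P Q X Y ->
  segment_parity X Y P Q = segment_parity P Q X Y.
Proof.
case/disjoint_segments_ends=> nPX nPY nQX nQY; rewrite /segment_parity.
rewrite (lexlt_anti nPX) (lexlt_anti nPY) (lexlt_anti nQX) (lexlt_anti nQY).
move: (ray X Y P) (ray X Y Q) (ray P Q X) (ray P Q Y).
by move: (lexlt X P) (lexlt Y P) (lexlt X Q) (lexlt Y Q); do 8!case.
Qed.

Theorem disjoint_segments_parity P Q X Y : disjoint_segments P Q X Y ->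
  segment_parity P Q X Y = false.
Proof.
have rayxx U V : ray U U V = false by rewrite /ray addbb.
wlog PQ : P Q / lexlt P Q.
  move=> H dis; have [<-|ne] := eqVneq P Q.
    by rewrite /segment_parity !rayxx !addbb.
  case PQ: (lexlt P Q); first exact: H.
  rewrite -segment_parityCl; apply: H (disjoint_segments_rev dis).
  by rewrite (@lexlt_anti Q P) 1?eq_sym ?PQ.
wlog XY : X Y / lexlt X Y.
  move=> H dis; have [<-|ne] := eqVneq X Y.
    by rewrite /segment_parity !rayxx !addbb.
  case XY: (lexlt X Y); first exact: H.
  have dis' := disjoint_segments_sym (disjoint_segments_rev (disjoint_segments_sym dis)).
  rewrite -segment_parityCr; apply: H dis'.
  by rewrite (@lexlt_anti Y X) 1?eq_sym ?XY.
move=> dis; case PX: (lexlt P X); first exact: segment_parity_sorted.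
rewrite -segment_parity_sym //; apply: segment_parity_sorted (disjoint_segments_sym dis) _ _ _ => //.
by have [nPX _ _ _] := disjoint_segments_ends dis; rewrite (@lexlt_anti X P) 1?eq_sym ?PX.
Qed.

Definition chain_ray (c : nat -> R * R) n X := \big[addb/false]_(i < n) ray (c i) (c i.+1) X.

Lemma chain_ray0 c X : chain_ray c 0 X = false.
Proof. exact: big_ord0. Qed.

Lemma chain_rayS c n X : chain_ray c n.+1 X = chain_ray c n X (+) ray (c n) (c n.+1) X.
Proof. exact: big_ord_recr. Qed.

(** The equations of all pairs of segments are added; the terms at inner vertices of either chain
    occur twice and cancel. *)
Lemma chain_parity (c d : nat -> R * R) n m :
  (forall i j, (i < n)%N -> (j < m)%N -> disjoint_segments (c i) (c i.+1) (d j) (d j.+1)) ->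
  (chain_ray c n (d 0) (+) chain_ray c n (d m))
    (+) (chain_ray d m (c 0) (+) chain_ray d m (c n))
    (+) ((lexlt (c 0) (d 0) (+) lexlt (c 0) (d m)) (+) (lexlt (c n) (d 0) (+) lexlt (c n) (d m)))
  = false.
Proof.
move=> dis.
have row j k : (j < m)%N -> (k <= n)%N ->
  (chain_ray c k (d j) (+) chain_ray c k (d j.+1))
    (+) (ray (d j) (d j.+1) (c 0) (+) ray (d j) (d j.+1) (c k))
    (+) ((lexlt (c 0) (d j) (+) lexlt (c 0) (d j.+1))
         (+) (lexlt (c k) (d j) (+) lexlt (c k) (d j.+1))) = false.
  move=> jm; elim: k => [_|k IH kn]; first by rewrite !chain_ray0 !addbb.
  move: (IH (ltnW kn)) (disjoint_segments_parity (dis k j kn jm)).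
  rewrite /segment_parity !chain_rayS.
  rewrite [(chain_ray c k _ (+) _) (+) (_ (+) ray (c k) _ _)]addbACA.
  move: (_ (+) _) (ray _ _ (d j) (+) _) (ray _ _ (c 0)) (ray _ _ (c k)) (ray _ _ (c k.+1))
    (lexlt (c 0) _ (+) _) (lexlt (c k) _ (+) _) (lexlt (c k.+1) _ (+) _).
  by do 8!case.
suff col k : (k <= m)%N ->
  (chain_ray c n (d 0) (+) chain_ray c n (d k))
    (+) (chain_ray d k (c 0) (+) chain_ray d k (c n))
    (+) ((lexlt (c 0) (d 0) (+) lexlt (c 0) (d k)) (+) (lexlt (c n) (d 0) (+) lexlt (c n) (d k)))
  = false by apply: col.
elim: k => [_|k IH km]; first by rewrite !chain_ray0 !addbb.
move: (IH (ltnW km)) (row k n km (leqnn _)).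
rewrite !chain_rayS [(chain_ray d k _ (+) _) (+) (_ (+) ray (d k) _ _)]addbACA.
move: (chain_ray d k _ (+) _) (ray _ _ _ (+) _) (chain_ray c n _) (chain_ray c n _) (chain_ray c n _).
move: (lexlt (c 0) _) (lexlt (c 0) _) (lexlt (c 0) _) (lexlt (c n) _) (lexlt (c n) _) (lexlt (c n) _).
by do 11!case.
Qed.
End Segments.

(** * Plane drawings *)

From mathcomp Require Import classical_sets reals interval_inference prodnormedzmodule topology normedtype.
Import numFieldNormedType.Exports.
Local Open Scope classical_set_scope.
Local Open Scope ring_scope.

(** * Polygonal approximation of arcs *)

Section Arcs.
Variable R : realType.
Implicit Types (g h : R -> R * R) (s t eps : R).

Lemma within_close g s eps : {within `[0, 1], continuous g} -> 0 <= s <= 1 -> 0 < eps ->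
  exists2 eta, 0 < eta & forall s', 0 <= s' <= 1 -> `|s - s'| < eta ->
    `|(g s).1 - (g s').1| < eps /\ `|(g s).2 - (g s').2| < eps.
Proof.
move=> /subspace_continuousP/(_ s) cg s01 e0.
have /cg/cvgrPdist_lt/(_ _ e0) : s \in `[0, 1] by rewrite in_itv.
rewrite near_withinE => /nbhs_ballP[eta /= eta0 H]; exists eta => // s' s'01 near.
have := H s' near; rewrite /= in_itv /= => /(_ s'01).
by rewrite prod_normE /= gt_max => /andP.
Qed.

Lemma segment_close (a b c eps t : R) : `|c - a| < eps -> `|c - b| < eps -> 0 <= t <= 1 ->
  `|c - (a + t * (b - a))| < eps.
Proof.
rewrite !ltr_norml => /andP[H1 H2] /andP[H3 H4] /andP[t0 t1].
have [->|n0] := eqVneq t 0; first by apply/andP; split; lra.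
have {}t0 : 0 < t by rewrite lt_def n0.
have := ltr_pM2l t0 (c - b) eps; have := ltr_pM2l t0 (- eps) (c - b); rewrite H3 H4 => K3 K4.
have s0 : 0 <= 1 - t by lra.
have := ler_wpM2l s0 (ltW H1); have := ler_wpM2l s0 (ltW H2) => K1 K2.
by apply/andP; split; lra.
Qed.

(** Near parameters (s, t) the arcs stay in disjoint squares around g s and h t; squares are convex,
    so they also contain short chords. Compactness of the parameter square makes the number of
    chords uniform. *)
Lemma chains_disjoint g h :
  {within `[0, 1], continuous g} -> {within `[0, 1], continuous h} ->
  (forall s t, 0 <= s <= 1 -> 0 <= t <= 1 -> g s <> h t) ->
  \forall n \near \oo, forall i j, (i < n.+1)%N -> (j < n.+1)%N ->
    disjoint_segments (g (i%:R / n.+1%:R)) (g (i.+1%:R / n.+1%:R))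
                      (h (j%:R / n.+1%:R)) (h (j.+1%:R / n.+1%:R)).
Proof.
move=> cg ch dis.
have in01 n k : (k <= n.+1)%N -> 0 <= (k%:R / n.+1%:R : R) <= 1.
  by move=> kn; rewrite divr_ge0 //= ler_pdivrMr ?mul1r ?ler_nat.
have cK : compact ([set` `[0, 1 : R]] `*` [set` `[0, 1 : R]]).
  by apply: compact_setX; apply: segment_compact.
(* The covering property concerns all points [q] of the parameter square; the two equations restrict
   it to the grid. *)
have := (compact_near_coveringP _).1 cK nat \oo (fun n q => forall i j,
  (i < n.+1)%N -> (j < n.+1)%N -> i%:R / n.+1%:R = q.1 -> j%:R / n.+1%:R = q.2 ->
    disjoint_segments (g (i%:R / n.+1%:R)) (g (i.+1%:R / n.+1%:R))
                      (h (j%:R / n.+1%:R)) (h (j.+1%:R / n.+1%:R))) _.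
case.
  case=> s t [/=]; rewrite !in_itv /= => s01 t01.
  have [eps e0 far] : exists2 eps, 0 < eps & forall a b : R * R,
      `|(g s).1 - a.1| < eps -> `|(g s).2 - a.2| < eps ->
      `|(h t).1 - b.1| < eps -> `|(h t).2 - b.2| < eps -> a <> b.
    have half (a b : R) : a != b -> exists2 eps, 0 < eps &
        forall c : R, `|a - c| < eps -> `|b - c| < eps -> False.
      move=> ab; exists (`|a - b| / 2); first by rewrite divr_gt0 // normr_gt0 subr_eq0.
      by move=> c; rewrite (distrC b) => H1 H2; have := ler_distD c a b; lra.
    have [E|/half[eps e0 H]] := eqVneq (g s).1 (h t).1; last first.
      by exists eps => // a b a1 _ b1 _ E; apply: H a1 _; rewrite E.
    have [E'|/half[eps e0 H]] := eqVneq (g s).2 (h t).2; last first.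
      by exists eps => // a b _ a1 _ b1 E'; apply: H a1 _; rewrite E'.
    by case: (dis _ _ s01 t01); move: E E'; case: (g s) (h t) => ? ? [? ?] /= -> ->.
  have [eta1 eta10 G1] := within_close cg s01 e0.
  have [eta2 eta20 G2] := within_close ch t01 e0.
  (* One half for the distance to the first end of a chord, one for the step to its second end. *)
  pose eta := Num.min eta1 eta2 / 2.
  have eta0 : 0 < eta by rewrite divr_gt0 // lt_min eta10.
  have le1 : eta + eta <= eta1 by rewrite -splitr ge_min lexx.
  have le2 : eta + eta <= eta2 by rewrite -splitr ge_min lexx orbT.
  have step n k : (n.+1%:R^-1 : R) < eta -> forall c, `|c - k%:R / n.+1%:R| < eta ->
      `|c - k.+1%:R / n.+1%:R| < eta + eta.
    move=> small c close; have -> : k.+1%:R / n.+1%:R = k%:R / n.+1%:R + n.+1%:R^-1 :> R.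
      by rewrite -natr1 mulrDl mul1r.
    have p0 : 0 < (n.+1%:R^-1 : R) by rewrite invr_gt0.
    move: (k%:R / n.+1%:R : R) (n.+1%:R^-1 : R) p0 small close => a b p0 small.
    by rewrite !ltr_norml => /andP[? ?]; apply/andP; split; lra.
  exists ([set q | `|s - q.1| < eta /\ `|t - q.2| < eta], [set n | n.+1%:R^-1 < eta]) => /=.
    split; last exact: (near_infty_natSinv_lt (PosNum eta0)).
    apply/nbhs_ballP; exists eta => // -[q1 q2] [] //.
  case=> -[q1 q2] n /= [[close1 close2] small] i j iN jN E1 E2 a b a01 b01.
  rewrite -E1 in close1; rewrite -E2 in close2.
  have lt1 : eta < eta + eta by rewrite ltrDl.
  have [A1 A2] := G1 _ (in01 _ _ (ltnW iN)) (lt_le_trans (lt_trans close1 lt1) le1).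
  have [B1 B2] := G2 _ (in01 _ _ (ltnW jN)) (lt_le_trans (lt_trans close2 lt1) le2).
  have [A3 A4] := G1 _ (in01 _ _ iN) (lt_le_trans (step _ _ small _ close1) le1).
  have [B3 B4] := G2 _ (in01 _ _ jN) (lt_le_trans (step _ _ small _ close2) le2).
  by apply: far; apply: segment_close.
move=> N _ HN; exists N => // n Nn i j iN jN.
apply: (HN n Nn (i%:R / n.+1%:R, j%:R / n.+1%:R)) => //.
by split; rewrite /= in_itv /=; apply: in01; apply: ltnW.
Qed.
End Arcs.

(** Arcs of edges without a common end are disjoint: a common point would be the image of a vertex,
    and this vertex an end of both edges. There are finitely many such pairs, so one number of
    segments serves all of them and each edge gets a single polygon. *)
Theorem Planar_Kfree (R : realType) (G : sgraph) : Planar R G ->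
  Kfree (@adj G) [set: G]%SET.
Proof.
case=> p [a [pinj arcs thru meet]].
pose arc_of (q : G * G) (f : R -> R * R) := [/\ {within `[0, 1], continuous f}, f 0 = p q.1,
  f 1 = p q.2 & forall s, 0 <= s <= 1 -> a [set q.1; q.2]%SET (f s)].
have [g gP] : {g : G * G -> R -> R * R & forall q, adj q.1 q.2 -> arc_of q (g q)}.
  apply: (@choice _ _ (fun q f => adj q.1 q.2 -> arc_of q f)) => -[u v] /=.
  case uv: (adj u v); last by exists (fun _ => (0, 0)).
  have [f [cf _ f0 f1 E]] := arcs _ _ uv; exists f => _; split=> // s s01.
  by rewrite E; exists s => //=; rewrite in_itv.
pose indep (q : (G * G) * (G * G)) := [&& adj q.1.1 q.1.2, adj q.2.1 q.2.2,
  q.1.1 != q.2.1, q.1.1 != q.2.2, q.1.2 != q.2.1 & q.1.2 != q.2.2].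
have : \forall n \near \oo, forall q, indep q -> forall i j, (i < n.+1)%N -> (j < n.+1)%N ->
    disjoint_segments (g q.1 (i%:R / n.+1%:R)) (g q.1 (i.+1%:R / n.+1%:R))
                      (g q.2 (j%:R / n.+1%:R)) (g q.2 (j.+1%:R / n.+1%:R)).
  apply: filter_forall => -[[u v] [x y]] /=.
  case ind: (indep _); last exact: nearW.
  case/and5P: ind => /= uv xy ux uy /andP[vx vy].
  have [cg _ _ ga] := gP (u, v) uv; have [ch _ _ ha] := gP (x, y) xy.
  apply: filterS (chains_disjoint cg ch _) => [n H _ //|s t s01 t01 E].
  have hit : a [set x; y]%SET (g (u, v) s) by rewrite E; exact: ha.
  have ne : [set u; v]%SET != [set x; y]%SET.
    apply: contraNneq ux => /setP/(_ u); rewrite !inE eqxx /= => /esym/orP[//|].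
    by rewrite (negPf uy).
  have [w _ pw] := meet _ _ _ _ uv xy ne _ (conj (ga _ s01) hit).
  have [] : w = u \/ w = v by apply: thru uv _; rewrite pw; exact: ga.
    move=> wu; have [] : w = x \/ w = y by apply: thru xy _; rewrite pw.
      by apply/eqP; rewrite wu.
    by apply/eqP; rewrite wu.
  move=> wv; have [] : w = x \/ w = y by apply: thru xy _; rewrite pw.
    by apply/eqP; rewrite wv.
  by apply/eqP; rewrite wv.
case/filter_ex=> n Hn.
pose pt q i := g q (i%:R / n.+1%:R).
pose rho u v w := chain_ray (pt (u, v)) n.+1 (p w).
pose th : rel G := fun u v => lexlt (p u) (p v).
have th_anti x y : x != y -> th x y = ~~ th y x.
  by move=> xy; apply: lexlt_anti; rewrite (inj_eq pinj).
have rhoE x y z w : adj x y -> adj z w -> x != z -> x != w -> y != z -> y != w ->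
    parity th (rho x y) x y (rho z w) z w = false.
  move=> xy zw xz xw yz yw.
  have pt0 u v : adj u v -> pt (u, v) 0%N = p u.
    by move=> uv; have [_ E _ _] := gP (u, v) uv; rewrite /pt mul0r.
  have pt1 u v : adj u v -> pt (u, v) n.+1 = p v.
    by move=> uv; have [_ _ E _] := gP (u, v) uv; rewrite /pt divff.
  have := @chain_parity R (pt (x, y)) (pt (z, w)) n.+1 n.+1.
  rewrite !pt0 ?pt1 //; apply=> i j iN jN.
  by apply: (Hn ((x, y), (z, w))) => //; rewrite /indep /= xy zw xz xw yz.
split; [exact: (crossing_K5 (@adj_sym G) th_anti rhoE)|exact: (crossing_K33 (@adj_sym G) th_anti rhoE)].
Qed.

Lemma is_arc_sym (R : realType) (P Q : R * R) A : is_arc P Q A -> is_arc Q P A.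
Proof.
case=> g [cg ig g0 g1 AE]; exists (fun t => g (1 - t)).
have flip (t : R) : t \in `[0, 1] -> 1 - t \in `[0, 1].
  by rewrite !in_itv /= => H; lra.
split; rewrite ?subr0 ?subrr //.
- apply/subspace_continuousP => t t01; apply: cvg_trans (_ : _ --> g (1 - t)).
    apply: cvg_refl.
  move/subspace_continuousP/(_ _ (flip _ t01)): cg => cg.
  apply: (cvg_comp _ _ _ cg).
  move=> U; rewrite /= !nbhs_simpl /=; rewrite /within /= => H.
  have c1 : (fun s : R => 1 - s) @ t --> 1 - t by apply: cvgB; [exact: cvg_cst|exact: cvg_id].
  move/c1: H; rewrite nbhs_simpl /=; apply: filterS => s H s01; apply: H; exact: flip.
- move=> s t s01 t01 /ig E; have := E (flip _ s01) (flip _ t01); lra.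
- rewrite AE; apply/seteqP; split=> [_ [t t01 <-]|_ [t t01 <-]]; exists (1 - t); rewrite ?subKr //;
  exact: flip.
Qed.

Lemma convex_between (R : realFieldType) (a b p q t : R) :
  a < p < b -> a < q < b -> 0 <= t <= 1 -> a < p + (q - p) * t < b.
Proof.
move=> /andP[p1 p2] /andP[q1 q2] /andP[t0 t1].
have [->|n0] := eqVneq t 0; first by rewrite mulr0 addr0 p1.
have {}t0 : 0 < t by rewrite lt_def n0.
have [qa qb] : 0 < t * (q - a) /\ 0 < t * (b - q) by split; rewrite mulr_gt0 ?subr_gt0.
have [pa pb] : 0 <= (1 - t) * (p - a) /\ 0 <= (1 - t) * (b - p).
  by split; rewrite mulr_ge0 ?subr_ge0 // ltW.
by apply/andP; split; lra.
Qed.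

(** * From bars to a plane drawing *)

Section Bump.
Variables (R : realType) (d : R).
Hypothesis d0 : 0 < d.

(** A tent of height 1 over ]-d, d[: the positive part of 1 - |t|/d, written with absolute values so
    that continuity is immediate. *)
Definition bump (t : R) : R := (1 - `|t| / d + `|1 - `|t| / d|) / 2.

Lemma bump_out t : d <= `|t| -> bump t = 0.
Proof.
move=> H; rewrite /bump [`|1 - _|]ler0_norm ?subrr ?mul0r //.
by rewrite subr_le0 ler_pdivlMr ?mul1r.
Qed.

Lemma bump_in t : `|t| <= d -> bump t = 1 - `|t| / d.
Proof.
by move=> H; rewrite /bump [`|1 - _|]ger0_norm ?subr_ge0 ?ler_pdivrMr ?mul1r //; lra.
Qed.

Lemma bump_continuous : continuous bump.
Proof.
have cn (f : R -> R) t : {for t, continuous f} -> {for t, continuous (fun s => `|f s|)}.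
  by move=> cf; apply: continuous_comp cf _; exact: norm_continuous.
have c1 t : {for t, continuous (fun t => 1 - `|t| / d)}.
  apply: continuousB; first exact: cst_continuous.
  by apply: continuousM; [exact: norm_continuous|exact: cst_continuous].
move=> t; rewrite /continuous_at /bump.
apply: (@continuousM _ _ (fun t => 1 - `|t| / d + `|1 - `|t| / d|)); last exact: cst_continuous.
by apply: continuousD; [exact: c1|apply: cn; exact: c1].
Qed.

Lemma bump_bounds t : 0 <= bump t <= 1.
Proof.
have [H|/ltW/bump_out ->] := leP `|t| d; last by rewrite lexx ler01.
have le1 : `|t| / d <= 1 by rewrite ler_pdivrMr ?mul1r.
have ge0 : 0 <= `|t| / d by rewrite divr_ge0 // ltW.
by rewrite bump_in //; lra.
Qed.

Lemma bump_eq1 t : bump t = 1 -> t = 0.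
Proof.
have [/bump_in ->|/ltW/bump_out ->] := leP `|t| d; last by move=> E; lra.
move=> E; have /eqP : `|t| / d = 0 by lra.
by rewrite mulf_eq0 invr_eq0 (gt_eqF d0) orbF normr_eq0 => /eqP.
Qed.
End Bump.

Section BarsPlanar.
Variables (R : realType) (G : sgraph) (y l r : G -> R) (x : G -> G -> R).
Hypothesis barsG : bars (@adj G) [set: G]%SET y l r x.
Implicit Types a b w : G.

Definition centre w := (l w + r w) / 2.

(* Above and below, the curve follows the vertical line at [x a b] except near
   the two bars, where it bends towards their centres. *)
Definition curve d a b h := x a b + (centre a - x a b) * bump d (h - y a)
  + (centre b - x a b) * bump d (h - y b).

(** A set does not order its two elements; the condition on heights leaves one way to name them, so
    the curve is determined by [S]. *)
Definition edge_arc d (S : {set G}) (q : R * R) := exists a b,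
  [/\ S = [set a; b]%SET, adj a b, y a < y b, y a <= q.2 <= y b & q.1 = curve d a b q.2].

(** At heights near the bar of [w] the edges at [w] stay in the interval of [w], while all other
    edges run vertically outside it. Two edges that meet there both end at [w]; they bend from
    different abscissae towards the same centre with the same weight, so they agree only where
    [bump] is 1, at the bar itself. *)
Lemma bars_Planar : Planar R G.
Proof.
case: barsG => yi lr ed sep inj.
have yI a b : y a = y b -> a = b by apply: yi; rewrite inE.
have [d0' d00 gap'] := seq_gap [seq y w | w : G].
(* Half the gap, so that the strips within [d] of different bars are disjoint. *)
pose d := d0' / 2; have d0 : 0 < d by rewrite divr_gt0.
have gap a b : y a < y b -> y a + d + d < y b.
  have yin w : y w \in [seq y w | w : G] by rewrite map_f ?mem_enum.
  by move=> lt; have := gap' _ _ (yin a) (yin b) lt; rewrite /d; lra.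
pose near w h := `|h - y w| < d.
have nearE w h : near w h -> - d < h - y w < d by rewrite /near ltr_norml.
have far a w h : near w h -> a != w -> d <= `|h - y a|.
  move=> /nearE nw aw; rewrite leNgt ltr_norml; apply/negP=> na.
  by case: (ltgtP (y a) (y w)) => [/gap|/gap|/yI/eqP]; [lra|lra|apply/negP].
have near_val a b w h : adj a b -> w \in [set a; b]%SET -> near w h ->
    curve d a b h = x a b + (centre w - x a b) * bump d (h - y w).
  move=> ab; have nab : a != b by apply: contraTneq ab => ->; rewrite adj_irrefl.
  rewrite !inE /curve => /orP[/eqP ->|/eqP ->] nw.
    by rewrite (bump_out d0 (far b _ _ nw _)) 1?eq_sym // mulr0 addr0.
  by rewrite (bump_out d0 (far a _ _ nw _)) // mulr0 addr0.
have far_val a b h : ~~ near a h -> ~~ near b h -> curve d a b h = x a b.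
  by rewrite /near -!leNgt => na nb; rewrite /curve !(bump_out d0) // !mulr0 !addr0.
have xin a b w : adj a b -> w \in [set a; b]%SET -> l w < x a b < r w.
  move=> ab; have [E H] := ed a b (finset.in_setT _) (finset.in_setT _) ab.
  rewrite !inE => /orP[/eqP ->|/eqP ->] //; rewrite E.
  by have [] := ed b a (finset.in_setT _) (finset.in_setT _) (etrans (adj_sym _ _) ab).
have cin w : l w < centre w < r w.
  by have := lr w (finset.in_setT _); rewrite /centre; lra.
have blocked a b w h : adj a b -> y a < y b -> y a <= h <= y b -> near w h ->
    w \notin [set a; b]%SET -> curve d a b h = x a b /\ (x a b < l w \/ r w < x a b).
  move=> ab yab hab nw; rewrite !inE negb_or => /andP[wa wb].
  have na : ~~ near a h by rewrite /near -leNgt (far a w) // eq_sym.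
  have nb : ~~ near b h by rewrite /near -leNgt (far b w) // eq_sym.
  split; first exact: far_val.
  have := nearE _ _ nw => nw'.
  apply: sep; rewrite ?inE //; apply/andP; split.
    by case: (ltgtP (y a) (y w)) => [//|/gap|/yI/esym/eqP]; [lra|rewrite (negPf wa)].
  by case: (ltgtP (y w) (y b)) => [//|/gap|/yI/eqP]; [lra|rewrite (negPf wb)].
have pair_sorted a b a' b' : y a < y b -> y a' < y b' ->
    [set a; b]%SET = [set a'; b']%SET -> a = a' /\ b = b'.
  move=> lt lt' /setP E; have := E a; have := E b; rewrite !inE !eqxx orbT /=.
  move=> /esym/orP[/eqP Eb|/eqP Eb] /esym/orP[/eqP Ea|/eqP Ea] //.
  - by rewrite Ea Eb ltxx in lt.
  - by rewrite -Ea -Eb in lt'; have := lt_trans lt lt'; rewrite ltxx.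
  - by rewrite Ea Eb ltxx in lt.
have near_in a b w h : adj a b -> w \in [set a; b]%SET -> near w h ->
    l w < curve d a b h < r w.
  move=> ab wab nw; rewrite (near_val _ _ _ _ ab wab nw).
  exact: convex_between (xin _ _ _ ab wab) (cin w) (bump_bounds d0 _).
exists (fun w => (centre w, y w)), (edge_arc d); split.
- by move=> a b [_ /yI].
- have up a b : adj a b -> y a < y b -> is_arc (centre a, y a) (centre b, y b) (edge_arc d [set a; b]%SET).
    move=> ab yab; pose Y t : R := y a + t * (y b - y a).
    have nab : a != b by apply: contraTneq ab => ->; rewrite adj_irrefl.
    have nearw w : near w (y w) by rewrite /near subrr normr0.
    have bump0 : bump d 0 = 1 by rewrite bump_in ?normr0 ?mul0r ?subr0 // ltW.
    have cY t : {for t, continuous Y}.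
      apply: continuousD; first exact: cst_continuous.
      by apply: continuousM; [exact: cvg_id|exact: cst_continuous].
    have cB w t : {for t, continuous (fun t => bump d (Y t - y w))}.
      apply: continuous_comp; last exact: bump_continuous.
      by apply: continuousB; [exact: cY|exact: cst_continuous].
    have cC t : {for t, continuous (fun t => curve d a b (Y t))}.
      apply: continuousD; last by apply: continuousM; [exact: cst_continuous|exact: cB].
      apply: continuousD; first exact: cst_continuous.
      by apply: continuousM; [exact: cst_continuous|exact: cB].
    exists (fun t => (curve d a b (Y t), Y t)); split.
    + apply: continuous_subspaceT => t.
      exact: (@cvg_pair _ _ _ (nbhs t) (nbhs (curve d a b (Y t))) (nbhs (Y t)) _ _ _ _ _ (cC t) (cY t)).
    + move=> s t _ _ [_ /addrI]; apply: mulIf; lra.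
    + rewrite /Y mul0r addr0 (near_val _ _ a) ?inE ?eqxx //.
      by rewrite subrr bump0 mulr1 addrC subrK.
    + rewrite /Y mul1r addrC subrK (near_val _ _ b) ?inE ?eqxx ?orbT //.
      by rewrite subrr bump0 mulr1 addrC subrK.
    + apply/seteqP; split=> [q [a' [b' [E a'b' ya'b' hq Eq]]]|_ [t t01 <-]].
        have [Ea Eb] := pair_sorted _ _ _ _ yab ya'b' E; rewrite -Ea -Eb in hq Eq.
        exists ((q.2 - y a) / (y b - y a)).
          by rewrite /= in_itv /= ler_pdivlMr ?ler_pdivrMr ?subr_gt0 //; lra.
        rewrite /Y divfK ?subr_eq0 ?gt_eqF // addrC subrK -Eq.
        by case: (q).
      exists a, b; split=> //=; rewrite /Y; move: t01; rewrite /= in_itv /= => /andP[t0 t1].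
      have ? : 0 < y b - y a by lra.
      by apply/andP; split; nra.
  move=> a b ab; case: (ltgtP (y a) (y b)) => [lt|gt|/yI E]; first exact: up.
    by rewrite finset.setUC; apply: is_arc_sym; apply: up; rewrite // adj_sym.
  by rewrite E adj_irrefl in ab.
- move=> a b w _ [a' [b' [S ab yab hab E]]]; rewrite /= in hab E.
  have nw : near w (y w) by rewrite /near subrr normr0.
  case wab: (w \in [set a'; b']%SET).
    by move: wab; rewrite -S !inE => /orP[/eqP|/eqP]; [left|right].
  have [E' H] := blocked _ _ _ _ ab yab hab nw (negbT wab).
  have /andP[K1 K2] := cin w; rewrite E E' in K1 K2.
  by case: H => H; [have := lt_trans H K1|have := lt_trans H K2]; rewrite ltxx.
- move=> u v u' v' _ _ ne q [[a [b [S ab yab hab E]]] [a' [b' [S' ab' yab' hab' E']]]].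
  rewrite {}S {}S' in ne.
  have xne : x a b != x a' b'.
    apply: contraNneq ne => /(inj a b (finset.in_setT _) (finset.in_setT _) a' b'
      (finset.in_setT _) (finset.in_setT _) ab ab').
    by case/orP=> /andP[/eqP -> /eqP ->] //; rewrite finset.setUC.
  have clash w c e c' e' : adj c e -> adj c' e' -> y c' < y e' -> y c' <= q.2 <= y e' ->
      curve d c e q.2 = curve d c' e' q.2 -> near w q.2 ->
      w \in [set c; e]%SET -> w \in [set c'; e']%SET.
    move=> ce ce' yce' hce' EE nw wce; apply/negPn/negP=> nwce.
    have [E1 H] := blocked _ _ _ _ ce' yce' hce' nw nwce.
    have /andP[K1 K2] := near_in _ _ _ _ ce wce nw; rewrite EE E1 in K1 K2.
    by case: H => H; [have := lt_trans H K1|have := lt_trans H K2]; rewrite ltxx.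
  have EE : curve d a b q.2 = curve d a' b' q.2 by rewrite -E -E'.
  have finish w : near w q.2 -> w \in [set a; b]%SET -> range (fun w => (centre w, y w)) q.
    move=> nw wS; have wS' := clash _ _ _ _ _ ab ab' yab' hab' EE nw wS.
    have Ew := near_val _ _ _ _ ab wS nw.
    move: EE; rewrite Ew (near_val _ _ _ _ ab' wS' nw) => EE'.
    have /eqP : (1 - bump d (q.2 - y w)) * (x a b - x a' b') = 0 by lra.
    rewrite mulf_eq0 [x a b - _ == 0]subr_eq0 (negPf xne) orbF subr_eq0 eq_sym => /eqP B1.
    have hw : q.2 = y w by apply/eqP; rewrite -subr_eq0 (bump_eq1 d0 B1).
    exists w => //; rewrite [RHS]surjective_pairing E Ew B1 hw mulr1.
    by congr (_, _); rewrite addrC subrK.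
  case na: (near a q.2); first by apply: finish na _; rewrite !inE eqxx.
  case nb: (near b q.2); first by apply: finish nb _; rewrite !inE eqxx orbT.
  have nn w : w \in [set a'; b']%SET -> ~~ near w q.2.
    move=> wS'; apply/negP=> nw; move: (clash w _ _ _ _ ab' ab yab hab (esym EE) nw wS').
    by rewrite !inE => /orP[]/eqP Ew; [move: na|move: nb]; rewrite -Ew nw.
  move: EE; rewrite !far_val ?na ?nb ?nn ?inE ?eqxx ?orbT // => EE.
  by rewrite EE eqxx in xne.
Qed.
End BarsPlanar.

(** * The two directions of the equivalence *)

Lemma Free_Planar_Kfree (R : realType) (G : sgraph) (u v : G) :
  Free (Planar R) G -> u != v -> Kfree (plus_edge (@adj G) u v) [set: G]%SET.
Proof.
case=> planarG freeG uv; case uvG: (adj u v); last first.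
  by apply: (@Planar_Kfree R (add_edge u v)); apply: freeG; rewrite ?uvG.
have sub : subrel (plus_edge (@adj G) u v) (@adj G).
  by move=> x y /andP[_ /orP[//|/orP[]/andP[/eqP -> /eqP ->]]]; rewrite // adj_sym.
by have [no5 no33] := Planar_Kfree planarG; split=> /(has_model_mono sub).
Qed.

Lemma missing_edge_not_minor (R : realType) (G : sgraph) (K : sgraph) (a b : K) :
  Free (Planar R) G -> a != b ->
  (forall u v : G, u != v -> ~ has_model (@adj K) (plus_edge (@adj G) u v) [set: G]%SET) ->
  ~ minor (del_edge a b) G.
Proof.
move=> freeG ab no /minor_has_model.
case/(has_model_missing_edge (@adj_irrefl G) (k' := @adj K) _ ab) => [i j ij|u [v [uv]]].
  change ((@adj K i j && ~~ same_pair a b i j) || same_pair a b i j).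
  by rewrite ij; case: same_pair.
exact: no.
Qed.

Lemma excluded_minors_Kfree (G : sgraph) (u v : G) : u != v ->
  excluded_minors (fun H => H = K5_minus \/ H = K33_minus) G ->
  Kfree (plus_edge (@adj G) u v) [set: G]%SET.
Proof.
move=> uv excl.
have no33 : ~ has_model (@adj K33_minus) (@adj G) [set: G]%SET.
  by move/has_model_minor; apply: excl; right.
split=> [/(K5_plus_edge (@adj_sym G))[|//]|/(K33_plus_edge (@adj_sym G))//].
by move/has_model_minor; apply: excl; left.
Qed.

Lemma excluded_minors_bars (R : realType) (G : sgraph) (u v : G) : u != v ->
  excluded_minors (fun H => H = K5_minus \/ H = K33_minus) G ->
  exists y l r x, bars (R := R) (plus_edge (@adj G) u v) [set: G]%SET y l r x.
Proof.
move=> uv /(excluded_minors_Kfree uv) free.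
have uz : plus_edge (@adj G) u v u v by apply/andP; split=> //; rewrite /same_pair !eqxx orbT.
have [y [l [r [x [bG _]]]]] := Kfree_barrep R (@add_edge_sym G u v) (@add_edge_irrefl G u v) free
  (finset.in_setT u) (finset.in_setT v) uz.
by exists y, l, r, x.
Qed.

Theorem theorem1 (R : realType) (G : sgraph) :
  Free (Planar R) G <->
  excluded_minors (fun H => H = K5_minus \/ H = K33_minus) G.
Proof.
split=> [freeG H [->|->]|excl].
- apply: (missing_edge_not_minor freeG) => // u v uv.
  by have [] := Free_Planar_Kfree freeG uv.
- apply: (missing_edge_not_minor freeG) => // u v uv.
  by have [] := Free_Planar_Kfree freeG uv.
split=> [|u v uv _].
  (* [G] itself is drawn as a subgraph of some $G+uv$; with fewer than two vertices there is no edge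
     to draw. *)
  have [[u [v uv]]|single] := pselect (exists u v : G, u != v).
    have [y [l [r [x bG]]]] := excluded_minors_bars R uv excl.
    apply: (bars_Planar (bars_sub (finset.subsetT _) _ bG)) => a b _ _ ab.
    apply/andP; split; last by apply/orP; left.
    by apply: contraTneq ab => ->; rewrite adj_irrefl.
  have [|y [l [r [x bG]]]] := @bars_edgeless R _ (@adj G) [set: G]%SET.
    move=> a b _ _; apply/negP=> ab; apply: single; exists a, b.
    by apply: contraTneq ab => ->; rewrite adj_irrefl.
  exact: bars_Planar bG.
have [y [l [r [x bG]]]] := excluded_minors_bars R uv excl.
exact: (@bars_Planar R (add_edge u v) _ _ _ _ bG).
Qed.
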